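(* Let $n_1,\dots,n_d \geq 1$ be positive integers such that $n_i/n_j$ is not an integral power of $p$ for each $i \neq j$. For each $i$ take polynomials $u_{i1},\dots,u_{ir_i} \in \overline{K}[t]$ with $\|u_{ij}\|_\infty < |\theta|_\infty^{n_i q/(q-1)}$ for $j=1,\dots,r_i$. If for each $i$ the elements $\tilde{\pi}^{n_i}, L_{u_{i1},n_i}(\theta),\dots,L_{u_{ir_i},n_i}(\theta)$ are linearly independent over $K$, then the $1+\sum_{i=1}^d r_i$ elements $\tilde{\pi}$, $L_{u_{ij},n_i}(\theta)$ ($1 \leq i \leq d$, $1 \leq j \leq r_i$) are algebraically independent over $\overline{K}$.
   Context: Let $\mathbb{F}_q$ be the finite field with $q$ elements, $p$ its characteristic, $K = \mathbb{F}_q(\theta)$, $K_\infty = \mathbb{F}_q((\theta^{-1}))$ with absolute value $|\cdot|_\infty$ ($|\theta|_\infty>1$), $\mathbb{C}_\infty$ the completion of an algebraic closure of $K_\infty$, $\overline{K}$ the algebraic closure of $K$ in $\mathbb{C}_\infty$, and $t$ a variable independent of $\theta$. Fixing a $(q-1)$-st root of $-\theta$, $\tilde{\pi} = (-\theta)^{q/(q-1)} \prod_{i=1}^\infty (1-\theta^{1-q^i})^{-1}$. For $u = \sum_j \alpha_j t^j \in \overline{K}[t]$ put $\|u\|_\infty = \max_j |\alpha_j|_\infty$ and, for $i \geq 0$, $u^{(i)} = \sum_j \alpha_j^{q^i} t^j$. For a positive integer $n$ and $u \in \overline{K}[t]$ with $\|u\|_\infty < |\theta|_\infty^{nq/(q-1)}$,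 set $$L_{u,n}(t) = \sum_{i \geq 0} \frac{u^{(i)}}{\big((t-\theta^q)(t-\theta^{q^2})\cdots(t-\theta^{q^i})\big)^n}$$ (empty product $=1$ for $i=0$), a power series in $t$ converging on $|t|_\infty < |\theta|_\infty^q$; $L_{u,n}(\theta)$ denotes its value at $t=\theta$. *)

(* Defs.v *)
From HB Require Import structures.
From mathcomp Require Import all_boot all_order all_algebra.
From mathcomp Require Import reals.
From mathcomp Require Import mpoly.

Set Implicit Arguments.
Unset Strict Implicit.
Unset Printing Implicit Defensive.

Import Order.TTheory GRing.Theory Num.Theory.
Local Open Scope ring_scope.

Section CinftyDefs.
Variables (R : realType) (C : closedFieldType) (abs : C -> R) (q : nat) (theta : C).

(* F_q inside C: the roots of X^q - X (in char p, q = p^e, C alg. closed). *)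
Definition inFq (a : C) : Prop := a ^+ q = a.
Definition polyFq (a : {poly C}) : Prop := forall j, inFq a`_j.

Definition inK (x : C) : Prop :=
  exists a b : {poly C}, [/\ polyFq a, polyFq b, b != 0 & x = a.[theta] / b.[theta]].
Definition polyK (P : {poly C}) : Prop := forall j, inK P`_j.

Definition inKbar (x : C) : Prop :=
  exists P : {poly C}, [/\ polyK P, P != 0 & root P x].
Definition polyKbar (P : {poly C}) : Prop := forall j, inKbar P`_j.

Definition nonarch_abs : Prop :=
  [/\ (forall x, 0 <= abs x), (forall x, abs x = 0 <-> x = 0),
      (forall x y, abs (x * y) = abs x * abs y)
    & (forall x y, abs (x + y) <= Num.max (abs x) (abs y))].

Definition cvg_abs (s : nat -> C) (l : C) : Prop :=
  forall eps : R, 0 < eps -> exists N, forall m, (N <= m)%N -> abs (s m - l) < eps.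

Definition cauchy_abs (s : nat -> C) : Prop :=
  forall eps : R, 0 < eps -> exists N, forall m k, (N <= m)%N -> (N <= k)%N ->
    abs (s m - s k) < eps.

(* (C, abs, theta) is a model of C_infty: C is an algebraically closed field of
   characteristic p, q = p^e (e >= 1), abs is a non-archimedean absolute value
   whose restriction to K = F_q(theta) is the infinite place (|a(theta)| =
   |theta|^(deg a) for a in F_q[theta], |theta| > 1), C is complete, and the
   algebraic closure of K is dense in C.  These properties characterize C_infty
   (the completion of an algebraic closure of K_infty) up to isometric
   K-isomorphism. *)
Definition Cinfty_model (p : nat) : Prop :=
  [/\ prime p /\ p \in [pchar C],
      (exists e, (0 < e)%N /\ q = (p ^ e)%N),
      nonarch_abs /\ 1 < abs theta,
      (forall a : {poly C}, polyFq a -> a != 0 -> abs a.[theta] = abs theta ^+ (size a).-1)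
    & (forall s, cauchy_abs s -> exists l, cvg_abs s l) /\
      (forall x (eps : R), 0 < eps -> exists y, inKbar y /\ abs (x - y) < eps)].

Definition twist (i : nat) (u : {poly C}) : {poly C} :=
  map_poly (fun a => a ^+ (q ^ i)) u.

Definition normp (u : {poly C}) : R := \big[Num.max/0]_(j < size u) abs u`_j.

Definition Lterm (n : nat) (u : {poly C}) (i : nat) : C :=
  (twist i u).[theta] / (\prod_(1 <= k < i.+1) (theta - theta ^+ (q ^ k))) ^+ n.

Definition Lpartial (n : nat) (u : {poly C}) (N : nat) : C :=
  \sum_(i < N) Lterm n u i.

Definition pi_partial (xi : C) (N : nat) : C :=
  xi ^+ q * \prod_(1 <= i < N.+1) (1 - theta / theta ^+ (q ^ i))^-1.

End CinftyDefs.

Section Indep.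
Variable (C : fieldType).

Definition lin_indep_over (P : C -> Prop) (I : finType) (x : I -> C) : Prop :=
  forall c : I -> C, (forall k, P (c k)) -> \sum_k c k * x k = 0 -> forall k, c k = 0.

Definition alg_indep_over (P : C -> Prop) (I : finType) (x : I -> C) : Prop :=
  forall F : {mpoly C[#|I|]}, (forall m, P F@_m) -> F != 0 ->
    F.@[fun k => x (enum_val k)] != 0.

End Indep.

(* Main.v *)
(** Write [phi] for the twist raising the coefficients of a power series in [t]
    to the [q]-th power, and [T = t - theta^q].  The deformations [f] of the
    period and of the [L_{u,n}(theta)] converge beyond [|t| = |theta|] and satisfy
    [phi f = T^n (f + v)] with polynomial [v] (namely [n = 1], [v = 0] for the
    period and [v = - u] otherwise).

    Functions to values.  Any relation between values at [theta] of solutions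
    [psi] of a polynomial system [phi psi = Phi psi], linearly independent over
    [C(t)], saves one unknown in each interpolation condition at the points
    [theta^(q^mu)].  Siegel's lemma gives a combination [G] of the components
    of [phi^M psi], with coefficients of small height, having more zeros than
    degree, so that its coefficients are tiny by the Schwarz lemma.  But [G]
    satisfies an equation [sum_i A_i phi^i G = 0] with [A_i] of small height (by
    Siegel's lemma again), and comparing lowest coefficients bounds the lowest
    coefficient of [G] from below.  Applied to all monomials of bounded degree,
    this reduces the theorem to the algebraic independence of the functions.

    Independence of functions.  A relation with minimal leading monomial is a
    semi-invariant of the twist.  Hasse derivatives preserve semi-invariants, so
    by induction on the degree a semi-invariant is a sum of terms [c x_k^(p^a)];
    comparing degrees in [t] forces [n_k p^a] to be constant, hence, by the
    hypothesis on the [n_i], a single index [i] and a single [a] occur.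
    Extracting [p]-th roots one may take [a = 0]; then
    [Z = sum_j c_j L_ij + Q] with [c_j] in [F_q[t]] solves [phi Z = T^n Z], so it
    is [g Pi^n] with [g] in [F_q[[t]]], a polynomial by convergence.  Its value
    at [theta] is a linear relation excluded by the hypothesis. *)
Require Import Defs.
From HB Require Import structures.
From mathcomp Require Import all_boot all_order all_algebra.
From mathcomp Require Import boolp reals.
From mathcomp Require Import mpoly.
From mathcomp Require Import zify ring lra.

Set Implicit Arguments.
Unset Strict Implicit.
Unset Printing Implicit Defensive.

Import Order.TTheory GRing.Theory Num.Theory.
Local Open Scope ring_scope.

(** * Formal power series and Frobenius twists *)

(** In the transfer to values, smallness asks for more zeros than the degree of the coefficients,
    Siegel's lemma for more unknowns than equations. With [l] components these demands clash until
    one value is eliminated; then zeros and degree in the ratio [2l : 2l - 1] meet both. All heights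
    are multiples of [Q = q^M1] by constants independent of the excess [s] of zeros over degree, so
    after a [Q]-th root the gain [rho^-s] beats a fixed constant. Heights are degrees of coordinates
    in an order over [F_q[theta]]: Siegel's lemma is linear algebra over [F_q], and so is the
    Liouville inequality.

    In the independence of functions, the period stands apart: the hypothesis compares the [n_i]
    with each other and not with [1], so weights cannot tell the period from an [L] with
    [n_i = p^k]. As its inhomogeneous term is zero, the twist merely rescales it and its exponent is
    carried along unchanged; its inverse disposes of relations in the period alone. Hasse
    derivatives are used because ordinary ones do not see [x^p]. *)

Record series (A : Type) := Series { coefs : nat -> A }.
Arguments Series {A} _.

HB.instance Definition _ (A : Type) := gen_eqMixin (series A).
HB.instance Definition _ (A : Type) := gen_choiceMixin (series A).

Lemma seriesP (A : Type) (f g : series A) : coefs f =1 coefs g -> f = g.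
Proof. by case: f g => f [g] /= /funext ->. Qed.

Section SeriesRing.
Variable A : comNzRingType.
Implicit Types f g h : series A.

Definition ser_trunc (N : nat) f : {poly A} := \poly_(i < N) coefs f i.

Definition ser_zero : series A := Series (fun=> 0).
Definition ser_one : series A := Series (fun k => (k == 0%N)%:R).
Definition ser_opp f : series A := Series (fun k => - coefs f k).
Definition ser_add f g : series A := Series (fun k => coefs f k + coefs g k).
Definition ser_mul f g : series A :=
  Series (fun k => \sum_(i < k.+1) coefs f i * coefs g (k - i)%N).

Lemma ser_addA : associative ser_add.
Proof. by move=> f g h; apply: seriesP => k /=; rewrite addrA. Qed.
Lemma ser_addC : commutative ser_add.
Proof. by move=> f g; apply: seriesP => k /=; rewrite addrC. Qed.
Lemma ser_add0 : left_id ser_zero ser_add.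
Proof. by move=> f; apply: seriesP => k /=; rewrite add0r. Qed.
Lemma ser_addN : left_inverse ser_zero ser_opp ser_add.
Proof. by move=> f; apply: seriesP => k /=; rewrite addNr. Qed.

HB.instance Definition _ :=
  GRing.isZmodule.Build (series A) ser_addA ser_addC ser_add0 ser_addN.

Lemma coef_ser_trunc N f k : (ser_trunc N f)`_k = if (k < N)%N then coefs f k else 0.
Proof. by rewrite coef_poly. Qed.

(** In each degree a product of series is a product of polynomials, so associativity and
    commutativity are inherited from [{poly A}]. *)
Lemma coef_mul_trunc N f g k : (k < N)%N ->
  coefs (ser_mul f g) k = (ser_trunc N f * ser_trunc N g)`_k.
Proof.
move=> kN /=; rewrite coefM; apply: eq_bigr => i _.
have iN : (i < N)%N by apply: leq_trans kN; rewrite ltnS -ltnS.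
by rewrite !coef_ser_trunc iN (leq_ltn_trans (leq_subr _ _) kN).
Qed.

Lemma coef_mul_congr (P P' Q Q' : {poly A}) k :
  (forall i, (i <= k)%N -> P`_i = P'`_i) -> (forall i, (i <= k)%N -> Q`_i = Q'`_i) ->
  (P * Q)`_k = (P' * Q')`_k.
Proof.
move=> hP hQ; rewrite !coefM; apply: eq_bigr => i _.
by rewrite hP ?hQ ?leq_subr // -ltnS.
Qed.

Lemma ser_mulA : associative ser_mul.
Proof.
move=> f g h; apply: seriesP => k.
rewrite !(@coef_mul_trunc k.+1) //.
transitivity ((ser_trunc k.+1 f * (ser_trunc k.+1 g * ser_trunc k.+1 h))`_k).
  apply: coef_mul_congr => // i ik.
  by rewrite coef_ser_trunc ltnS ik (@coef_mul_trunc k.+1).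
rewrite mulrA; apply: coef_mul_congr => // i ik.
by rewrite coef_ser_trunc ltnS ik (@coef_mul_trunc k.+1).
Qed.

Lemma ser_mulC : commutative ser_mul.
Proof.
by move=> f g; apply: seriesP => k; rewrite !(@coef_mul_trunc k.+1) // mulrC.
Qed.

Lemma ser_mul1 : left_id ser_one ser_mul.
Proof.
move=> f; apply: seriesP => k /=; rewrite big_ord_recl /= subn0 mul1r big1 ?addr0 // => i _.
by rewrite mul0r.
Qed.

Lemma ser_mulDl : left_distributive ser_mul ser_add.
Proof.
move=> f g h; apply: seriesP => k /=; rewrite -big_split /=.
by apply: eq_bigr => i _; rewrite mulrDl.
Qed.

Lemma ser_oner_neq0 : ser_one != 0.
Proof.
apply/eqP => /(congr1 (fun f => coefs f 0%N)) /= /eqP; by rewrite oner_eq0.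
Qed.

HB.instance Definition _ :=
  GRing.Zmodule_isComNzRing.Build (series A) ser_mulA ser_mulC ser_mul1 ser_mulDl ser_oner_neq0.

Lemma coefs0 k : coefs (0 : series A) k = 0. Proof. by []. Qed.
Lemma coefs1 k : coefs (1 : series A) k = (k == 0%N)%:R. Proof. by []. Qed.
Lemma coefsD f g k : coefs (f + g) k = coefs f k + coefs g k. Proof. by []. Qed.
Lemma coefsN f k : coefs (- f) k = - coefs f k. Proof. by []. Qed.
Lemma coefsB f g k : coefs (f - g) k = coefs f k - coefs g k. Proof. by []. Qed.
Lemma coefsM f g k :
  coefs (f * g) k = \sum_(i < k.+1) coefs f i * coefs g (k - i)%N.
Proof. by []. Qed.

Lemma coefs_sum (I : Type) (r : seq I) (P : pred I) (F : I -> series A) k :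
  coefs (\sum_(i <- r | P i) F i) k = \sum_(i <- r | P i) coefs (F i) k.
Proof. by elim/big_rec2: _ => // i y x _ <-. Qed.

Definition ser_poly (P : {poly A}) : series A := Series (fun k => P`_k).

Lemma ser_poly_is_zmod : zmod_morphism ser_poly.
Proof. by move=> P Q; apply: seriesP => k /=; rewrite coefB. Qed.

Lemma ser_poly_is_monoid : monoid_morphism ser_poly.
Proof.
split; first by apply: seriesP => k /=; rewrite coef1.
by move=> P Q; apply: seriesP => k /=; rewrite coefM.
Qed.

HB.instance Definition _ := GRing.isZmodMorphism.Build _ _ ser_poly ser_poly_is_zmod.
HB.instance Definition _ := GRing.isMonoidMorphism.Build _ _ ser_poly ser_poly_is_monoid.

Lemma coefs_poly (P : {poly A}) k : coefs (ser_poly P) k = P`_k. Proof. by []. Qed.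

Lemma ser_poly_inj : injective ser_poly.
Proof.
move=> P Q /(congr1 (@coefs A)) E; apply/polyP => k.
by have := congr1 (fun F => F k) E.
Qed.

(** Used twice: series over a field have no zero divisors, and the final contradiction reads off the
    lowest coefficient of a twisted equation. *)
Lemma coefs_ltM f g a b :
  (forall k, (k < a)%N -> coefs f k = 0) -> (forall k, (k < b)%N -> coefs g k = 0) ->
  coefs (f * g) (a + b) = coefs f a * coefs g b.
Proof.
move=> hf hg; rewrite coefsM.
have ha : (a < (a + b).+1)%N by rewrite ltnS leq_addr.
rewrite (bigD1 (Ordinal ha)) //= addKn big1 ?addr0 // => i.
rewrite -val_eqE /= neq_ltn => /orP[ia|ai]; first by rewrite hf // mul0r.
by rewrite hg ?mulr0 // ltn_subLR ?ltn_add2r // -ltnS.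
Qed.

Lemma ser_ord f : f != 0 ->
  exists a, coefs f a != 0 /\ forall k, (k < a)%N -> coefs f k = 0.
Proof.
move=> f0.
have ex : exists k, coefs f k != 0.
  apply: contrapT => /forallNP h; case/eqP: f0; apply: seriesP => k.
  by have /negP := h k; rewrite negbK => /eqP.
exists (ex_minn ex); case: ex_minnP => a ha hmin; split=> // k ka.
by apply/eqP; apply: contraLR ka => /hmin; rewrite -leqNgt.
Qed.

End SeriesRing.

Lemma ser_mulf_eq0 (A : fieldType) (f g : series A) : f * g = 0 -> f != 0 -> g = 0.
Proof.
move=> fg /ser_ord[a [fa hf]]; apply/eqP; apply/negPn/negP => /ser_ord[b [gb hg]].
have := coefs_ltM hf hg; rewrite fg coefs0 => /esym/eqP.
by rewrite mulf_eq0 (negPf fa) (negPf gb).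
Qed.

Section SeriesMap.
Variables (A B : comNzRingType) (g : {rmorphism A -> B}).
Definition ser_map (f : series A) : series B := Series (fun k => g (coefs f k)).

Lemma ser_map_is_zmod : zmod_morphism ser_map.
Proof. by move=> f h; apply: seriesP => k /=; rewrite raddfB. Qed.

Lemma ser_map_is_monoid : monoid_morphism ser_map.
Proof.
split; first by apply: seriesP => k /=; rewrite rmorph_nat.
move=> f h; apply: seriesP => k; rewrite /= rmorph_sum.
by apply: eq_bigr => i _; rewrite rmorphM.
Qed.

HB.instance Definition _ := GRing.isZmodMorphism.Build _ _ ser_map ser_map_is_zmod.
HB.instance Definition _ := GRing.isMonoidMorphism.Build _ _ ser_map ser_map_is_monoid.

Lemma ser_map_poly (P : {poly A}) : ser_map (ser_poly P) = ser_poly (map_poly g P).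
Proof. by apply: seriesP => k /=; rewrite coef_map. Qed.

End SeriesMap.

Section Frob.
Variables (C : fieldType) (p e : nat).
(* The dummy proof argument is what unification uses to recover the
   characteristic hypothesis of the morphism instances. *)
Definition frob (_ : p \in [pchar C]) (i : nat) (x : C) : C := x ^+ ((p ^ e) ^ i).

Variable (hp : p \in [pchar C]).

Lemma frobE i x : frob hp i x = x ^+ ((p ^ e) ^ i). Proof. by []. Qed.

Lemma frob_pnat i : [pchar C].-nat ((p ^ e) ^ i)%N.
Proof. by rewrite -expnM pnatX (pnatE _ (pcharf_prime hp)) hp. Qed.

Lemma frob_is_zmod i : zmod_morphism (frob hp i).
Proof.
move=> x y; rewrite !frobE exprDn_pchar ?frob_pnat //.
by rewrite exprNn_pchar // frob_pnat.
Qed.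

Lemma frob_is_monoid i : monoid_morphism (frob hp i).
Proof. by split=> [|x y]; rewrite !frobE ?expr1n ?exprMn. Qed.

HB.instance Definition _ i := GRing.isZmodMorphism.Build C C (frob hp i) (frob_is_zmod i).
HB.instance Definition _ i := GRing.isMonoidMorphism.Build C C (frob hp i) (frob_is_monoid i).

Lemma frobD i j x : frob hp (i + j) x = frob hp i (frob hp j x).
Proof. by rewrite !frobE -exprM expnD mulnC. Qed.

Lemma frob0 x : frob hp 0 x = x.
Proof. by rewrite frobE expn0 expr1. Qed.

Lemma frob1 x : frob hp 1 x = x ^+ (p ^ e).
Proof. by rewrite frobE expn1. Qed.

Lemma frob_sum i (I : Type) (r : seq I) (P : pred I) (F : I -> C) :
  frob hp i (\sum_(k <- r | P k) F k) = \sum_(k <- r | P k) frob hp i (F k).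
Proof. exact: rmorph_sum. Qed.

End Frob.

(** * Power series over a complete non-archimedean field *)

(** Bernoulli's inequality for [r^-1 = 1 + h], combined with the archimedean property. *)
Lemma expr_small (R : realType) (r eps : R) : 0 <= r < 1 -> 0 < eps ->
  exists N, forall m, (N <= m)%N -> r ^+ m < eps.
Proof.
move=> /andP[r0 r1] e0.
suff [N hN] : exists N, r ^+ N < eps.
  exists N => m Nm; apply: le_lt_trans hN.
  by rewrite ler_wiXn2l // ltW.
have [->|rn0] := eqVneq r 0; first by exists 1%N; rewrite expr1.
have rp : 0 < r by rewrite lt_neqAle eq_sym rn0.
pose h := r^-1 - 1.
have h0 : 0 < h by rewrite subr_gt0 invf_gt1.
have bern n : 1 + h *+ n <= (1 + h) ^+ n.
  elim: n => [|n IH]; first by rewrite mulr0n addr0 expr0.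
  rewrite exprS; apply: le_trans (ler_wpM2l _ IH); last by rewrite addr_ge0 // ltW.
  rewrite mulrDl mul1r mulrDr mulr1 mulrS.
  have : 0 <= h * h *+ n by rewrite mulrn_wge0 // mulr_ge0 // ltW.
  rewrite -mulrnAr; lra.
pose N := Num.bound (eps^-1 / h).
exists N.
have hN : eps^-1 < h *+ N.
  have := archi_boundP (ltW (divr_gt0 (_ : 0 < eps^-1) h0)).
  by rewrite invr_gt0 => /(_ e0); rewrite ltr_pdivrMr // mulr_natl.
have e1 : eps^-1 < (1 + h) ^+ N by apply: lt_le_trans (bern N); lra.
have -> : r = (1 + h)^-1 by rewrite /h addrC subrK invrK.
rewrite exprVn -[eps]invrK ltf_pV2 // ?posrE ?invr_gt0 //.
by rewrite exprn_gt0 // addr_gt0.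
Qed.

Section Nonarch.
Variables (R : realType) (C : closedFieldType) (abs : C -> R).
Hypothesis Hna : nonarch_abs abs.

Lemma abs_ge0 x : 0 <= abs x. Proof. by case: Hna. Qed.
Lemma abs_eq0 x : (abs x == 0) = (x == 0).
Proof. by case: Hna => _ h _ _; apply/eqP/eqP => /h. Qed.
Lemma abs0 : abs 0 = 0. Proof. by apply/eqP; rewrite abs_eq0. Qed.
Lemma abs_gt0 x : (0 < abs x) = (x != 0).
Proof. by rewrite lt_neqAle abs_ge0 andbT eq_sym abs_eq0. Qed.
Lemma absM x y : abs (x * y) = abs x * abs y. Proof. by case: Hna. Qed.
Lemma absD x y : abs (x + y) <= Num.max (abs x) (abs y). Proof. by case: Hna. Qed.

Lemma abs1 : abs 1 = 1.
Proof.
have h : abs 1 != 0 by rewrite abs_eq0 oner_eq0.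
by apply: (mulfI h); rewrite -absM !mulr1.
Qed.

Lemma absX x k : abs (x ^+ k) = abs x ^+ k.
Proof. by elim: k => [|k IH]; rewrite ?expr0 ?abs1 // !exprS absM IH. Qed.

Lemma absN x : abs (- x) = abs x.
Proof.
apply/eqP; rewrite -(@eqrXn2 _ 2) ?abs_ge0 //.
by rewrite -!absX sqrrN.
Qed.

Lemma absV x : abs x^-1 = (abs x)^-1.
Proof.
have [->|x0] := eqVneq x 0; first by rewrite invr0 abs0 invr0.
have h : abs x != 0 by rewrite abs_eq0.
by apply: (mulfI h); rewrite -absM !divff // abs1.
Qed.

Lemma absD_le x y B : abs x <= B -> abs y <= B -> abs (x + y) <= B.
Proof. by move=> hx hy; apply: le_trans (absD x y) _; rewrite ge_max hx. Qed.

Lemma absD_lt x y B : abs x < B -> abs y < B -> abs (x + y) < B.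
Proof. by move=> hx hy; apply: le_lt_trans (absD x y) _; rewrite gt_max hx. Qed.

Lemma absB x y : abs (x - y) = abs (y - x).
Proof. by rewrite -absN opprB. Qed.

Lemma abs_sum_le (I : Type) (r : seq I) (P : pred I) (F : I -> C) B :
  0 <= B -> (forall i, P i -> abs (F i) <= B) -> abs (\sum_(i <- r | P i) F i) <= B.
Proof.
move=> B0 h; elim/big_rec: _ => [|i x Pi IH]; first by rewrite abs0.
exact: absD_le (h i Pi) IH.
Qed.

Local Notation cvg := (cvg_abs abs).

Lemma cvg_abs_unique s l l' : cvg s l -> cvg s l' -> l = l'.
Proof.
move=> hl hl'; apply/eqP; rewrite -subr_eq0 -abs_eq0; apply/negPn/negP => n0.
have e0 : 0 < abs (l - l') by rewrite lt_neqAle eq_sym n0 abs_ge0.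
have [N hN] := hl _ e0; have [N' hN'] := hl' _ e0.
have := absD_lt (hN' _ (leq_maxr N N')) (y := l - s (maxn N N')).
rewrite absB => /(_ _); rewrite [s _ - _ + _]addrC addrA subrK -[l - l']/(l - l').
by rewrite absB (absB l) hN ?leq_maxl // ltxx => /(_ isT).
Qed.

Lemma cvg_abs_cst l : cvg (fun=> l) l.
Proof. by move=> eps e0; exists 0%N => m _; rewrite subrr abs0. Qed.

Lemma cvg_abs_ext s s' l : s =1 s' -> cvg s l -> cvg s' l.
Proof. by move=> /funext ->. Qed.

Lemma cvg_absD s s' l l' : cvg s l -> cvg s' l' -> cvg (fun N => s N + s' N) (l + l').
Proof.
move=> hl hl' eps e0; have [N hN] := hl _ e0; have [N' hN'] := hl' _ e0.
exists (maxn N N') => m; rewrite geq_max => /andP[h h'].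
by rewrite opprD addrACA; apply: absD_lt; [apply: hN|apply: hN'].
Qed.

Lemma cvg_abs_sum (I : Type) (r : seq I) (P : pred I) (s : I -> nat -> C) (l : I -> C) :
  (forall i, P i -> cvg (s i) (l i)) ->
  cvg (fun N => \sum_(i <- r | P i) s i N) (\sum_(i <- r | P i) l i).
Proof.
move=> h; elim: r => [|i r IH].
  by rewrite big_nil; apply: cvg_abs_ext (cvg_abs_cst 0) => N; rewrite big_nil.
case Pi: (P i); last first.
  by rewrite big_cons Pi; apply: cvg_abs_ext IH => N; rewrite big_cons Pi.
rewrite big_cons Pi; apply: cvg_abs_ext (cvg_absD (h _ Pi) IH) => N.
by rewrite big_cons Pi.
Qed.

Lemma cvg_absM s s' l l' : cvg s l -> cvg s' l' -> cvg (fun N => s N * s' N) (l * l').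
Proof.
move=> hl hl' eps e0.
pose M := 1 + abs l + abs l'.
have M1 : 1 <= M by rewrite /M -addrA lerDl addr_ge0 ?abs_ge0.
have M0 : 0 < M by apply: lt_le_trans M1.
have eM : 0 < Num.min 1 (eps / M) by rewrite lt_min ltr01 divr_gt0.
have [N hN] := hl _ eM; have [N' hN'] := hl' _ eM.
exists (maxn N N') => m; rewrite geq_max => /andP[/hN + /hN'].
rewrite !lt_min => /andP[_ h2] /andP[h3 h4].
have -> : s m * s' m - l * l' = (s m - l) * s' m + l * (s' m - l').
  by rewrite mulrBl mulrBr addrA subrK.
have hl'M : abs l' <= M by rewrite /M lerDr addr_ge0 ?abs_ge0.
have hlM : abs l <= M by rewrite /M addrAC lerDr addr_ge0 ?abs_ge0.
apply: absD_lt; rewrite absM.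
  have h5 : abs (s' m) <= M.
    by rewrite -(subrK l' (s' m)); apply: absD_le => //; apply: le_trans (ltW h3) M1.
  apply: le_lt_trans (ler_wpM2l (abs_ge0 _) h5) _.
  by rewrite -ltr_pdivlMr.
apply: le_lt_trans (ler_wpM2r (abs_ge0 _) hlM) _.
by rewrite mulrC -ltr_pdivlMr.
Qed.

Lemma cvg_absX s l k : cvg s l -> cvg (fun N => s N ^+ k) (l ^+ k).
Proof.
move=> h; elim: k => [|k IH].
  by apply: cvg_abs_ext (cvg_abs_cst _) => N; rewrite !expr0.
by rewrite exprS; apply: cvg_abs_ext (cvg_absM h IH) => N; rewrite exprS.
Qed.

Lemma cvg_absS s l : cvg s l -> cvg (fun N => s N.+1) l.
Proof. by move=> h eps /h[N hN]; exists N => m Nm; apply: hN; apply: leqW. Qed.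

Lemma cvg_abs_le s l B : cvg s l -> (forall N, abs (s N) <= B) -> abs l <= B.
Proof.
move=> h hB; rewrite leNgt; apply/negP => lB.
have l0 : 0 < abs l by apply: le_lt_trans lB; apply: le_trans (abs_ge0 _) (hB 0%N).
have [N hN] := h _ l0; have := hN N (leqnn _).
have := absD_lt (x := s N) (y := l - s N) (B := abs l).
by rewrite [s N + _]addrC subrK ltxx absB => /(_ (le_lt_trans (hB N) lB)) hh /hh.
Qed.


(** The Gauss norm at radius [rho] is at most [B]; as a relation it avoids forming a supremum. *)
Definition bnd (B rho : R) (f : series C) : Prop :=
  forall k, abs (coefs f k) * rho ^+ k <= B.

(** Evaluation is a relation, so identities between values follow from uniqueness of limits without
    a total evaluation map. *)
Definition evl (f : series C) (x y : C) : Prop :=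
  cvg (fun N => \sum_(k < N) coefs f k * x ^+ k) y.

Definition ccvg (F : nat -> series C) (f : series C) : Prop :=
  forall k, cvg (fun N => coefs (F N) k) (coefs f k).

Lemma ccvg_unique F f g : ccvg F f -> ccvg F g -> f = g.
Proof. by move=> hf hg; apply: seriesP => k; apply: cvg_abs_unique (hf k) (hg k). Qed.

Lemma ccvg_cst f : ccvg (fun=> f) f.
Proof. by move=> k; apply: cvg_abs_cst. Qed.

Lemma ccvgD F G f g : ccvg F f -> ccvg G g -> ccvg (fun N => F N + G N) (f + g).
Proof. by move=> hf hg k; apply: cvg_absD (hf k) (hg k). Qed.

Lemma ccvgM F G f g : ccvg F f -> ccvg G g -> ccvg (fun N => F N * G N) (f * g).
Proof.
move=> hf hg k; apply: cvg_abs_sum => i _.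
exact: cvg_absM (hf i) (hg _).
Qed.

Lemma ccvgS F f : ccvg F f -> ccvg (fun N => F N.+1) f.
Proof. by move=> hf k; apply: cvg_absS (hf k). Qed.

Section Bounds.
Variable rho : R.
Hypothesis rho0 : 0 < rho.

Lemma bnd_ge0 B f : bnd B rho f -> 0 <= B.
Proof. by move=> /(_ 0%N); apply: le_trans; rewrite mulr_ge0 ?abs_ge0 ?exprn_ge0 // ltW. Qed.

Lemma bnd_le B B' f : B <= B' -> bnd B rho f -> bnd B' rho f.
Proof. by move=> BB h k; apply: le_trans (h k) BB. Qed.

Lemma bndE B f : bnd B rho f <-> forall k, abs (coefs f k) <= B / rho ^+ k.
Proof. by split=> h k; have := h k; rewrite ler_pdivlMr ?exprn_gt0. Qed.

Lemma bnd0 B : 0 <= B -> bnd B rho 0.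
Proof. by move=> B0 k; rewrite coefs0 abs0 mul0r. Qed.

Lemma bndD B f g : bnd B rho f -> bnd B rho g -> bnd B rho (f + g).
Proof.
move=> /bndE hf /bndE hg; apply/bndE => k; rewrite coefsD.
exact: absD_le (hf k) (hg k).
Qed.

Lemma bndN B f : bnd B rho f -> bnd B rho (- f).
Proof. by move=> h k; rewrite coefsN absN. Qed.

Lemma bnd_sum (I : Type) (r : seq I) (P : pred I) (F : I -> series C) B :
  0 <= B -> (forall i, P i -> bnd B rho (F i)) -> bnd B rho (\sum_(i <- r | P i) F i).
Proof.
by move=> B0 h; elim/big_rec: _ => [|i x Pi IH]; [apply: bnd0 | apply: bndD (h i Pi) IH].
Qed.

Lemma bndM B B' f g : bnd B rho f -> bnd B' rho g -> bnd (B * B') rho (f * g).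
Proof.
move=> hf hg.
have B0 := bnd_ge0 hf; have B0' := bnd_ge0 hg.
apply/bndE => k; rewrite coefsM; apply: abs_sum_le => [|i _].
  by rewrite mulr_ge0 ?mulr_ge0 // invr_ge0 exprn_ge0 // ltW.
rewrite absM ler_pdivlMr ?exprn_gt0 //.
have ik : (i <= k)%N by rewrite -ltnS.
rewrite -[X in rho ^+ X](subnKC ik) exprD mulrACA.
by apply: ler_pM (hf i) (hg _); rewrite mulr_ge0 ?abs_ge0 ?exprn_ge0 // ltW.
Qed.

Lemma bnd_poly_ex (P : {poly C}) : exists B, bnd B rho (ser_poly P).
Proof.
exists (\sum_(k < size P) abs P`_k * rho ^+ k) => k; rewrite coefs_poly.
have ge0 (i : nat) : 0 <= abs P`_i * rho ^+ i.
  by rewrite mulr_ge0 ?abs_ge0 ?exprn_ge0 // ltW.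
have [kP|kP] := leqP (size P) k.
  by rewrite nth_default // abs0 mul0r sumr_ge0.
by rewrite (bigD1 (Ordinal kP)) //= lerDl sumr_ge0.
Qed.

Lemma bnd1 : bnd 1 rho 1.
Proof. by case=> [|k]; rewrite coefs1 /= ?abs1 ?abs0 ?mulr1 ?mul0r. Qed.

Lemma bndX B f k : bnd B rho f -> bnd (B ^+ k) rho (f ^+ k).
Proof.
move=> h; elim: k => [|k IH]; first by rewrite !expr0; apply: bnd1.
by rewrite !exprS; apply: bndM.
Qed.

Lemma evl_ext f x y y' : evl f x y -> evl f x y' -> y = y'.
Proof. exact: cvg_abs_unique. Qed.

Lemma evl0 x : evl 0 x 0.
Proof.
by apply: cvg_abs_ext (cvg_abs_cst 0) => N; rewrite big1 // => i _; rewrite mul0r.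
Qed.

Lemma evlD f g x y z : evl f x y -> evl g x z -> evl (f + g) x (y + z).
Proof.
move=> hf hg; apply: cvg_abs_ext (cvg_absD hf hg) => N.
by rewrite -big_split /=; apply: eq_bigr => i _; rewrite mulrDl.
Qed.

Lemma evlN f x y : evl f x y -> evl (- f) x (- y).
Proof.
move=> hf; rewrite -[- y]mulN1r; apply: cvg_abs_ext (cvg_absM (cvg_abs_cst (-1)) hf) => N.
by rewrite mulN1r -sumrN; apply: eq_bigr => i _; rewrite coefsN mulNr.
Qed.

Lemma evl_sum (I : Type) (r : seq I) (P : pred I) (F : I -> series C) x (y : I -> C) :
  (forall i, P i -> evl (F i) x (y i)) ->
  evl (\sum_(i <- r | P i) F i) x (\sum_(i <- r | P i) y i).
Proof.
move=> h; elim: r => [|i r IH]; first by rewrite !big_nil; apply: evl0.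
rewrite !big_cons; case: ifP => Pi //; exact: evlD (h i Pi) IH.
Qed.

Lemma evl_poly (P : {poly C}) x : evl (ser_poly P) x P.[x].
Proof.
move=> eps e0; exists (size P) => m Pm.
rewrite (_ : \sum_(k < m) _ = P.[x]) ?subrr ?abs0 //.
rewrite horner_coef (@big_ord_widen _ _ _ (size P) m (fun i => P`_i * x ^+ i)) // [RHS]big_mkcond /=.
by apply: eq_bigr => i _; case: ltnP => // /(nth_default 0) ->; rewrite mul0r.
Qed.

Lemma evl_le f x y B : bnd B rho f -> abs x <= rho -> evl f x y -> abs y <= B.
Proof.
move=> hf hx h; apply: (cvg_abs_le h) => N; apply: abs_sum_le => [|k _].
  exact: bnd_ge0 hf.
rewrite absM absX; apply: le_trans (hf k); rewrite ler_wpM2l ?abs_ge0 //.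
by rewrite lerXn2r // nnegrE ?abs_ge0 // ltW.
Qed.

Lemma ratio_lt1 x : abs x < rho -> 0 <= abs x / rho < 1.
Proof. by move=> h; rewrite divr_ge0 ?abs_ge0 ?ltW //= ltr_pdivrMr // mul1r. Qed.

Lemma ratio_small x B eps : abs x < rho -> 0 <= B -> 0 < eps ->
  exists N, forall m, (N <= m)%N -> B * (abs x / rho) ^+ m < eps.
Proof.
move=> hx B0 e0.
have B1 : 0 < B + 1 by rewrite ltr_wpDl.
have [N hN] := expr_small (ratio_lt1 hx) (divr_gt0 e0 B1).
exists N => m /hN; rewrite ltr_pdivlMr // mulrC; apply: le_lt_trans.
rewrite ler_wpM2r ?lerDl // exprn_ge0 //; by case/andP: (ratio_lt1 hx).
Qed.

Lemma bnd_term f B x k : bnd B rho f -> abs (coefs f k * x ^+ k) <= B * (abs x / rho) ^+ k.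
Proof.
move=> hf; rewrite absM absX expr_div_n mulrCA mulrC.
by rewrite ler_wpM2l ?exprn_ge0 ?abs_ge0 //; move/bndE: hf; apply.
Qed.

Lemma ratioX_le x B (N k : nat) : abs x < rho -> 0 <= B -> (N <= k)%N ->
  B * (abs x / rho) ^+ k <= B * (abs x / rho) ^+ N.
Proof.
move=> hx B0 Nk; have /andP[r0 r1] := ratio_lt1 hx.
by rewrite ler_wpM2l // ler_wiXn2l // ltW.
Qed.

Lemma evlM f g x y z B B' : bnd B rho f -> bnd B' rho g -> abs x < rho ->
  evl f x y -> evl g x z -> evl (f * g) x (y * z).
Proof.
move=> hf hg hx hy hz.
have B0 := bnd_ge0 hf; have B0' := bnd_ge0 hg.
have BB0 : 0 <= B * B' by rewrite mulr_ge0.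
pose S N (f : series C) := \sum_(k < N) coefs f k * x ^+ k.
have SE N h : S N h = (ser_trunc N h).[x] by rewrite horner_poly.
(* The truncation of the product and the product of the truncations agree below degree [N]; what
   remains is a geometric tail. *)
have key N : abs (S N (f * g) - S N f * S N g) <= B * B' * (abs x / rho) ^+ N.
  rewrite !SE -hornerM -hornerN -hornerD horner_coef; apply: abs_sum_le.
    by rewrite mulr_ge0 // exprn_ge0 //; case/andP: (ratio_lt1 hx).
  move=> k _; have [kN|Nk] := ltnP k N.
    rewrite coefB coef_ser_trunc kN (coef_mul_trunc _ _ kN) subrr mul0r abs0.
    by rewrite mulr_ge0 // exprn_ge0 //; case/andP: (ratio_lt1 hx).
  rewrite coefB coef_ser_trunc ltnNge Nk sub0r mulNr absN.
  apply: le_trans (ratioX_le hx BB0 Nk).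
  have tr h D : bnd D rho h -> bnd D rho (ser_poly (ser_trunc N h)).
    move=> hh i; rewrite coefs_poly coef_ser_trunc; case: ifP => _; first exact: hh.
    by rewrite abs0 mul0r (bnd_ge0 hh).
  rewrite -coefs_poly rmorphM; apply: bnd_term.
  by apply: bndM; apply: tr.
have h0 : cvg (fun N => S N (f * g) - S N f * S N g) 0.
  move=> eps e0; have [N hN] := ratio_small hx BB0 e0.
  by exists N => m /hN; rewrite subr0; apply: le_lt_trans.
rewrite -[y * z]add0r.
apply: cvg_abs_ext (cvg_absD h0 (cvg_absM hy hz)) => N.
by rewrite subrK.
Qed.

Lemma evlX f x y B k : bnd B rho f -> abs x < rho -> evl f x y -> evl (f ^+ k) x (y ^+ k).
Proof.
move=> hf hx hy; elim: k => [|k IH].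
  by rewrite !expr0 -(rmorph1 (@ser_poly C)) -(hornerC 1 x); apply: evl_poly.
by rewrite !exprS; apply: evlM hf (bndX k hf) hx hy IH.
Qed.

Lemma abs_sum_le_tail f B x m n : bnd B rho f -> abs x < rho -> (m <= n)%N ->
  abs (\sum_(k < n) coefs f k * x ^+ k - \sum_(k < m) coefs f k * x ^+ k)
   <= B * (abs x / rho) ^+ m.
Proof.
move=> hf hx mn; have B0 := bnd_ge0 hf.
rewrite (big_ord_widen n (fun k => coefs f k * x ^+ k) mn).
rewrite [X in _ - X]big_mkcond -sumrB; apply: abs_sum_le.
  by rewrite mulr_ge0 // exprn_ge0 //; case/andP: (ratio_lt1 hx).
move=> k _; case: ltnP => km.
  rewrite subrr abs0.
  by rewrite mulr_ge0 // exprn_ge0 //; case/andP: (ratio_lt1 hx).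
by rewrite subr0; apply: le_trans (bnd_term _ _ hf) (ratioX_le hx B0 km).
Qed.

Hypothesis Hcomplete : forall s, cauchy_abs abs s -> exists l, cvg s l.

Lemma evl_ex f B x : bnd B rho f -> abs x < rho -> exists y, evl f x y.
Proof.
move=> hf hx; apply: Hcomplete => eps e0.
have [N hN] := ratio_small hx (bnd_ge0 hf) e0.
exists N => m k Nm Nk.
rewrite -(subrK (\sum_(i < N) coefs f i * x ^+ i) (\sum_(i < m) _)) -addrA.
apply: absD_lt; last rewrite absB.
  exact: le_lt_trans (abs_sum_le_tail hf hx Nm) (hN _ (leqnn _)).
exact: le_lt_trans (abs_sum_le_tail hf hx Nk) (hN _ (leqnn _)).
Qed.

(** Convergence in Gauss norm, which commutes with evaluation ([ncvg_evl]). The weaker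
    coefficientwise [ccvg] suffices to carry functional equations to the limit. *)
Definition ncvg (F : nat -> series C) (f : series C) : Prop :=
  forall eps : R, 0 < eps -> exists N, forall m, (N <= m)%N -> bnd eps rho (F m - f).

Lemma ncvg_ccvg F f : ncvg F f -> ccvg F f.
Proof.
move=> h k eps e0.
have e1 : 0 < eps * rho ^+ k / 2 by rewrite divr_gt0 // mulr_gt0 ?exprn_gt0.
have [N hN] := h _ e1; exists N => m /hN /(_ k).
have r1 : 0 < rho ^+ k by rewrite exprn_gt0.
rewrite coefsB -ler_pdivlMr // => /le_lt_trans; apply.
rewrite ltr_pdivrMr // ltr_pdivrMr // mulr_natr mulr2n ltrDl mulr_gt0 //.
Qed.

Lemma ncvg_evl F f B x y (Y : nat -> C) : ncvg F f -> abs x < rho ->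
  bnd B rho f -> (forall N, evl (F N) x (Y N)) -> evl f x y -> cvg Y y.
Proof.
move=> h hx hf hY hy eps e0.
have e1 : 0 < eps / 2 by rewrite divr_gt0.
have [N hN] := h _ e1; exists N => m /hN hm.
have hev : evl (F m - f) x (Y m - y).
  by apply: evlD (hY m) (evlN hy).
apply: le_lt_trans (evl_le hm (ltW hx) hev) _.
by rewrite ltr_pdivrMr // mulr_natr mulr2n ltrDl.
Qed.

(** By the ultrametric inequality, increments tending to zero already form a Cauchy sequence. *)
Lemma ncvg_ex F (d : nat -> R) :
  (forall eps : R, 0 < eps -> exists N, forall m, (N <= m)%N -> d m < eps) ->
  (forall N, bnd (d N) rho (F N.+1 - F N)) -> exists f, ncvg F f.
Proof.
move=> hd hF.
have step eps N : 0 < eps -> (forall m, (N <= m)%N -> d m < eps) ->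
    forall j, bnd eps rho (F (N + j)%N - F N).
  move=> e0 hN; elim=> [|j IH].
    by rewrite addn0 subrr; apply: bnd0; apply: ltW.
  rewrite addnS -(subrK (F (N + j)%N) (F _)) -addrA; apply: bndD => //.
  by apply: bnd_le (hF _); apply: ltW; apply: hN; rewrite leq_addr.
have cau eps : 0 < eps -> exists N, forall m k, (N <= m)%N -> (N <= k)%N ->
    bnd eps rho (F m - F k).
  move=> e0; have [N hN] := hd _ e0; exists N => m k Nm Nk.
  rewrite -(subrK (F N) (F m)) -addrA; apply: bndD.
    by rewrite -(subnKC Nm); apply: step.
  by rewrite -opprB; apply: bndN; rewrite -(subnKC Nk); apply: step.
have ck k : exists l, cvg (fun N => coefs (F N) k) l.
  apply: Hcomplete => eps e0.
  have r1 : 0 < rho ^+ k by rewrite exprn_gt0.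
  have e1 : 0 < eps * rho ^+ k / 2 by rewrite divr_gt0 // mulr_gt0.
  have [N hN] := cau _ e1; exists N => m j Nm Nj.
  have := hN _ _ Nm Nj k; rewrite coefsB -ler_pdivlMr // => /le_lt_trans; apply.
  by rewrite ltr_pdivrMr // ltr_pdivrMr // mulr_natr mulr2n ltrDl mulr_gt0.
have [l hl] := choice ck.
exists (Series l) => eps e0; have [N hN] := cau _ e0; exists N => m Nm.
apply/bndE => k; rewrite coefsB.
have hN' : forall j, abs (coefs (F m) k - coefs (F (N + j)%N) k) <= eps / rho ^+ k.
  by move=> j; have /bndE := hN _ (N + j)%N Nm (leq_addr _ _); apply.
apply: (@cvg_abs_le (fun j => coefs (F m) k - coefs (F (N + j)%N) k)) hN'.
apply: cvg_absD; first exact: cvg_abs_cst.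
move=> eps' e0'; have [N' hN'] := hl k _ e0'; exists N' => j N'j.
by rewrite -opprD absN; apply: hN'; apply: leq_trans N'j (leq_addl _ _).
Qed.

(** * Zeros of bounded series and the Schwarz lemma *)

Definition ser_shift (i : nat) (f : series C) := Series (fun j => coefs f (i + j)%N).

Lemma bnd_shift B f i : bnd B rho f -> bnd (B / rho ^+ i) rho (ser_shift i f).
Proof.
move=> /bndE h; apply/bndE => k /=; apply: le_trans (h _) _.
by rewrite exprD invfM mulrA.
Qed.

Lemma evl_shift f i x y y' : evl (ser_shift i f) x y -> evl (ser_shift i.+1 f) x y' ->
  y = coefs f i + x * y'.
Proof.
move=> /cvg_absS h h'; apply: cvg_abs_unique h _.
apply: cvg_abs_ext (cvg_absD (cvg_abs_cst _) (cvg_absM (cvg_abs_cst x) h')) => N.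
rewrite big_ord_recl expr0 mulr1 /= addn0 mulr_sumr; congr (_ + _).
apply: eq_bigr => j _; rewrite /= /bump /= add1n exprS addSnnS.
by rewrite mulrCA.
Qed.

(** Synthetic division: the coefficients of the quotient are the values at [a] of the shifted
    series, and each shift lowers the bound by a factor [rho]. *)
Lemma zero_factor f B a : bnd B rho f -> abs a < rho -> evl f a 0 ->
  exists2 g, bnd (B / rho) rho g & f = ser_poly ('X - a%:P) * g.
Proof.
move=> hf ha f0.
have ex i : exists y, evl (ser_shift i f) a y.
  exact: evl_ex (bnd_shift i hf) ha.
have [v hv] := choice ex.
exists (Series (fun k => v k.+1)).
  apply/bndE => k /=; rewrite -mulrA -invfM -exprS.
  exact: evl_le (bnd_shift k.+1 hf) (ltW ha) (hv _).
have v0 : v 0%N = 0.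
  by apply: evl_ext f0; have := hv 0%N; rewrite (_ : ser_shift 0 f = f) //; apply: seriesP.
apply: seriesP => k; rewrite rmorphB mulrBl coefsB.
have -> : ser_poly a%:P * Series (fun k => v k.+1) = Series (fun k => a * v k.+1).
  apply: seriesP => j; rewrite coefsM /= big_ord_recl /= coefC /= subn0 big1 ?addr0 //.
  by move=> i _; rewrite coefC /= mul0r.
rewrite coefsM /=; case: k => [|k].
  rewrite big_ord_recl big_ord0 /= coefX mul0r !add0r.
  by have := evl_shift (hv 0%N) (hv 1%N); rewrite v0 => /esym/eqP; rewrite addr_eq0 => /eqP.
rewrite 2!big_ord_recl /= !coefX /= mul0r add0r mul1r big1 ?addr0.
  by rewrite /bump /= subn1 /= (evl_shift (hv k.+1) (hv k.+2)) addrK.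
by move=> i _; rewrite coefX /= mul0r.
Qed.

Lemma zeros_factor f B N (a : nat -> C) : bnd B rho f ->
  (forall i, (i < N)%N -> abs (a i) < rho /\ evl f (a i) 0) ->
  (forall i j, (i < j < N)%N -> a i != a j) ->
  exists2 g, bnd (B / rho ^+ N) rho g & f = ser_poly (\prod_(i < N) ('X - (a i)%:P)) * g.
Proof.
move=> hf; elim: N => [|N IH] ha dis.
  by exists f; rewrite ?expr0 ?divr1 // big_ord0 rmorph1 mul1r.
have [||g hg fE] := IH.
- by move=> i iN; apply: ha; apply: ltnW.
- by move=> i j /andP[ij jN]; apply: dis; rewrite ij ltnW.
have [aN fN] := ha N (leqnn _).
have [z hz] := evl_ex hg aN.
(* The points are distinct, so the factors already removed do not vanish at [a N]. *)
have z0 : z = 0.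
  set P := \prod_(i < N) _ in fE.
  have [D hD] := bnd_poly_ex P.
  have := evlM hD hg aN (evl_poly P _) hz; rewrite -fE => /evl_ext /(_ fN) /eqP.
  rewrite mulf_eq0 => /orP[|/eqP //]; rewrite horner_prod prodf_seq_eq0 => /hasP[i _] /=.
  by rewrite hornerXsubC subr_eq0 eq_sym (negPf (dis _ _ _)) // ltn_ord leqnn.
rewrite z0 in hz.
have [h hh gE] := zero_factor hg aN hz.
exists h; first by rewrite exprSr invfM mulrA.
by rewrite big_ord_recr /= rmorphM -mulrA -gE.
Qed.

End Bounds.

Lemma bnd1_prod N (a : nat -> C) : (forall i, (i < N)%N -> 1 <= abs (a i)) ->
  bnd (\prod_(i < N) abs (a i)) 1 (ser_poly (\prod_(i < N) ('X - (a i)%:P))).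
Proof.
elim: N => [|N IH] h.
  by rewrite !big_ord0 rmorph1; apply: bnd1.
rewrite !big_ord_recr rmorphM /=; apply: bndM => //.
  by apply: IH => i iN; apply: h; apply: ltnW.
move=> k; rewrite coefs_poly expr1n mulr1 coefB coefX coefC.
apply: absD_le; case: k => [|[|k]] //=; rewrite ?subr0 ?oppr0 ?absN ?abs0 ?abs1 ?abs_ge0 //.
exact: h.
Qed.

(** Schwarz lemma: the zeros are divided out at radius [rho], gaining [rho^N], and multiplied back
    at radius [1], where each factor ['X - a] costs only [abs a]. *)
Lemma zeros_bound f B N (a : nat -> C) rho : 1 <= rho ->
  (forall s, cauchy_abs abs s -> exists l, cvg s l) -> bnd B rho f ->
  (forall i, (i < N)%N -> 1 <= abs (a i) < rho /\ evl f (a i) 0) ->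
  (forall i j, (i < j < N)%N -> a i != a j) ->
  forall k, abs (coefs f k) <= (\prod_(i < N) abs (a i)) * (B / rho ^+ N).
Proof.
move=> r1 hC hf ha dis k.
have r0 : 0 < rho by apply: lt_le_trans r1.
have [|g hg fE] := zeros_factor r0 hC hf _ dis.
  by move=> i /ha [/andP[]].
have hg1 : bnd (B / rho ^+ N) 1 g.
  move=> j; rewrite expr1n mulr1; apply: le_trans (hg j).
  by rewrite ler_peMr ?abs_ge0 // exprn_ege1.
have hp : bnd (\prod_(i < N) abs (a i)) 1 (ser_poly (\prod_(i < N) ('X - (a i)%:P))).
  by apply: bnd1_prod => i /ha [/andP[]].
have := bndM ltr01 hp hg1 k; rewrite -fE expr1n mulr1; exact.
Qed.

End Nonarch.

(** * Linear algebra over a subfield *)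

Definition subfield_pred (C : fieldType) (P : C -> Prop) : Prop :=
  [/\ P 0, P 1, (forall x y, P x -> P y -> P (x - y)),
      (forall x y, P x -> P y -> P (x * y)) & (forall x, P x -> P x^-1)].

Section Kernel.
Variables (C : fieldType) (P : C -> Prop).
Hypothesis HP : subfield_pred P.

Lemma sfN x : P x -> P (- x).
Proof. by case: HP => h0 _ hB _ _ hx; rewrite -[- x]sub0r; apply: hB. Qed.
Lemma sfD x y : P x -> P y -> P (x + y).
Proof. by case: (HP) => _ _ hB _ _ hx hy; rewrite -[y]opprK; apply: hB => //; apply: sfN. Qed.
Lemma sfM x y : P x -> P y -> P (x * y).
Proof. by case: HP => _ _ _ hM _; apply: hM. Qed.
Lemma sfV x : P x -> P x^-1.
Proof. by case: HP => _ _ _ _; apply. Qed.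
Lemma sf0 : P 0. Proof. by case: HP. Qed.
Lemma sf1 : P 1. Proof. by case: HP. Qed.
Lemma sf_sum (I : Type) (r : seq I) (Q : pred I) (F : I -> C) :
  (forall i, Q i -> P (F i)) -> P (\sum_(i <- r | Q i) F i).
Proof.
by move=> h; elim/big_rec: _ => [|i x Qi IH]; [apply: sf0 | apply: sfD (h i Qi) IH].
Qed.
(** Gaussian elimination: a pivot in the first row removes one equation and one unknown, and all
    operations stay in the subfield. *)
Lemma kernel_ord m : forall n (M : 'I_m -> 'I_n -> C), (m < n)%N ->
  (forall i j, P (M i j)) ->
  exists x : 'I_n -> C, [/\ forall j, P (x j), exists j, x j != 0
    & forall i, \sum_j M i j * x j = 0].
Proof.
elim: m => [|m IH] [//|n] M mn hM.
  by exists (fun=> 1); split; [move=> _; apply: sf1|exists ord0; apply: oner_neq0|case].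
have [h0|h0] := pselect (forall j, M ord0 j = 0).
  have [x [hx nx hs]] := IH n.+1 (fun i => M (lift ord0 i)) (ltnW mn) (fun i j => hM _ _).
  exists x; split=> // i; have [j ->|->] := unliftP ord0 i; first exact: hs.
  by apply: big1 => j _; rewrite h0 mul0r.
have [s0 hs0] : exists j, M ord0 j != 0.
  apply: contrapT => /forallNP hh; apply: h0 => j; apply/eqP.
  by apply: contrapT => /negP; apply: hh.
set a := M ord0 s0 in hs0.
pose M' i j := M (lift ord0 i) (lift s0 j) - M (lift ord0 i) s0 * M ord0 (lift s0 j) / a.
have [|i j|x' [hx' [j0 nj0] hs']] := IH n M'; first by rewrite -ltnS.
  by case: HP => _ _ hB _ _; apply: hB => //; apply: sfM; [apply: sfM|apply: sfV; apply: hM].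
pose y := - (\sum_j M ord0 (lift s0 j) * x' j) / a.
pose x s := if unlift s0 s is Some j then x' j else y.
have xl j : x (lift s0 j) = x' j by rewrite /x liftK.
have xs : x s0 = y by rewrite /x unlift_none.
exists x; split.
- move=> j; rewrite /x; case: unliftP => [j' _|_] //.
  by apply: sfM; [apply/sfN/sf_sum => i _; apply: sfM|apply: sfV; apply: hM].
- by exists (lift s0 j0); rewrite xl.
have sumE i : \sum_j M i j * x j = M i s0 * y + \sum_j M i (lift s0 j) * x' j.
  by rewrite (bigD1_ord s0) //= xs; congr (_ + _); apply: eq_bigr => j _; rewrite xl.
move=> i; rewrite sumE; have [i' ->|->] := unliftP ord0 i; last first.
  by rewrite /y mulrC -/a divfK // addNr.
rewrite -[RHS](hs' i').
rewrite [RHS](eq_bigr (fun j => M (lift ord0 i') (lift s0 j) * x' j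
    - M (lift ord0 i') s0 / a * (M ord0 (lift s0 j) * x' j))); last first.
  by move=> j _; rewrite /M'; ring.
by rewrite sumrB -mulr_sumr /y; ring.
Qed.

Lemma kernel_fin (S T : finType) (M : T -> S -> C) : (#|T| < #|S|)%N ->
  (forall i j, P (M i j)) ->
  exists x : S -> C, [/\ forall j, P (x j), exists j, x j != 0
    & forall i, \sum_j M i j * x j = 0].
Proof.
move=> TS hM.
have [x [hx [j nj] hs]] :=
  kernel_ord (M := fun i j => M (enum_val i) (enum_val j)) TS (fun _ _ => hM _ _).
exists (fun s => x (enum_rank s)); split=> [s||i]; first exact: hx.
  by exists (enum_val j); rewrite enum_valK.
rewrite -[RHS](hs (enum_rank i)) (reindex (@enum_val S S)) /=; last first.
  by exists enum_rank => k _; rewrite ?enum_valK ?enum_rankK.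
by apply: eq_bigr => k _; rewrite enum_valK enum_rankK.
Qed.

(** * Spans, free bases and finite extensions *)

Definition lin_span (I : finType) (b : I -> C) (x : C) : Prop :=
  exists2 c : I -> C, (forall i, P (c i)) & x = \sum_i c i * b i.

Definition lin_free (I : finType) (b : I -> C) : Prop :=
  forall c : I -> C, (forall i, P (c i)) -> \sum_i c i * b i = 0 -> forall i, c i = 0.

Lemma lin_spanD (I : finType) (b : I -> C) x y :
  lin_span b x -> lin_span b y -> lin_span b (x + y).
Proof.
move=> [c hc ->] [d hd ->]; exists (fun i => c i + d i) => [i|]; first exact: sfD.
by rewrite -big_split; apply: eq_bigr => i _; rewrite mulrDl.
Qed.

Lemma lin_spanZ (I : finType) (b : I -> C) a x : P a -> lin_span b x -> lin_span b (a * x).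
Proof.
move=> ha [c hc ->]; exists (fun i => a * c i) => [i|]; first exact: sfM.
by rewrite mulr_sumr; apply: eq_bigr => i _; rewrite mulrA.
Qed.

Lemma lin_span0 (I : finType) (b : I -> C) : lin_span b 0.
Proof. by exists (fun=> 0) => [_|]; [apply: sf0|rewrite big1 // => i _; rewrite mul0r]. Qed.

Lemma lin_span_sum (I : finType) (b : I -> C) (J : Type) (r : seq J) (Q : pred J) (F : J -> C) :
  (forall i, Q i -> lin_span b (F i)) -> lin_span b (\sum_(i <- r | Q i) F i).
Proof.
by move=> h; elim/big_rec: _ => [|i x Qi]; [apply: lin_span0|apply/lin_spanD/h].
Qed.

Lemma lin_span_gen (I : finType) (b : I -> C) i : lin_span b (b i).
Proof.
exists (fun j => (j == i)%:R) => [j|]; first by case: eqP => _; [apply: sf1|apply: sf0].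
by rewrite (bigD1 i) //= eqxx mul1r big1 ?addr0 // => j /negPf ->; rewrite mul0r.
Qed.

Lemma lin_span_sub (I J : finType) (b : I -> C) (d : J -> C) x :
  (forall i, lin_span d (b i)) -> lin_span b x -> lin_span d x.
Proof. by move=> h [c hc ->]; apply: lin_span_sum => i _; apply: lin_spanZ. Qed.

Lemma lin_span_mul (I J L : finType) (b : I -> C) (d : J -> C) (f : L -> C) x y :
  (forall i j, lin_span f (b i * d j)) -> lin_span b x -> lin_span d y -> lin_span f (x * y).
Proof.
move=> h [c hc ->] [c' hc' ->]; rewrite mulr_suml; apply: lin_span_sum => i _.
rewrite mulr_sumr; apply: lin_span_sum => j _.
by rewrite mulrACA; apply: lin_spanZ => //; apply: sfM.
Qed.

(* A shortest generating family containing 1 is free. *)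
Lemma lin_free_basis (I : finType) (b : I -> C) : lin_span b 1 ->
  exists n (d : 'I_n.+1 -> C), [/\ d ord0 = 1, lin_free d,
    forall i, lin_span b (d i) & forall i, lin_span d (b i)].
Proof.
move=> b1.
pose good k := `[< exists d : 'I_k.+1 -> C, [/\ d ord0 = 1,
    forall i, lin_span b (d i) & forall i, lin_span d (b i)] >].
have ex : exists k, good k.
  exists #|I|; apply/asboolP.
  pose d (i : 'I_#|I|.+1) := if unlift ord0 i is Some j then b (enum_val j) else 1.
  exists d; split=> [|i|i]; first by rewrite /d unlift_none.
    by rewrite /d; case: unliftP => [j _|_] //; apply: lin_span_gen.
  have := lin_span_gen d (lift ord0 (enum_rank i)).
  by rewrite /d liftK enum_rankK.
case: (ex_minnP ex) => k /asboolP[d [d0 hd1 hd2]] kmin; exists k, d; split=> // c hc cd0.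
suff hl j : j != ord0 -> c j = 0.
  move=> i; have [->|/hl //] := eqVneq i ord0.
  by move: cd0; rewrite (bigD1 ord0) //= d0 mulr1 big1 ?addr0 // => j /hl ->; rewrite mul0r.
move=> j0; apply/eqP/negPn/negP => cj.
have [k' kE] : exists k', k = k'.+1.
  by move: j j0 {cj}; case: (k) => [|k'] j; [rewrite (ord1 j) eqxx|exists k'].
subst k.
have /kmin : good k'; last by rewrite ltnn.
apply/asboolP; exists (fun i => d (lift j i)).
have dj : lin_span (fun i => d (lift j i)) (d j).
  have -> : d j = - (c j)^-1 * \sum_i c (lift j i) * d (lift j i).
    move: cd0; rewrite (bigD1_ord j) //= => /eqP; rewrite addrC addr_eq0 => /eqP ->.
    by rewrite mulrNN mulKf.
  apply: lin_spanZ; first by apply/sfN/sfV.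
  by exists (fun i => c (lift j i)).
split=> [|i|i].
- have := unlift_some j0; case=> i' h _; rewrite -d0 h; congr d.
  by apply: val_inj; rewrite -h /= /bump; case: (j) j0 => -[].
- exact: hd1.
apply: lin_span_sub (hd2 i) => i'.
have [i'' ->|->] := unliftP j i'; last exact: dj.
exact: (lin_span_gen (fun i => d (lift j i))).
Qed.

Lemma span_powers (Q : {poly C}) z : (forall j, P Q`_j) -> Q != 0 -> root Q z ->
  forall k, lin_span (fun i : 'I_(size Q).-1 => z ^+ i) (z ^+ k).
Proof.
move=> hQ Q0 rQ; set n := (size Q).-1.
have sQ : size Q = n.+1 by rewrite prednK // size_poly_gt0.
have small k : (k < n)%N -> lin_span (fun i : 'I_n => z ^+ i) (z ^+ k).
  by move=> kn; have := lin_span_gen (fun i : 'I_n => z ^+ i) (Ordinal kn).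
have top : lin_span (fun i : 'I_n => z ^+ i) (z ^+ n).
  have := rootP rQ; rewrite horner_coef sQ big_ord_recr /= -[Q`_n]/(Q`_(size Q).-1).
  rewrite -/(lead_coef Q) => /eqP; rewrite addrC addr_eq0 => /eqP h.
  have -> : z ^+ n = (lead_coef Q)^-1 * - \sum_(i < n) Q`_i * z ^+ i.
    by rewrite -h mulKf // lead_coef_eq0.
  apply: lin_spanZ; first by apply/sfV/hQ.
  exists (fun i : 'I_n => - Q`_i) => [i|]; first exact/sfN/hQ.
  by rewrite -sumrN; apply: eq_bigr => i _; rewrite mulNr.
elim=> [|k IH]; first by case: (posnP n) => n0; [have -> : z ^+ 0 = z ^+ n by rewrite n0|exact: small].
rewrite exprS; case: IH => c hc ->; rewrite mulr_sumr; apply: lin_span_sum => i _.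
rewrite mulrCA -exprS; apply: lin_spanZ => //.
by have := ltn_ord i; rewrite leq_eqVlt => /orP[/eqP ->|/small].
Qed.

(** Elements are adjoined one at a time: the products of old generators with the powers of [z] below
    the degree of its equation again span a ring. *)
Lemma alg_family (Z : seq C) :
  (forall z, z \in Z -> exists Q : {poly C}, [/\ forall j, P Q`_j, Q != 0 & root Q z]) ->
  exists (I : finType) (b : I -> C), [/\ lin_span b 1,
    forall i j, lin_span b (b i * b j) & forall z, z \in Z -> lin_span b z].
Proof.
elim: Z => [|z Z IH] hZ.
  exists 'I_1, (fun=> 1); split=> // [|_ _]; rewrite ?mulr1.
    exact: (lin_span_gen (fun _ : 'I_1 => 1) ord0).
  exact: (lin_span_gen (fun _ : 'I_1 => 1) ord0).
have [|I [b [b1 bM bZ]]] := IH; first by move=> y yZ; apply: hZ; rewrite inE yZ orbT.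
have [|Q [hQ Q0 rQ]] := hZ z; first by rewrite mem_head.
have hz := span_powers hQ Q0 rQ; set n := (size Q).-1 in hz.
pose d (ij : I * 'I_n) := b ij.1 * z ^+ ij.2.
have bd x y : lin_span b x -> lin_span (fun i : 'I_n => z ^+ i) y -> lin_span d (x * y).
  by apply: lin_span_mul => i j; apply: (lin_span_gen d (i, j)).
exists (I * 'I_n)%type, d; split.
- by rewrite -[1]mulr1; apply: bd => //; rewrite -(expr0 z).
- by move=> i j; rewrite /d mulrACA; apply: bd => //; rewrite -exprD.
move=> y; rewrite inE => /orP[/eqP ->|/bZ hy].
  by rewrite -[z]mul1r; apply: bd => //; rewrite -(expr1 z).
by rewrite -[y]mulr1; apply: bd => //; rewrite -(expr0 z).
Qed.

Lemma free_algebra_basis (Z : seq C) :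
  (forall z, z \in Z -> exists Q : {poly C}, [/\ forall j, P Q`_j, Q != 0 & root Q z]) ->
  exists n (d : 'I_n.+1 -> C), [/\ d ord0 = 1, lin_free d,
    forall i j, lin_span d (d i * d j) & forall z, z \in Z -> lin_span d z].
Proof.
move=> /alg_family[I [b [b1 bM bZ]]].
have [n [d [d0 df bd db]]] := lin_free_basis b1.
exists n, d; split=> // [i j|z /bZ]; last exact: lin_span_sub.
by apply: (lin_span_sub db); apply: lin_span_mul bM _ _.
Qed.

End Kernel.

(** * Heights in finite extensions of the rational function field *)

(** Heights in an order over [F_q[theta]], where [Sz d] bounds the degrees of the coordinates. The
    shift [c] makes heights of products additive, so even [0] has height [c], and [d - c] counts the
    free coefficients per coordinate in Siegel's lemma. [ho_lower] is the Liouville inequality. *)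
Record height_order (R : realType) (C : closedFieldType) (abs : C -> R)
    (Sz : nat -> C -> Prop) (kappa : R) (c : nat) : Prop := HeightOrder {
  ho_kappa : 1 <= kappa;
  ho_c : (0 < c)%N;
  ho_le : forall d d' x, (d <= d')%N -> Sz d x -> Sz d' x;
  ho0 : Sz c 0;
  hoD : forall d x y, Sz d x -> Sz d y -> Sz d (x + y);
  hoN : forall d x, Sz d x -> Sz d (- x);
  hoM : forall d d' x y, Sz d x -> Sz d' y -> Sz (d + d') (x * y);
  ho_upper : forall d x, Sz d x -> abs x <= kappa ^+ d;
  ho_lower : forall d x, Sz d x -> x != 0 -> 1 <= abs x * kappa ^+ d;
  ho_siegel : forall (S T : finType) (M : T -> S -> C) d d1,
    (forall t s, Sz d1 (M t s)) -> (#|T| * (d + d1) < #|S| * (d - c))%N ->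
    exists y : S -> C, [/\ forall s, Sz d (y s), exists s, y s != 0
      & forall t, \sum_s M t s * y s = 0] }.

Section Model.
Variables (R : realType) (C : closedFieldType) (abs : C -> R) (p e : nat) (theta : C).
Local Notation q := (p ^ e)%N.
Hypothesis hp : p \in [pchar C].
Hypothesis e0 : (0 < e)%N.
Hypothesis Hna : nonarch_abs abs.
Hypothesis theta1 : 1 < abs theta.
Hypothesis Hinf : forall a : {poly C}, polyFq q a -> a != 0 ->
  abs a.[theta] = abs theta ^+ (size a).-1.

Lemma inFqE (x : C) : inFq q x <-> frob e hp 1 x = x.
Proof. by rewrite frob1. Qed.

Lemma inFq_subfield : subfield_pred (inFq (C := C) q).
Proof.
split=> [|||x y|x]; rewrite ?inFqE ?rmorph0 ?rmorph1 //.
- by move=> x y /inFqE hx /inFqE hy; apply/inFqE; rewrite rmorphB /= hx hy.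
- by move=> /inFqE hx /inFqE hy; rewrite rmorphM /= hx hy.
- by move=> /inFqE hx; rewrite fmorphV /= hx.
Qed.
Local Notation HF := inFq_subfield.

Lemma polyFq0 : polyFq q (0 : {poly C}).
Proof. by move=> j; rewrite coef0; apply: sf0 HF. Qed.
Lemma polyFqC (x : C) : inFq q x -> polyFq q x%:P.
Proof. by move=> hx j; rewrite coefC; case: eqP => // _; apply: sf0 HF. Qed.
Lemma polyFq1 : polyFq q (1 : {poly C}).
Proof. by apply: polyFqC; apply: sf1 HF. Qed.
Lemma polyFqX : polyFq q ('X : {poly C}).
Proof. by move=> j; rewrite coefX; case: eqP => _; [apply: sf1 HF|apply: sf0 HF]. Qed.
Lemma polyFqD (a b : {poly C}) : polyFq q a -> polyFq q b -> polyFq q (a + b).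
Proof. by move=> ha hb j; rewrite coefD; apply: sfD HF _ _ (ha j) (hb j). Qed.
Lemma polyFqN (a : {poly C}) : polyFq q a -> polyFq q (- a).
Proof. by move=> ha j; rewrite coefN; apply: sfN HF _ (ha j). Qed.
Lemma polyFqM (a b : {poly C}) : polyFq q a -> polyFq q b -> polyFq q (a * b).
Proof.
by move=> ha hb j; rewrite coefM; apply: (sf_sum HF) => i _; apply: sfM HF _ _ (ha _) (hb _).
Qed.
Lemma polyFqXn k : polyFq q ('X^k : {poly C}).
Proof. by move=> j; rewrite coefXn; case: eqP => _; [apply: sf1 HF|apply: sf0 HF]. Qed.
Lemma polyFq_sum (I : Type) (r : seq I) (Q : pred I) (F : I -> {poly C}) :
  (forall i, Q i -> polyFq q (F i)) -> polyFq q (\sum_(i <- r | Q i) F i).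
Proof.
by move=> h; elim/big_rec: _ => [|i x Qi]; [apply: polyFq0|apply/polyFqD/h].
Qed.
Lemma polyFq_prod (I : Type) (r : seq I) (Q : pred I) (F : I -> {poly C}) :
  (forall i, Q i -> polyFq q (F i)) -> polyFq q (\prod_(i <- r | Q i) F i).
Proof.
by move=> h; elim/big_rec: _ => [|i x Qi]; [apply: polyFq1|apply/polyFqM/h].
Qed.

(** The arithmetic source of the Liouville inequality: [F_q[theta]] is discrete for the infinite
    place. *)
Lemma polyFq_abs_ge1 (a : {poly C}) : polyFq q a -> a != 0 -> 1 <= abs a.[theta].
Proof. by move=> ha a0; rewrite Hinf // exprn_ege1 // ltW. Qed.

Lemma polyFq_theta0 (a : {poly C}) : polyFq q a -> a != 0 -> a.[theta] != 0.
Proof.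
move=> ha a0; rewrite -(abs_gt0 Hna); apply: lt_le_trans (polyFq_abs_ge1 ha a0).
exact: ltr01.
Qed.

Lemma inK_poly (a : {poly C}) : polyFq q a -> inK q theta a.[theta].
Proof.
by move=> ha; exists a, 1; split; rewrite ?oner_eq0 ?hornerC ?divr1 //; apply: polyFq1.
Qed.

Lemma inK_subfield : subfield_pred (inK q theta).
Proof.
split.
- by rewrite -(horner0 theta); apply/inK_poly/polyFq0.
- by rewrite -(hornerC 1 theta); apply/inK_poly/polyFq1.
- move=> x y [a [b [ha hb b0 ->]]] [c [d [hc hd d0 ->]]].
  exists (a * d - c * b), (b * d); split.
  + by apply: polyFqD; [apply: polyFqM|apply/polyFqN/polyFqM].
  + exact: polyFqM.
  + by rewrite mulf_neq0.
  have bt := polyFq_theta0 hb b0; have dt := polyFq_theta0 hd d0.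
  by rewrite !hornerE; field; rewrite bt dt.
- move=> x y [a [b [ha hb b0 ->]]] [c [d [hc hd d0 ->]]].
  exists (a * c), (b * d); split; rewrite ?mulf_neq0 //; try exact: polyFqM.
  by rewrite !hornerM mulf_div.
move=> x [a [b [ha hb b0 ->]]].
have [->|a0] := eqVneq a 0.
  rewrite horner0 mul0r invr0 -(horner0 theta); exact/inK_poly/polyFq0.
by exists b, a; split; rewrite // invf_div.
Qed.
Local Notation HK := inK_subfield.

Lemma common_denom (J : finType) (x : J -> C) : (forall j, inK q theta (x j)) ->
  exists a : {poly C}, [/\ polyFq q a, a != 0 &
    forall j, exists2 b : {poly C}, polyFq q b & a.[theta] * x j = b.[theta]].
Proof.
move=> /choice[a /choice[b hab]].
exists (\prod_j b j); split.
- by apply: polyFq_prod => j _; case: (hab j).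
- by apply/prodf_neq0 => j _; case: (hab j).
move=> j; exists (a j * \prod_(i | i != j) b i).
  by apply: polyFqM; [case: (hab j)|apply: polyFq_prod => i _; case: (hab i)].
have [ha hb b0 ->] := hab j; rewrite (bigD1 j) //= !hornerM.
by have := polyFq_theta0 hb b0 => b1; field.
Qed.

(** * Orders over [F_q[theta]]: Siegel's lemma and the Liouville inequality *)

Section Order.
Variables (m : nat) (b : 'I_m.+1 -> C) (g : 'I_m.+1 -> 'I_m.+1 -> 'I_m.+1 -> {poly C}) (c : nat).
Hypothesis b0 : b ord0 = 1.
Hypothesis bfree : lin_free (inK q theta) b.
Hypothesis gFq : forall i j l, polyFq q (g i j l).
Hypothesis gsize : forall i j l, (size (g i j l) <= c)%N.
Hypothesis c0 : (0 < c)%N.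
Hypothesis bM : forall i j, b i * b j = \sum_l (g i j l).[theta] * b l.

Definition comb (a : 'I_m.+1 -> {poly C}) : C := \sum_i (a i).[theta] * b i.

Lemma comb_neq0 a : (forall i, polyFq q (a i)) -> (exists i, a i != 0) -> comb a != 0.
Proof.
move=> ha [i ai]; apply/eqP => /bfree h.
by have := polyFq_theta0 (ha i) ai; rewrite h ?eqxx // => j; apply: inK_poly.
Qed.

Lemma comb_mul a a' :
  comb a * comb a' = comb (fun l => \sum_i \sum_j a i * a' j * g i j l).
Proof.
rewrite /comb mulr_suml.
under [RHS]eq_bigr => l _ do rewrite horner_sum mulr_suml.
rewrite exchange_big; apply: eq_bigr => i _; rewrite mulr_sumr.
under [RHS]eq_bigr => l _ do rewrite horner_sum mulr_suml.
rewrite exchange_big; apply: eq_bigr => j _.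
rewrite mulrACA bM mulr_sumr; apply: eq_bigr => l _.
by rewrite !hornerM !mulrA.
Qed.

Definition mcomb (S : finType) (al y : S -> 'I_m.+1 -> {poly C}) (l : 'I_m.+1) : {poly C} :=
  \sum_s \sum_i \sum_j al s i * y s j * g i j l.

Lemma mcombE (S : finType) (al y : S -> 'I_m.+1 -> {poly C}) :
  \sum_s comb (al s) * comb (y s) = comb (mcomb al y).
Proof.
under eq_bigr => s _ do rewrite comb_mul.
rewrite /comb exchange_big; apply: eq_bigr => l _.
by rewrite -mulr_suml -horner_sum.
Qed.

(** Linear algebra over [F_q]: each unknown polynomial has [K] coefficients, and each condition is a
    polynomial of size at most [K + d1 + c], hence that many scalar equations. The index type [W]
    selects which coordinates must vanish, so that [osz_lower] can leave one of them free. *)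
Lemma linear_solve (S T W : finType) (wt : W -> T) (wl : W -> 'I_m.+1)
    (al : T -> S -> 'I_m.+1 -> {poly C}) (d1 K : nat) :
  (forall t s i, polyFq q (al t s i)) -> (forall t s i, (size (al t s i) <= d1)%N) ->
  (#|W| * (K + d1 + c) < #|S| * m.+1 * K)%N ->
  exists y : S -> 'I_m.+1 -> {poly C}, [/\ forall s i, polyFq q (y s i),
    forall s i, (size (y s i) <= K)%N, exists s, exists i, y s i != 0
    & forall w, mcomb (al (wt w)) y (wl w) = 0].
Proof.
move=> hal hs hcard.
pose E (t : T) (s : S) (j l : 'I_m.+1) : {poly C} := \sum_i al t s i * g i j l.
have EF t s j l : polyFq q (E t s j l).
  by apply: polyFq_sum => i _; apply: polyFqM.
have Es t s j l : (size (E t s j l) <= d1 + c)%N.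
  apply: (leq_trans (size_sum _ _ _)); apply/bigmax_leqP => i _.
  apply: leq_trans (size_polyMleq _ _) _.
  by rewrite (leq_trans (leq_pred _)) // leq_add.
pose M (wh : W * 'I_(K + d1 + c)) (sjk : S * 'I_m.+1 * 'I_K) : C :=
  ('X^(sjk.2) * E (wt wh.1) sjk.1.1 sjk.1.2 (wl wh.1))`_(wh.2).
have [||x [xF [[[s0 j0] k0] x0] xs]] := kernel_fin HF (M := M).
- by rewrite !card_prod !card_ord.
- by move=> wh sjk; apply: polyFqM; [apply: polyFqXn|apply: EF].
pose y s j : {poly C} := \poly_(k < K) if insub k is Some k' then x (s, j, k') else 0.
have yE s j (k : 'I_K) : (y s j)`_k = x (s, j, k).
  by rewrite coef_poly ltn_ord valK.
have yE' s j : y s j = \sum_(k < K) x (s, j, k) *: 'X^k.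
  by rewrite /y poly_def; apply: eq_bigr => k _; rewrite valK.
exists y; split.
- move=> s j k; rewrite coef_poly; case: ifP => kK; last exact: sf0 HF.
  by case: insubP => [k' _ _|]; [apply: xF|move=> _; apply: sf0 HF].
- by move=> s j; apply: size_poly.
- exists s0, j0; apply/eqP => h; move: x0; rewrite -yE h coef0 eqxx //.
move=> w; have yK s i : (size (y s i) <= K)%N by apply: size_poly.
have -> : mcomb (al (wt w)) y (wl w) = \sum_s \sum_j y s j * E (wt w) s j (wl w).
  apply: eq_bigr => s _; rewrite exchange_big; apply: eq_bigr => j _.
  by rewrite mulr_sumr; apply: eq_bigr => i _; rewrite mulrCA mulrA.
apply/polyP => h; rewrite coef0.
have [hh|hh] := ltnP h (K + d1 + c); last first.
  apply: nth_default; apply: leq_trans hh.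
  apply: (leq_trans (size_sum _ _ _)); apply/bigmax_leqP => s _.
  apply: (leq_trans (size_sum _ _ _)); apply/bigmax_leqP => i _.
  apply: leq_trans (size_polyMleq _ _) _.
  by rewrite (leq_trans (leq_pred _)) // -addnA leq_add.
rewrite -[RHS](xs (w, Ordinal hh)) coef_sum.
transitivity (\sum_s \sum_j \sum_k M (w, Ordinal hh) (s, j, k) * x (s, j, k)); last first.
  by rewrite pair_bigA /= pair_bigA /=; apply: eq_bigr => -[[s j] k] _.
apply: eq_bigr => s _; rewrite coef_sum; apply: eq_bigr => j _.
rewrite yE' mulr_suml coef_sum; apply: eq_bigr => k _.
by rewrite -scalerAl coefZ mulrC.
Qed.

(* The shift by [c], a bound on the degrees of the structure constants, makes
   [osz] submultiplicative. *)
Definition osz (d : nat) (x : C) : Prop :=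
  exists a : 'I_m.+1 -> {poly C},
    [/\ forall i, polyFq q (a i), forall i, (size (a i) + c <= d)%N & x = comb a].

Definition obase : R := abs theta * (1 + \sum_i abs (b i)).

Lemma obase_sum_ge1 : 1 <= 1 + \sum_i abs (b i).
Proof. by rewrite lerDl sumr_ge0 // => i _; apply: abs_ge0. Qed.

Lemma obase_ge1 : 1 <= obase.
Proof.
rewrite /obase -[leLHS]mulr1; apply: ler_pM => //; first exact: ltW.
exact: obase_sum_ge1.
Qed.

Lemma abs_polyFq_le (a : {poly C}) d : polyFq q a -> (size a <= d)%N ->
  abs a.[theta] <= abs theta ^+ d.
Proof.
move=> ha had; have [->|a0] := eqVneq a 0.
  by rewrite horner0 abs0 // exprn_ge0 // (abs_ge0 Hna).
rewrite Hinf // ler_weXn2l // ?ltW //.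
by apply: leq_trans had; apply: leq_pred.
Qed.

Lemma osz_upper d x : osz d x -> abs x <= obase ^+ d.
Proof.
move=> [a [ha hs ->]]; apply: (abs_sum_le Hna).
  by rewrite exprn_ge0 // (le_trans ler01 obase_ge1).
move=> i _; rewrite (absM Hna) exprMn; apply: ler_pM; rewrite ?(abs_ge0 Hna) //.
  by apply: abs_polyFq_le => //; apply: leq_trans (hs i); apply: leq_addr.
apply: (@le_trans _ _ (1 + \sum_i abs (b i))).
  rewrite (bigD1 i) //= addrCA lerDl addr_ge0 // sumr_ge0 // => j _.
  exact: abs_ge0.
rewrite -{1}[1 + _]expr1 ler_weXn2l ?obase_sum_ge1 //.
by apply: leq_trans (hs i); apply: leq_trans c0 (leq_addl _ _).
Qed.

(** Instead of a norm, a multiplier is found by counting: some nonzero element of the order takes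
    [x] into [F_q[theta]], where absolute values are at least [1], and its own height is
    controlled. *)
Lemma osz_lower d x : osz d x -> x != 0 -> 1 <= abs x * (obase ^+ m.+2) ^+ d.
Proof.
move=> [a [ha hs xE]] x0.
have cd : (c <= d)%N by apply: leq_trans (hs ord0); apply: leq_addl.
have d0 : (0 < d)%N by apply: leq_trans cd.
(* The least [K] with [m (K + d) < (m + 1) K]. As [c <= d] and [0 < d], it satisfies
   [K + c <= (m + 2) d], which explains the exponent [m.+2]. *)
pose K := (m * d).+1.
have hsz (t s : 'I_1) i : (size (a i) <= d - c)%N by rewrite leq_subRL // addnC.
have [|y [yF ys [s0 [i0 y0]] yz]] := @linear_solve 'I_1 'I_1 'I_m (fun=> ord0) (lift ord0)
   (fun _ _ => a) (d - c) K (fun _ _ => ha) hsz.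
  by rewrite !card_ord mul1n -addnA subnK // /K; nia.
rewrite (ord1 s0) in y0.
have z0 : comb (y ord0) != 0 by apply: comb_neq0 => //; exists i0.
pose P0 := mcomb (fun=> a) y ord0.
have P0F : polyFq q P0.
  apply: polyFq_sum => s _; apply: polyFq_sum => i _; apply: polyFq_sum => j _.
  by apply: polyFqM => //; apply: polyFqM.
have xzE : x * comb (y ord0) = P0.[theta].
  have := mcombE (fun _ : 'I_1 => a) y; rewrite big_ord1 -xE => ->.
  rewrite /comb (bigD1_ord ord0) //= b0 mulr1 big1 ?addr0 // => i _.
  by rewrite (yz i) horner0 mul0r.
have P00 : P0 != 0.
  apply/eqP => h; have := mulf_neq0 x0 z0; by rewrite xzE h horner0 eqxx.
apply: le_trans (polyFq_abs_ge1 P0F P00) _; rewrite -xzE (absM Hna).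
rewrite ler_wpM2l ?(abs_ge0 Hna) //.
have hz : osz (K + c) (comb (y ord0)).
  by exists (y ord0); split=> // i; rewrite leq_add2r.
apply: le_trans (osz_upper hz) _; rewrite -exprM ler_weXn2l ?obase_ge1 // /K.
nia.
Qed.

Lemma osz_poly (P : {poly C}) : polyFq q P -> osz (size P + c) P.[theta].
Proof.
move=> hP; exists (fun i => if i == ord0 then P else 0); split.
- by move=> i; case: eqP => // _; apply: polyFq0.
- by move=> i; case: eqP => _ //; rewrite size_poly0 leq_add2r.
rewrite /comb (bigD1 ord0) //= b0 mulr1 big1 ?addr0 // => i /negPf ->.
by rewrite horner0 mul0r.
Qed.

Lemma osz_height_order : height_order abs osz (obase ^+ m.+2) c.
Proof.
split.
- by rewrite exprn_ege1 // obase_ge1.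
- exact: c0.
- move=> d d' x dd [a [ha hs ->]]; exists a; split=> // i.
  exact: leq_trans (hs i) dd.
- have := osz_poly polyFq0; by rewrite size_poly0 horner0.
- move=> d x y [a [ha hs ->]] [a' [ha' hs' ->]]; exists (fun i => a i + a' i); split.
  + by move=> i; apply: polyFqD.
  + move=> i; have := size_polyD (a i) (a' i); have := hs i; have := hs' i; lia.
  by rewrite /comb -big_split; apply: eq_bigr => i _; rewrite hornerD mulrDl.
- move=> d x [a [ha hs ->]]; exists (fun i => - a i); split.
  + by move=> i; apply: polyFqN.
  + by move=> i; rewrite size_polyN.
  by rewrite /comb -sumrN; apply: eq_bigr => i _; rewrite hornerN mulNr.
- move=> d d' x y [a [ha hs ->]] [a' [ha' hs' ->]]; rewrite comb_mul.
  eexists; split; last by [].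
    move=> l; apply: polyFq_sum => i _; apply: polyFq_sum => j _.
    by apply: polyFqM => //; apply: polyFqM.
  move=> l; have h0 : (c + c <= d + d')%N.
    by apply: leq_add; [apply: leq_trans (hs l)|apply: leq_trans (hs' l)]; apply: leq_addl.
  suff : (size (\sum_i \sum_j a i * a' j * g i j l)%R <= d + d' - c)%N by lia.
  apply: (leq_trans (size_sum _ _ _)); apply/bigmax_leqP => i _.
  apply: (leq_trans (size_sum _ _ _)); apply/bigmax_leqP => j _.
  have h1 := size_polyMleq (a i * a' j) (g i j l); have h2 := size_polyMleq (a i) (a' j).
  have := hs i; have := hs' j; have := gsize i j l; lia.
- move=> d x h; apply: le_trans (osz_upper h) _; rewrite -exprM ler_weXn2l ?obase_ge1 //.
  by rewrite leq_pmull.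
- exact: osz_lower.
move=> S T M d d1 hal; have {hal} [al hal] : exists al : T -> S -> 'I_m.+1 -> {poly C},
   forall t s, [/\ forall i, polyFq q (al t s i), forall i, (size (al t s i) + c <= d1)%N & M t s = comb (al t s)].
  have h t : exists al : S -> 'I_m.+1 -> {poly C}, forall s, [/\ forall i, polyFq q (al s i),
      forall i, (size (al s i) + c <= d1)%N & M t s = comb (al s)].
    by have [al h] := choice (hal t); exists al.
  by have [al h'] := choice h; exists al.
move=> hcard.
have cd : (c < d)%N by rewrite -subn_gt0; case: (d - c)%N hcard => //; rewrite muln0.
have hcard' : (#|{: T * 'I_m.+1}| * ((d - c) + (d1 - c) + c) < #|S| * m.+1 * (d - c))%N.
  rewrite card_prod card_ord -mulnA (mulnC #|S|) -mulnA mulnCA ltn_pmul2l //.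
  by apply: leq_ltn_trans hcard; rewrite leq_mul2l; apply/orP; right; lia.
have hs t s i : (size (al t s i) <= d1 - c)%N by case: (hal t s) => _ /(_ i) h _; lia.
have hF t s i : polyFq q (al t s i) by case: (hal t s).
have [y [yF ys [s0 [i0 y0]] yz]] := linear_solve fst snd hF hs hcard'.
exists (fun s => comb (y s)); split.
- move=> s; exists (y s); split=> // i.
  by rewrite -(subnK (ltnW cd)) leq_add2r.
- by exists s0; apply: comb_neq0 => //; exists i0.
move=> t; under eq_bigr => s _ do (have [_ _ ->] := hal t s).
rewrite mcombE /comb big1 // => l _.
by rewrite (yz (t, l)) horner0 mul0r.
Qed.

End Order.

Lemma height_order_ex (Z : seq C) : (forall z, z \in Z -> inKbar q theta z) ->
  exists (Sz : nat -> C -> Prop) (kappa : R) (c d0 : nat) (a : {poly C}),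
    [/\ height_order abs Sz kappa c,
        forall P : {poly C}, polyFq q P -> Sz (size P + c)%N P.[theta],
        polyFq q a, a != 0 & forall z, z \in Z -> Sz d0 (a.[theta] * z)].
Proof.
move=> hZ.
have [m [b [b0 bfree bM bZ]]] : exists n (d : 'I_n.+1 -> C), [/\ d ord0 = 1,
    lin_free (inK q theta) d, forall i j, lin_span (inK q theta) d (d i * d j)
    & forall z, z \in Z -> lin_span (inK q theta) d z].
  apply: (free_algebra_basis HK) => z /hZ [Q [hQ Q0 rQ]]; by exists Q.
have [g hg] : exists g : 'I_m.+1 * 'I_m.+1 -> 'I_m.+1 -> C, forall ij,
    (forall l, inK q theta (g ij l)) /\ b ij.1 * b ij.2 = \sum_l g ij l * b l.
  have h (ij : 'I_m.+1 * 'I_m.+1) : exists g : 'I_m.+1 -> C,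
      (forall l, inK q theta (g l)) /\ b ij.1 * b ij.2 = \sum_l g l * b l.
    by have [g hg ->] := bM ij.1 ij.2; exists g.
  by have [g hg] := choice h; exists g.
have [A [AF A0 hA]] : exists a : {poly C}, [/\ polyFq q a, a != 0 &
    forall k : 'I_m.+1 * 'I_m.+1 * 'I_m.+1,
      exists2 b : {poly C}, polyFq q b & a.[theta] * g k.1 k.2 = b.[theta]].
  by apply: common_denom => k; case: (hg k.1).
have [G hG] : exists G : 'I_m.+1 * 'I_m.+1 * 'I_m.+1 -> {poly C}, forall k,
    polyFq q (G k) /\ A.[theta] * g k.1 k.2 = (G k).[theta].
  have h k : exists b : {poly C}, polyFq q b /\ A.[theta] * g k.1 k.2 = b.[theta].
    by have [b' h1 h2] := hA k; exists b'.
  by have [G hG] := choice h; exists G.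
have A1 : A.[theta] != 0 by apply: polyFq_theta0.
(* Rescaling all basis elements except 1 by a common denominator makes the
   structure constants polynomial. *)
pose sc (i : 'I_m.+1) : {poly C} := if i == ord0 then 1 else A.
pose be i := (sc i).[theta] * b i.
have scF i : polyFq q (sc i) by rewrite /sc; case: eqP => // _; apply: polyFq1.
have sc0 i : sc i != 0 by rewrite /sc; case: (i == ord0); rewrite ?oner_eq0.
have sc1 i : (sc i).[theta] != 0 by apply: polyFq_theta0.
(* Structure constants of the rescaled basis. Off index [0], [(A b_i) (A b_j)] is the sum of the
   [A G_l b_l]; for [l] nonzero the factor [A] is absorbed by the basis element [A b_l], while for
   [l = 0] it stays in the coefficient. *)
pose ga i j l : {poly C} :=
  if i == ord0 then (l == j)%:R else if j == ord0 then (l == i)%:R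
  else if l == ord0 then A * G (i, j, l) else G (i, j, l).
have boolF (t : bool) : polyFq q (t%:R : {poly C}).
  by case: t; [apply: polyFq1|apply: polyFq0].
have GF k : polyFq q (G k) by case: (hG k).
have gaF i j l : polyFq q (ga i j l).
  by rewrite /ga; do 3!case: ifP => _ //; apply: polyFqM.
have delta i : be i = \sum_l ((l == i)%:R : {poly C}).[theta] * be l.
  rewrite (bigD1 i) //= eqxx hornerC mul1r big1 ?addr0 // => j /negPf ->.
  by rewrite horner0 mul0r.
have be0 : be ord0 = 1 by rewrite /be /sc eqxx hornerC mul1r.
have beM i j : be i * be j = \sum_l (ga i j l).[theta] * be l.
  rewrite /ga; have [->|i0] := eqVneq i ord0; first by rewrite be0 mul1r -delta.
  have [->|j0] := eqVneq j ord0; first by rewrite be0 mulr1 -delta.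
  rewrite /be /sc (negPf i0) (negPf j0) mulrACA; have [_ /= ->] := hg (i, j).
  rewrite mulr_sumr; apply: eq_bigr => l _; have [_ /= hGl] := hG (i, j, l).
  case: eqP => l0; first by rewrite hornerC mul1r hornerM -hGl; ring.
  by rewrite -hGl; ring.
have befree : lin_free (inK q theta) be.
  move=> f hf hs l.
  have : f l * (sc l).[theta] = 0.
    apply: (bfree (fun l => f l * (sc l).[theta])) => [i|].
      by apply: (sfM HK) => //; apply: inK_poly.
    by rewrite -[RHS]hs; apply: eq_bigr => i _; rewrite mulrA.
  by move/eqP; rewrite mulf_eq0 (negPf (sc1 l)) orbF => /eqP.
pose c := (\max_k size (ga k.1.1 k.1.2 k.2)).+1.
have gac i j l : (size (ga i j l) <= c)%N.
  by apply: leqW; apply: (leq_bigmax (i, j, l)).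
have hord := osz_height_order be0 befree gaF gac (ltn0Sn _) beM.
have hpoly := fun P => osz_poly c be0 (P := P).
have hZ' (k : seq_sub Z) : exists f : 'I_m.+1 -> C,
    (forall l, inK q theta (f l)) /\ ssval k = \sum_l f l * be l.
  have [f hf ->] := bZ _ (ssvalP k); exists (fun l => f l / (sc l).[theta]); split.
    by move=> l; apply: (sfM HK) => //; apply/(sfV HK)/inK_poly.
  by apply: eq_bigr => l _; rewrite /be mulrA divfK.
have [f hf] := choice hZ'.
have [a [aF a0 ha]] : exists a : {poly C}, [/\ polyFq q a, a != 0 &
    forall k : seq_sub Z * 'I_m.+1,
      exists2 b : {poly C}, polyFq q b & a.[theta] * f k.1 k.2 = b.[theta]].
  by apply: common_denom => k; case: (hf k.1).
have [H hH] : exists H : seq_sub Z * 'I_m.+1 -> {poly C}, forall k,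
    polyFq q (H k) /\ a.[theta] * f k.1 k.2 = (H k).[theta].
  have h k : exists b : {poly C}, polyFq q b /\ a.[theta] * f k.1 k.2 = b.[theta].
    by have [b' h1 h2] := ha k; exists b'.
  by have [H hH] := choice h; exists H.
exists (osz be c), (obase be ^+ m.+2), c, (\max_k size (H k) + c)%N, a; split=> //.
move=> z zZ; exists (fun l => H (SeqSub zZ, l)); split.
- by move=> l; case: (hH (SeqSub zZ, l)).
- by move=> l; rewrite leq_add2r; apply: (leq_bigmax (SeqSub zZ, l)).
have [_ /= zE] := hf (SeqSub zZ).
rewrite [in LHS]zE /comb mulr_sumr; apply: eq_bigr => l _.
by have [_ /= <-] := hH (SeqSub zZ, l); rewrite mulrA.
Qed.

End Model.

(** * Linear independence of values of solutions of difference systems *)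

Section Twist.
Variables (R : realType) (C : closedFieldType) (abs : C -> R) (p e : nat).
Local Notation q := (p ^ e)%N.
Hypothesis hp : p \in [pchar C].
Hypothesis e0 : (0 < e)%N.
Hypothesis Hna : nonarch_abs abs.
Local Notation fr n := (frob e hp n).
Local Notation phi n := (ser_map (fr n)).

Lemma q_gt1 : (1 < q)%N.
Proof. by rewrite -[1%N](expn0 p) ltn_exp2l // (prime_gt1 (pcharf_prime hp)). Qed.

Lemma qX_gt0 n : (0 < q ^ n)%N.
Proof. by rewrite expn_gt0 ltnW // q_gt1. Qed.

Lemma frob_inj n : injective (fr n).
Proof. exact: fmorph_inj. Qed.

Lemma frob_surj n (y : C) : exists x, fr n x = y.
Proof.
have [x hx] := solve_monicpoly (fun i => if i == 0%N then y else 0) (qX_gt0 n).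
exists x; rewrite frobE hx -(prednK (qX_gt0 n)) big_ord_recl /= expr0 mulr1 big1 ?addr0 //.
by move=> i _; rewrite mul0r.
Qed.

Lemma phi_comp m n f : phi (m + n) f = phi m (phi n f).
Proof. by apply: seriesP => k /=; rewrite frobD. Qed.

Lemma phi0 f : phi 0 f = f.
Proof. by apply: seriesP => k /=; rewrite frob0. Qed.

Lemma phi_inj n : injective (phi n).
Proof.
move=> f g /(congr1 (@coefs C)) h; apply: seriesP => k.
by apply: (@frob_inj n); have := congr1 (fun F => F k) h.
Qed.

Lemma abs_frob n x : abs (fr n x) = abs x ^+ (q ^ n).
Proof. by rewrite frobE absX. Qed.

Lemma bnd_phi B rho f n : 0 < rho -> bnd abs B rho f ->
  bnd abs (B ^+ (q ^ n)) (rho ^+ (q ^ n)) (phi n f).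
Proof.
move=> r0 hf k /=; rewrite abs_frob -exprM mulnC exprM -exprMn.
rewrite lerXn2r ?hf // nnegrE ?(bnd_ge0 Hna r0 hf) //.
by rewrite mulr_ge0 ?(abs_ge0 Hna) ?exprn_ge0 // ltW.
Qed.

Lemma evl_phi f x y n : evl abs f x y -> evl abs (phi n f) (fr n x) (fr n y).
Proof.
move=> h; apply: cvg_abs_ext (cvg_absX Hna (q ^ n) h) => N.
rewrite -frobE frob_sum; apply: eq_bigr => i _.
by rewrite rmorphM rmorphXn.
Qed.

End Twist.

Lemma lowest_coef (A : nzRingType) (n : nat) (P : 'I_n -> {poly A}) : (exists i, P i != 0) ->
  exists h, (exists i, (P i)`_h != 0) /\ forall i k, (k < h)%N -> (P i)`_k = 0.
Proof.
move=> [i0 hi0].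
have ex : exists h, [exists i, (P i)`_h != 0].
  exists (size (P i0)).-1; apply/existsP; exists i0.
  by rewrite -/(lead_coef _) lead_coef_eq0.
exists (ex_minn ex); case: ex_minnP => h /existsP hh hmin; split=> // i k kh.
apply/eqP/negPn/negP => hk; move: kh; rewrite ltnNge => /negP; apply.
by apply: hmin; apply/existsP; exists i.
Qed.

(** Here [x = q^mu] is the cost of twisting, [a0 d] pays for a power of [theta], [a1 y] for an
    iterate of [Phi] at [theta], and the last [a0] for the relation. The summand [1] in [a2] makes
    it positive, as [siegel_count] requires. *)
Lemma siegel_entry_size (a0 a1 a2 d Q x y : nat) : a2 = (2 * a0 + a1 + 1)%N ->
  (d * x <= Q)%N -> (y * x = Q)%N -> (x <= Q)%N ->
  ((a0 * d + (a1 * y + a0)) * x <= a2 * Q)%N.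
Proof.
move=> -> h1 h2 h3; have := leq_mul (leqnn a0) h1; have := leq_mul (leqnn a0) h3.
have -> : ((a0 * d + (a1 * y + a0)) * x = a0 * (d * x) + (a1 * (y * x) + a0 * x))%N by ring.
rewrite h2; nia.
Qed.

(** Count for the auxiliary function: equations and unknowns are in the ratio [2l - 2 : 2l - 1],
    which is compensated by the height [2l (c + a)]. After division by [l s Q] the margin is at
    least [c + 2a]. *)
Lemma siegel_count (l s Q c a : nat) : (0 < l)%N -> (0 < s)%N -> (0 < Q)%N -> (0 < a)%N ->
  (2 * l * s * (l - 1) * (2 * l * (c + a) * Q + a * Q) <
   l * ((2 * l - 1) * s) * (2 * l * (c + a) * Q - c))%N.
Proof.
move=> l0 s0 Q0 a0.
apply: (@leq_trans (l * ((2 * l - 1) * s) * ((2 * l * (c + a) - c) * Q))); last first.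
  rewrite leq_mul2l; apply/orP; right; rewrite mulnBl; apply: leq_sub2l; by rewrite leq_pmulr.
have -> : (2 * l * s * (l - 1) * (2 * l * (c + a) * Q + a * Q)
  = l * s * Q * (2 * (l - 1) * (2 * l * (c + a) + a)))%N by rewrite -mulnDl; ring.
have -> : (l * ((2 * l - 1) * s) * ((2 * l * (c + a) - c) * Q)
  = l * s * Q * ((2 * l - 1) * (2 * l * (c + a) - c)))%N by ring.
rewrite ltn_pmul2l ?muln_gt0 ?l0 ?s0 //.
by case: l l0 => // l _; rewrite subn1 /=; nia.
Qed.

Lemma sum_geom_le (q N : nat) : (1 < q)%N -> (\sum_(i < N) q ^ i <= q ^ N)%N.
Proof.
move=> q1; elim: N => [|N IH]; first by rewrite big_ord0.
rewrite big_ord_recr /= expnS; apply: leq_trans (_ : 2 * q ^ N <= _)%N.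
  by rewrite mul2n -addnn leq_add2r.
by rewrite leq_mul2r q1 orbT.
Qed.

(** Count for the twisted equation: the ratio of equations to unknowns is [2l + 1 : 2l + 2], and the
    factor [2l + 3] in the height leaves a margin [c + 2a] after division by [l w]. *)
Lemma siegel_count2 (l D w c a : nat) : (0 < l)%N -> (0 < w)%N -> D = (2 * l * w)%N ->
  (0 < c)%N ->
  (l * (D + w) * ((2 * l + 3) * (c + a) + a) < l.+1 * D * ((2 * l + 3) * (c + a) - c))%N.
Proof.
move=> l0 w0 -> c0.
have -> : (l * (2 * l * w + w) * ((2 * l + 3) * (c + a) + a) =
  l * w * ((2 * l + 1) * ((2 * l + 3) * (c + a) + a)))%N by ring.
have -> : (l.+1 * (2 * l * w) * ((2 * l + 3) * (c + a) - c) =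
  l * w * ((2 * l + 2) * ((2 * l + 3) * (c + a) - c)))%N by rewrite -addn1; ring.
rewrite ltn_pmul2l ?muln_gt0 ?l0 //; nia.
Qed.

Section ABP.
Variables (R : realType) (C : closedFieldType) (abs : C -> R) (p e : nat) (theta : C).
Local Notation q := (p ^ e)%N.
Hypothesis hp : p \in [pchar C].
Hypothesis e0 : (0 < e)%N.
Hypothesis Hna : nonarch_abs abs.
Hypothesis theta1 : 1 < abs theta.
Hypothesis Hcomplete : forall s, cauchy_abs abs s -> exists l, cvg_abs abs s l.
Local Notation fr n := (frob e hp n).
Local Notation phi n := (ser_map (fr n)).
Local Notation evl := (evl abs).
Local Notation bnd := (bnd abs).

Variables (Sz : nat -> C -> Prop) (kappa : R) (c : nat).
Hypothesis hO : height_order abs Sz kappa c.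

Lemma Sz_le d d' x : (d <= d')%N -> Sz d x -> Sz d' x.
Proof. exact: (ho_le hO). Qed.

Lemma Sz0 d : (c <= d)%N -> Sz d 0.
Proof. by move=> cd; apply: Sz_le cd (ho0 hO). Qed.

Lemma Sz_sum (I : Type) (r : seq I) (P : pred I) (F : I -> C) d : (c <= d)%N ->
  (forall i, P i -> Sz d (F i)) -> Sz d (\sum_(i <- r | P i) F i).
Proof.
by move=> cd h; elim/big_rec: _ => [|i x Pi hx]; [apply: Sz0|apply: (hoD hO) (h i Pi) hx].
Qed.

Lemma SzX d x k : (0 < k)%N -> Sz d x -> Sz (d * k) (x ^+ k).
Proof.
case: k => // k _ hx; elim: k => [|k IH]; first by rewrite muln1 expr1.
by rewrite exprS mulnS; apply: (hoM hO).
Qed.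

Lemma Sz_frob d x n : Sz d x -> Sz (d * q ^ n) (fr n x).
Proof. by move=> hx; rewrite frobE; apply: SzX => //; apply: qX_gt0 hp e0 n. Qed.

Definition polySz d (P : {poly C}) := forall k, Sz d P`_k.

Lemma polySzM d d' P Q : (c <= d + d')%N -> polySz d P -> polySz d' Q -> polySz (d + d') (P * Q).
Proof.
move=> cd hP hQ k; rewrite coefM; apply: Sz_sum => // i _; exact: (hoM hO).
Qed.

Lemma polySz_sum (I : Type) (r : seq I) (Q : pred I) (F : I -> {poly C}) d : (c <= d)%N ->
  (forall i, Q i -> polySz d (F i)) -> polySz d (\sum_(i <- r | Q i) F i).
Proof. by move=> cd h k; rewrite coef_sum; apply: Sz_sum => // i Qi; apply: h. Qed.

Lemma polySz_map d P n : polySz d P -> polySz (d * q ^ n) (map_poly (fr n) P).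
Proof. by move=> h k; rewrite coef_map; apply: Sz_frob. Qed.

(** Let [s] be the first index with [al s] nonzero. For a small root [x] the later terms carry at
    least one more factor [abs x] than [abs x ^+ (q ^ s)], so [abs (al s)] is at most
    [kappa ^+ d * abs x]; the Liouville inequality bounds it from below. *)
Lemma small_root_bound (n d : nat) (al : 'I_n -> C) (x : C) :
  (forall i, Sz d (al i)) -> (exists i, al i != 0) -> x != 0 -> abs x <= 1 ->
  \sum_i al i * fr i x = 0 -> 1 <= abs x * kappa ^+ (2 * d).
Proof.
move=> hal [i0 ai0] x0 x1 hs.
have k1 := ho_kappa hO; have kd0 : 0 <= kappa ^+ d by rewrite exprn_ge0 // (le_trans ler01).
case: (@arg_minnP _ i0 (fun i => al i != 0) (fun i : 'I_n => nat_of_ord i) ai0) => s as0 smin.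
have xs : 0 < abs x ^+ (q ^ s) by rewrite exprn_gt0 // abs_gt0.
have key : abs (al s) <= kappa ^+ d * abs x.
  have : abs (al s * fr s x) <= kappa ^+ d * abs x ^+ (q ^ s).+1.
    move: hs; rewrite (bigD1 s) //= => /eqP; rewrite addr_eq0 => /eqP ->; rewrite absN //.
    apply: (abs_sum_le Hna) => [|i i_s].
      by rewrite mulr_ge0 // exprn_ge0 // abs_ge0.
    have [ai|ai] := eqVneq (al i) 0.
      by rewrite ai mul0r abs0 // mulr_ge0 // exprn_ge0 // abs_ge0.
    have si : (s < i)%N by rewrite ltn_neqAle smin // andbT eq_sym; apply: contraNneq i_s => /val_inj ->.
    rewrite absM // abs_frob //; apply: ler_pM; rewrite ?exprn_ge0 ?abs_ge0 //.
      exact: (ho_upper hO).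
    apply: ler_wiXn2l => //; first exact: abs_ge0.
    by rewrite ltn_exp2l // (q_gt1 hp e0).
  by rewrite absM // abs_frob // exprSr mulrA mulrAC ler_pM2r.
apply: le_trans (ho_lower hO (hal s) as0) _.
rewrite mul2n -addnn exprD mulrA ler_wpM2r //.
by rewrite mulrC.
Qed.

Variables (J : finType) (psi : J -> series C) (rho B : R) (Phi : J -> J -> {poly C}).
Variables (lam : J -> C) (vl : J -> C) (c0 : nat).
Hypothesis B1 : 1 <= B.
Hypothesis rho_theta : abs theta < rho.
Hypothesis psi_bnd : forall j, bnd B rho (psi j).
Hypothesis psi_free : forall P : J -> {poly C},
  \sum_j ser_poly (P j) * psi j = 0 -> forall j, P j = 0.
Hypothesis psi_phi : forall i, phi 1 (psi i) = \sum_j ser_poly (Phi i j) * psi j.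
Hypothesis psi_val : forall j, evl (psi j) theta (vl j).
Hypothesis cc0 : (c <= c0)%N.
Hypothesis Sz1 : Sz c0 1.
Hypothesis SzT : Sz c0 theta.
Hypothesis SzPhi : forall i j, polySz c0 (Phi i j).
Hypothesis Szlam : forall j, Sz c0 (lam j).

Let rho1 : 1 < rho. Proof. exact: lt_trans rho_theta. Qed.
Let rho0 : 0 < rho. Proof. exact: lt_trans rho1. Qed.

(** The product [phi^(n-1)(Phi) ... phi(Phi) Phi], the matrix of the [n]-fold twist. *)
Fixpoint Phi_iter (n : nat) : J -> J -> {poly C} :=
  if n is n'.+1 then fun i j => \sum_k map_poly (fr n') (Phi i k) * Phi_iter n' k j
  else fun i j => (i == j)%:R.

Lemma psi_phin n i : phi n (psi i) = \sum_j ser_poly (Phi_iter n i j) * psi j.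
Proof.
elim: n i => [|n IH] i.
  rewrite phi0 (bigD1 i) //= eqxx rmorph1 mul1r big1 ?addr0 // => j /negPf.
  by rewrite eq_sym => ->; rewrite rmorph0 mul0r.
rewrite -addn1 phi_comp psi_phi rmorph_sum.
under eq_bigr => k _ do rewrite rmorphM /= IH ser_map_poly mulr_sumr.
rewrite exchange_big; apply: eq_bigr => j _ /=.
rewrite addn1 /= rmorph_sum mulr_suml; apply: eq_bigr => k _.
by rewrite rmorphM mulrA.
Qed.

Lemma SzXc0 x k : Sz c0 x -> Sz (c0 * k.+1) (x ^+ k).
Proof.
move=> hx; case: k => [|k]; first by rewrite expr0 muln1.
by apply: Sz_le (SzX (ltn0Sn k) hx); rewrite leq_mul2l leqnSn orbT.
Qed.

Definition Phi_size := \max_(ij : J * J) size (Phi ij.1 ij.2).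
Definition Phi_height := (c0 * Phi_size.+2)%N.

(** The new factor has twisted coefficients but is evaluated at the untwisted [theta], so it costs
    at most [Phi_height * q ^ n], like the previous product; since [2 <= q] the two together fit
    under [q ^ n.+1]. *)
Lemma Sz_Phi_iter_theta n i j : Sz (Phi_height * q ^ n) (Phi_iter n i j).[theta].
Proof.
have c1c0 : (c0 <= Phi_height)%N by rewrite /Phi_height leq_pmulr.
elim: n i j => [|n IH] i j /=.
  rewrite muln1; apply: Sz_le c1c0 _.
  by case: eqP => _; [rewrite hornerC|rewrite horner0; apply: Sz0].
have cn m : (c <= Phi_height * q ^ m)%N.
  by apply: leq_trans cc0 (leq_trans c1c0 _); rewrite leq_pmulr // (qX_gt0 hp e0).
rewrite horner_sum; apply: Sz_sum => // k _; rewrite hornerM.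
apply: (@Sz_le (Phi_height * q ^ n + Phi_height * q ^ n)).
  by rewrite addnn -mul2n mulnCA leq_mul2l expnS leq_mul2r (q_gt1 hp e0) !orbT.
apply: (hoM hO) (IH _ _); rewrite horner_coef; apply: Sz_sum => // h _.
rewrite coef_map; apply: (@Sz_le (c0 * q ^ n + c0 * Phi_size)).
  by have := qX_gt0 hp e0 n; rewrite /Phi_height; nia.
apply: (hoM hO); first exact/Sz_frob/SzPhi.
apply: Sz_le (SzXc0 h SzT); rewrite leq_mul2l; apply/orP; right.
apply: (leq_trans (ltn_ord h)); rewrite size_map_poly.
exact: (leq_bigmax (i, k)).
Qed.

(** Only the iterates up to [ncomp] are needed at the level of coefficients, so any bound
    independent of [s] is good enough. *)
Lemma Sz_Phi_iter_coef n : exists c3, (c <= c3)%N /\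
  forall m, (m <= n)%N -> forall i j, polySz c3 (Phi_iter m i j).
Proof.
elim: n => [|n [c3 [cc3 IH]]].
  exists c0; split=> // -[|//] _ i j k /=.
  by case: eqP => _; rewrite ?coef0 ?coef1; [case: eqP => _ //|]; apply: Sz0.
exists (c0 * q ^ n + c3)%N; split=> [|m]; first by apply: leq_trans cc3 (leq_addl _ _).
rewrite leq_eqVlt => /orP[/eqP -> i j|mn i j k]; last first.
  by apply: Sz_le (IH m mn i j k); apply: leq_addl.
rewrite /=; apply: polySz_sum => [|k _]; first by apply: leq_trans cc3 (leq_addl _ _).
apply: polySzM; first by apply: leq_trans cc3 (leq_addl _ _).
  exact: polySz_map.
exact: IH.
Qed.

Definition phin_val n i := \sum_j (Phi_iter n i j).[theta] * vl j.

Lemma evl_phin n i : evl (phi n (psi i)) theta (phin_val n i).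
Proof.
rewrite psi_phin; apply: (evl_sum Hna) => j _.
have [D hD] := bnd_poly_ex Hna rho0 (Phi_iter n i j).
exact: (evlM Hna rho0 hD (psi_bnd j) rho_theta (evl_poly Hna _ _) (psi_val j)).
Qed.

Lemma evl_phin_frob mu nu i :
  evl (phi (mu + nu) (psi i)) (fr mu theta) (fr mu (phin_val nu i)).
Proof. by rewrite phi_comp; apply: (evl_phi e hp Hna); apply: evl_phin. Qed.

Section Relation.
Variable j0 : J.
Hypothesis lam0 : lam j0 != 0.
Hypothesis rel : \sum_j lam j * vl j = 0.

(** The coefficient of [vl j'] left after [vl j0] is eliminated from [phin_val nu i] by the
    relation, scaled by [lam j0] to avoid a division. *)
Definition elim_entry nu i j' := (Phi_iter nu i j').[theta] * lam j0 - (Phi_iter nu i j0).[theta] * lam j'.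

Lemma lam_phin_val nu i : lam j0 * phin_val nu i = \sum_(j' | j' != j0) elim_entry nu i j' * vl j'.
Proof.
have E : lam j0 * vl j0 = - \sum_(j' | j' != j0) lam j' * vl j'.
  by apply/eqP; rewrite -addr_eq0; move/eqP: rel; rewrite (bigD1 j0).
rewrite /phin_val (bigD1 j0) //= mulrDr mulrCA E mulrN mulr_sumr -sumrN mulr_sumr -big_split.
by apply: eq_bigr => j' _; rewrite /elim_entry /=; ring.
Qed.

Definition ncomp := #|J|.
Lemma ncomp_gt0 : (0 < ncomp)%N. Proof. by apply/card_gt0P; exists j0. Qed.

Definition entry_height := (2 * c0 + Phi_height + 1)%N.
Definition aux_height := (2 * ncomp * (c + entry_height))%N.

Lemma Sz_elim_entry nu i j' : Sz (Phi_height * q ^ nu + c0) (elim_entry nu i j').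
Proof.
by apply: (hoD hO); [|apply: (hoN hO)]; apply: (hoM hO) => //; apply: Sz_Phi_iter_theta.
Qed.

(** * The auxiliary function and its twisted equation *)

Section Aux.
Variable s : nat.
Hypothesis s0 : (0 < s)%N.
(** [N] zeros and [d] coefficients per component: [N (l - 1) < l d] for [l = ncomp] permits Siegel's
    lemma, and the excess [N - d = s] produces the smallness. The summand [d] in [M1] gives
    [d q^mu <= q^M1], so powers of [theta] cost no more than the iterates of [Phi]. *)
Let N := (2 * ncomp * s)%N.
Let d := ((2 * ncomp - 1) * s)%N.
Let M1 := (N + d)%N.
Let Q := (q ^ M1)%N.

Let Q0 : (0 < Q)%N. Proof. exact: qX_gt0 hp e0 M1. Qed.
Let Nd : N = (d + s)%N. Proof. by rewrite /N /d; have := ncomp_gt0; nia. Qed.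


Lemma siegel_aux : exists y : J * 'I_d -> C,
  [/\ forall u, Sz (aux_height * Q) (y u), exists u : J * 'I_d, y u != 0 &
    forall (mu : 'I_N) j', j' != j0 ->
      \sum_(u : J * 'I_d) fr mu (theta ^+ u.2 * elim_entry (M1 - mu) u.1 j') * y u = 0].
Proof.
have := @ho_siegel _ _ _ _ _ _ hO (J * 'I_d)%type ('I_N * {j | j != j0})%type
   (fun (t : 'I_N * {j | j != j0}) (u : J * 'I_d) => fr t.1 (theta ^+ u.2 * elim_entry (M1 - t.1) u.1 (sval t.2))) (aux_height * Q) (entry_height * Q).
case.
- move=> [mu [j' hj']] [i k] /=.
  apply: (@Sz_le ((c0 * d + (Phi_height * q ^ (M1 - mu) + c0)) * q ^ mu)).
    have muN := ltn_ord mu.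
    have h1 : (d * q ^ mu <= Q)%N.
      rewrite /Q /M1 addnC expnD leq_mul //; first exact/ltnW/ltn_expl/(q_gt1 hp e0).
      by rewrite leq_exp2l ?(q_gt1 hp e0) // ltnW.
    have h2 : (q ^ (M1 - mu) * q ^ mu = Q)%N.
      by rewrite -expnD subnK // (leq_trans (ltnW muN)) // leq_addr.
    have h3 : (q ^ mu <= Q)%N.
      by rewrite leq_exp2l ?(q_gt1 hp e0) // (leq_trans (ltnW muN)) // leq_addr.
    exact: (siegel_entry_size (erefl entry_height) h1 h2 h3).
  apply: Sz_frob; apply: (hoM hO); last exact: Sz_elim_entry.
  by apply: Sz_le (SzXc0 k SzT); rewrite leq_mul2l ltn_ord orbT.
- rewrite !card_prod !card_ord card_sig.
  have -> : #|[pred x | x != j0]| = (ncomp - 1)%N by rewrite /ncomp subn1 -(cardC1 j0); apply: eq_card.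
  by apply: siegel_count; rewrite ?ncomp_gt0 // /entry_height addn1.
move=> y [hy ny hs]; exists y; split=> // mu j' hj'.
exact: (hs (mu, exist _ j' hj')).
Qed.

Lemma aux_function : exists y : J -> {poly C},
  [/\ forall j, polySz (aux_height * Q) (y j), exists j, y j != 0, forall j, (size (y j) <= d)%N &
   forall mu, (mu < N)%N -> evl (\sum_j ser_poly (y j) * phi M1 (psi j)) (fr mu theta) 0].
Proof.
have [y [hy [[i0 k0] ny] hs]] := siegel_aux.
pose Y j : {poly C} := \poly_(k < d) if insub k is Some k' then y (j, k') else 0.
have cQ : (c <= aux_height * Q)%N.
  apply: (leq_trans _ (leq_pmulr _ Q0)); apply: (leq_trans (leq_addr entry_height c)).
  by rewrite /aux_height leq_pmull // muln_gt0 ncomp_gt0.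
have YE j : Y j = \sum_(k < d) y (j, k) *: 'X^k.
  by rewrite /Y poly_def; apply: eq_bigr => k _; rewrite valK.
exists Y; split.
- move=> j k; rewrite coef_poly; case: ifP => kd; last exact: Sz0.
  by case: insubP => [k' _ _|_]; [apply: hy|apply: Sz0].
- exists i0; apply/eqP => /(congr1 (fun P : {poly C} => P`_k0)).
  by rewrite coef_poly ltn_ord valK coef0 => /eqP; rewrite (negPf ny).
- by move=> j; apply: size_poly.
move=> mu muN.
have muM : (mu <= M1)%N by rewrite (leq_trans (ltnW muN)) // leq_addr.
have rQ0 : 0 < rho ^+ Q by rewrite exprn_gt0.
have th : abs (fr mu theta) < rho ^+ Q.
  rewrite abs_frob //; apply: (@le_lt_trans _ _ (abs theta ^+ Q)).
    rewrite ler_weXn2l ?ltW // leq_exp2l //; exact: (q_gt1 hp e0).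
  by rewrite ltrXn2r ?abs_ge0 // -lt0n.
have ev : evl (\sum_j ser_poly (Y j) * phi M1 (psi j)) (fr mu theta)
    (\sum_j (Y j).[fr mu theta] * fr mu (phin_val (M1 - mu) j)).
  apply: (evl_sum Hna) => j _; have [D hD] := bnd_poly_ex Hna rQ0 (Y j).
  apply: (evlM Hna rQ0 hD (bnd_phi e hp Hna M1 rho0 (psi_bnd j)) th); first exact: evl_poly.
  by rewrite -{1}(subnKC muM); apply: evl_phin_frob.
suff E : \sum_j (Y j).[fr mu theta] * fr mu (phin_val (M1 - mu) j) = 0 by rewrite E in ev.
(* After multiplication by the twisted [lam j0] the value is a combination of the twisted [vl j']
   with [j' != j0]; the Siegel conditions annihilate each of its coefficients separately. *)
apply: (mulfI (x := fr mu (lam j0))); first by rewrite fmorph_eq0.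
rewrite mulr0 mulr_sumr.
transitivity (\sum_(j' | j' != j0) fr mu (vl j') *
    \sum_(u : J * 'I_d) fr mu (theta ^+ u.2 * elim_entry (M1 - mu) u.1 j') * y u); last first.
  by rewrite big1 // => j' hj'; rewrite (hs (Ordinal muN)) // mulr0.
under [RHS]eq_bigr => j' _ do rewrite mulr_sumr.
rewrite exchange_big /=.
transitivity (\sum_j \sum_(k < d) \sum_(j' | j' != j0)
    fr mu (vl j') * (fr mu (theta ^+ k * elim_entry (M1 - mu) j j') * y (j, k))); last first.
  by rewrite pair_bigA /=; apply: eq_bigr => -[].
apply: eq_bigr => j _; rewrite mulrCA -rmorphM lam_phin_val rmorph_sum /=.
rewrite YE horner_sum mulr_suml; apply: eq_bigr => k _.
rewrite mulr_sumr; apply: eq_bigr => j' _.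
by rewrite hornerZ hornerXn !rmorphM rmorphXn /=; ring.
Qed.

Variable y : J -> {poly C}.
Hypothesis ySz : forall j, polySz (aux_height * Q) (y j).
Hypothesis y0 : exists j, y j != 0.
Hypothesis ysize : forall j, (size (y j) <= d)%N.
Let G := \sum_j ser_poly (y j) * phi M1 (psi j).
Hypothesis Gzero : forall mu, (mu < N)%N -> evl G (fr mu theta) 0.

(** The twist is bijective on [C], so the coefficients of [G] can be untwisted [M1] times, which
    turns [G = 0] into a relation between the [psi j]. *)
Lemma aux_neq0 : G != 0.
Proof.
apply/eqP => G0; case: y0 => j /eqP; apply.
have [h hh] := choice (fun x => frob_surj hp e0 M1 x).
have h0 : h 0 = 0 by apply: (@frob_inj _ _ e hp M1); rewrite hh rmorph0.
pose Y i : {poly C} := map_poly h (y i).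
have YE i : map_poly (fr M1) (Y i) = y i.
  by apply/polyP => k; rewrite coef_map /= coef_map_id0 // hh.
have : \sum_i ser_poly (Y i) * psi i = 0.
  apply: (@phi_inj _ _ e hp M1); rewrite rmorph0 rmorph_sum -[RHS]G0.
  by apply: eq_bigr => i _; rewrite rmorphM /= ser_map_poly YE.
by move=> /psi_free /(_ j) Yj; rewrite -YE Yj rmorph0.
Qed.

(** At radius [rho^Q] the coefficients contribute [kappa^(aux_height Q) rho^(Q d)] and the twisted
    functions [B^Q]. The [N] zeros divide this by [rho^(Q N)], at the cost of their product, at most
    [abs theta ^+ Q]. The exponent [N - d = s] survives. *)
Lemma aux_small k : abs (coefs G k) <=
  (abs theta * kappa ^+ aux_height * B / rho ^+ s) ^+ Q.
Proof.
have r0 := rho0; have rQ1 : 1 <= rho ^+ Q by rewrite exprn_ege1 // ltW.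
have rQ0 : 0 < rho ^+ Q by rewrite exprn_gt0.
have k0 : 0 <= kappa by apply: le_trans ler01 (ho_kappa hO).
have q1 := q_gt1 hp e0.
have yb j : bnd (kappa ^+ (aux_height * Q) * (rho ^+ Q) ^+ d) (rho ^+ Q) (ser_poly (y j)).
  move=> i; rewrite coefs_poly; have [di|di] := leqP d i.
    by rewrite nth_default ?(leq_trans (ysize j)) // abs0 // mul0r mulr_ge0 // exprn_ge0 // ltW.
  apply: ler_pM; rewrite ?abs_ge0 ?exprn_ge0 ?(ltW rQ0) ?(ltW r0) //.
    exact: (ho_upper hO (ySz j i)).
  by rewrite ler_weXn2l // ltnW.
have Gb : bnd (kappa ^+ (aux_height * Q) * (rho ^+ Q) ^+ d * B ^+ Q) (rho ^+ Q) G.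
  apply: (bnd_sum Hna rQ0) => [|j _].
    by rewrite !mulr_ge0 ?exprn_ge0 ?(ltW rQ0) ?(ltW r0) // (le_trans ler01).
  exact: (bndM Hna rQ0 (yb j) (bnd_phi e hp Hna M1 rho0 (psi_bnd j))).
have ath i : abs (fr i theta) = abs theta ^+ (q ^ i) by rewrite abs_frob.
have NQ i : (i < N)%N -> (i <= M1)%N.
  by move=> iN; apply: leq_trans (ltnW iN) (leq_addr _ _).
have h1 i : (i < N)%N -> 1 <= abs (fr i theta) < rho ^+ Q /\ evl G (fr i theta) 0.
  move=> iN; split; last exact: Gzero.
  rewrite ath exprn_ege1 ?ltW //=; apply: (@le_lt_trans _ _ (abs theta ^+ Q)).
    by rewrite ler_weXn2l ?ltW // leq_exp2l // NQ.
  by rewrite ltrXn2r ?abs_ge0 // -lt0n.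
have h2 i j : (i < j < N)%N -> fr i theta != fr j theta.
  move=> /andP[ij jN]; apply/eqP => /(congr1 abs); rewrite !ath => E.
  have : abs theta ^+ (q ^ i) < abs theta ^+ (q ^ j) by rewrite ltr_eXn2l // ltn_exp2l.
  by rewrite E ltxx.
apply: le_trans (zeros_bound Hna rQ1 Hcomplete Gb h1 h2 k) _.
apply: (@le_trans _ _ (abs theta ^+ Q * (kappa ^+ (aux_height * Q) * (rho ^+ Q) ^+ d * B ^+ Q / (rho ^+ Q) ^+ N))).
  apply: ler_wpM2r.
    by rewrite mulr_ge0 ?invr_ge0 ?exprn_ge0 ?(ltW rQ0) ?(ltW r0) // !mulr_ge0 ?exprn_ge0 ?(ltW rQ0) ?(ltW r0) // (le_trans ler01).
  under eq_bigr => i _ do rewrite ath.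
  rewrite -expr_sum ler_weXn2l ?ltW //; apply: leq_trans (sum_geom_le N q1) _.
  by rewrite leq_exp2l // leq_addr.
rewrite Nd exprD !exprMn exprVn -!exprM [(s * Q)%N]mulnC le_eqVlt; apply/orP; left; apply/eqP.
have rd : rho ^+ (Q * d) != 0 by rewrite gt_eqF // exprn_gt0.
have rs : rho ^+ (Q * s) != 0 by rewrite gt_eqF // exprn_gt0.
by field; rewrite rd rs.
Qed.

(** The [ncomp.+1] series [phi^i G] are polynomial combinations of only [ncomp] series
    [phi^M1 psi_j], hence dependent. Only the heights of the [A i] matter later, so their degrees
    need no control. *)
Lemma diff_relation c3 : (c <= c3)%N ->
  (forall m, (m <= ncomp)%N -> forall i j, polySz c3 (Phi_iter m i j)) ->
  exists A : 'I_ncomp.+1 -> {poly C},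
   [/\ forall i, polySz ((2 * ncomp + 3) * (c + (aux_height * q ^ ncomp + c3) * Q)) (A i),
       exists i, A i != 0 & \sum_i ser_poly (A i) * phi i G = 0].
Proof.
move=> cc3 hc3; set d2 := ((aux_height * q ^ ncomp + c3) * Q)%N.
have cd2 : (c <= d2)%N.
  by apply: leq_trans cc3 _; apply: (leq_trans _ (leq_pmulr _ Q0)); apply: leq_addl.
pose w (i : 'I_ncomp.+1) (j : J) : {poly C} :=
  \sum_k map_poly (fr i) (y k) * map_poly (fr M1) (Phi_iter i k j).
have wE (i : 'I_ncomp.+1) : phi i G = \sum_j ser_poly (w i j) * phi M1 (psi j).
  rewrite /G rmorph_sum /=.
  under eq_bigr => k _ do
    rewrite rmorphM /= ser_map_poly -phi_comp addnC phi_comp psi_phin rmorph_sum mulr_sumr.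
  rewrite exchange_big; apply: eq_bigr => j _; rewrite /w rmorph_sum mulr_suml.
  by apply: eq_bigr => k _; rewrite !rmorphM /= ser_map_poly mulrA.
have wSz i j : polySz d2 (w i j).
  apply: polySz_sum => // k _ h.
  have il : (i <= ncomp)%N by rewrite -ltnS.
  apply: (@Sz_le (aux_height * Q * q ^ i + c3 * q ^ M1)).
    rewrite /d2 mulnDl leq_add2r mulnAC leq_mul2r leq_mul2l leq_exp2l ?(q_gt1 hp e0) //.
    by rewrite il !orbT.
  apply: polySzM; [|exact: polySz_map|exact/polySz_map/hc3].
  by apply: leq_trans cc3 _; apply: (leq_trans _ (leq_addl _ _)); rewrite leq_pmulr.
pose W := (\max_(ij : 'I_ncomp.+1 * J) size (w ij.1 ij.2)).+1.
have wW i j : (size (w i j) <= W)%N by apply: leqW; apply: (leq_bigmax (i, j)).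
(* Entries of size at most [W] spoil the surplus of one unknown polynomial; degrees below
   [D = 2 l W] leave [(l + 1) D] unknowns against [l (D + W)] equations. *)
pose D := (2 * ncomp * W)%N.
have [||a [aSz [[i0 h0] na] hs]] := @ho_siegel _ _ _ _ _ _ hO ('I_ncomp.+1 * 'I_D)%type (J * 'I_(D + W))%type
  (fun (t : J * 'I_(D + W)) (u : 'I_ncomp.+1 * 'I_D) => ('X^(u.2) * w u.1 t.1)`_(t.2))
  ((2 * ncomp + 3) * (c + d2)) d2.
- move=> t u; rewrite coefXnM; case: ifP => _; [exact: Sz0|exact: wSz].
- rewrite !card_prod !card_ord; apply: (@siegel_count2 ncomp D W) => //; first exact: ncomp_gt0.
  exact: (ho_c hO).
have cc : (c <= (2 * ncomp + 3) * (c + d2))%N by nia.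
pose A i : {poly C} := \poly_(k < D) if insub k is Some k' then a (i, k') else 0.
have AE i : A i = \sum_(k < D) a (i, k) *: 'X^k.
  by rewrite /A poly_def; apply: eq_bigr => k _; rewrite valK.
exists A; split.
- move=> i k; rewrite coef_poly; case: ifP => kd; last exact: Sz0.
  by case: insubP => [k' _ _|_]; [apply: aSz|apply: Sz0].
- exists i0; apply/eqP => /(congr1 (fun P : {poly C} => P`_h0)).
  by rewrite coef_poly ltn_ord valK coef0 => /eqP; rewrite (negPf na).
have Aw j : \sum_i A i * w i j = 0.
  apply/polyP => h; rewrite coef0.
  have [hD|hD] := ltnP h (D + W); last first.
    apply: nth_default; apply: leq_trans hD.
    apply: (leq_trans (size_sum _ _ _)); apply/bigmax_leqP => i _.
    apply: leq_trans (size_polyMleq _ _) _; apply: (leq_trans (leq_pred _)).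
    by apply: leq_add; [apply: size_poly|apply: wW].
  rewrite -[RHS](hs (j, Ordinal hD)) coef_sum.
  transitivity (\sum_i \sum_(k < D) ('X^k * w i j)`_h * a (i, k)); last first.
    by rewrite pair_bigA /=; apply: eq_bigr => -[].
  apply: eq_bigr => i _; rewrite AE mulr_suml coef_sum; apply: eq_bigr => k _.
  by rewrite -scalerAl coefZ mulrC.
under eq_bigr => i _ do rewrite wE mulr_sumr.
rewrite exchange_big big1 // => j _.
under eq_bigr => i _ do rewrite mulrA -rmorphM.
by rewrite -mulr_suml -rmorph_sum Aw rmorph0 mul0r.
Qed.

End Aux.

(** The upper bound for the coefficients of [G] and the lower bound for the lowest one are both
    [Q]-th powers. The constant [c5] does not depend on [s], so [s] can be taken large enough for
    the bases to contradict each other. *)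
Lemma weak_abp_contra : False.
Proof.
have [c3 [cc3 hc3]] := Sz_Phi_iter_coef ncomp.
pose c5 := ((2 * ncomp + 3) * (c + (aux_height * q ^ ncomp + c3)))%N.
have k1 := ho_kappa hO; have k0 : 0 < kappa by apply: lt_le_trans k1.
pose C1 := abs theta * kappa ^+ aux_height * B.
have C10 : 0 < C1 by rewrite !mulr_gt0 ?exprn_gt0 // ?(lt_le_trans _ B1) // (lt_trans _ theta1).
have kc : 1 <= kappa ^+ (2 * c5) by rewrite exprn_ege1.
have C20 : 0 < C1 * kappa ^+ (2 * c5) by rewrite mulr_gt0 // exprn_gt0.
have r1 : 0 <= rho^-1 < 1 by rewrite invr_ge0 ltW //= invf_lt1.
have C2i : 0 < (C1 * kappa ^+ (2 * c5))^-1 by rewrite invr_gt0.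
have [s0 hs] := expr_small r1 C2i.
set s := s0.+1; have {hs} hs : rho^-1 ^+ s < (C1 * kappa ^+ (2 * c5))^-1.
  by apply: hs; apply: leqnSn.
have sgt0 : (0 < s)%N by [].
have {hs} lt1 : C1 / rho ^+ s * kappa ^+ (2 * c5) < 1.
  rewrite -exprVn mulrAC; move: hs; rewrite -[_^-1 in ltRHS]mul1r ltr_pdivlMr //.
  by rewrite mulrC.
have Cs0 : 0 <= C1 / rho ^+ s by rewrite divr_ge0 ?exprn_ge0 ?ltW.
have lt2 : C1 / rho ^+ s < 1 by apply: le_lt_trans lt1; rewrite ler_peMr.
have [y [ySz ny ysize yz]] := aux_function sgt0.
have small := aux_small sgt0 ySz ysize yz.
have [A [ASz nA rA]] := diff_relation sgt0 ySz cc3 hc3.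
have := aux_neq0 s ny; set G := \sum_j _ in small rA *.
set Q := (q ^ _)%N in ySz ASz small.
have Q0 : (0 < Q)%N by apply: qX_gt0 hp e0 _.
move=> /ser_ord[k [Gk lowG]].
have [h [[i hi] lowA]] := lowest_coef nA.
have x1 : abs (coefs G k) <= 1.
  by apply: le_trans (small k) _; rewrite exprn_ile1 // ltW.
(* The coefficient of degree [h + k] in the twisted equation: every [phi^i G] starts in degree [k],
   and no [A i] starts before [h]. *)
have hsum : \sum_i (A i)`_h * fr i (coefs G k) = 0.
  have := congr1 (fun f => coefs f (h + k)%N) rA; rewrite coefs0 coefs_sum => E.
  rewrite -[RHS]E.
  apply: eq_bigr => i' _; rewrite (@coefs_ltM _ _ _ h k) //.
    by move=> k' /lowA; apply.
  by move=> k' /lowG /= ->; rewrite rmorph0.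
have := small_root_bound (fun i => ASz i h) (ex_intro _ i hi) Gk x1 hsum.
rewrite leNgt => /negP; apply.
apply: (@le_lt_trans _ _ ((C1 / rho ^+ s * kappa ^+ (2 * c5)) ^+ Q)); last first.
  by rewrite exprn_ilt1 -?lt0n // mulr_ge0 // exprn_ge0 // ltW.
rewrite exprMn; apply: ler_pM; rewrite ?abs_ge0 ?exprn_ge0 ?(ltW k0) //.
rewrite -exprM ler_weXn2l // /c5.
have ar (X a c' Q' : nat) : (0 < Q')%N -> (2 * (X * (c' + a * Q')) <= 2 * (X * (c' + a)) * Q')%N.
  by move=> Q'0; rewrite -!mulnA !leq_mul2l /= mulnDl leq_add2r leq_pmulr ?orbT.
exact: ar.
Qed.

End Relation.

Lemma weak_abp : (exists j, lam j != 0) -> \sum_j lam j * vl j != 0.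
Proof. by move=> [j0 l0]; apply/eqP => rel; apply: (weak_abp_contra l0 rel). Qed.

End ABP.

(** * Twisted equations over polynomials *)

Lemma lowest_terms (F : fieldType) (N R : {poly F}) : R != 0 ->
  exists d N1 R1 : {poly F}, [/\ d != 0, N = d * N1, R = d * R1, coprimep N1 R1 & R1 \is monic].
Proof.
move=> R0; set g := gcdp N R.
have g0 : g != 0 by rewrite gcdp_eq0 (negPf R0) andbF.
have NE : N = N %/ g * g by rewrite divpK // dvdp_gcdl.
have RE : R = R %/ g * g by rewrite divpK // dvdp_gcdr.
have R10 : R %/ g != 0 by apply: contraNneq R0; rewrite {2}RE => ->; rewrite mul0r.
set l := lead_coef (R %/ g).
have l0 : l != 0 by rewrite lead_coef_eq0.
exists (l *: g), (l^-1 *: (N %/ g)), (l^-1 *: (R %/ g)); split.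
- by rewrite scaler_eq0 negb_or l0.
- by rewrite -scalerAr -scalerAl scalerA mulVf // scale1r mulrC.
- by rewrite -scalerAr -scalerAl scalerA mulVf // scale1r mulrC.
- rewrite coprimepZl ?invr_eq0 // coprimepZr ?invr_eq0 //.
  by apply: coprimep_div_gcd; rewrite R0 orbT.
by rewrite monicE lead_coefZ mulVf.
Qed.

Section PolyTwist.
Variables (C : closedFieldType) (p e : nat).
Local Notation q := (p ^ e)%N.
Hypothesis hp : p \in [pchar C].
Hypothesis e0 : (0 < e)%N.
Local Notation phi := (map_poly (frob e hp 1)).

Lemma polyFqE (P : {poly C}) : polyFq q P <-> phi P = P.
Proof.
split=> [h|h j]; first by apply/polyP => j; rewrite coef_map /= frob1 h.
by rewrite /inFq -(frob1 e hp) -{2}h coef_map.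
Qed.

Lemma monic_twist_dvd (R : {poly C}) : R \is monic -> phi R %| R -> phi R = R.
Proof.
move=> mR dv; apply/eqP; rewrite -eqp_monic ?map_monic //.
by rewrite -dvdp_size_eqp // size_map_poly.
Qed.

(** A fraction fixed by the twist lies in [F_q(t)]: in lowest terms with monic denominator,
    numerator and denominator are fixed separately. *)
Lemma twist_ratio (A B : {poly C}) : B != 0 -> phi A * B = phi B * A ->
  exists a b : {poly C}, [/\ polyFq q a, polyFq q b, b != 0 & A * b = B * a].
Proof.
move=> B0 E; have [d [A1 [B1 [d0 AE BE cop mB]]]] := lowest_terms A B0.
have pd0 : phi d != 0 by rewrite map_poly_eq0.
have E1 : phi A1 * B1 = phi B1 * A1.
  apply: (mulfI (mulf_neq0 d0 pd0)); move: E; rewrite AE BE !rmorphM /= => E.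
  rewrite [LHS](_ : _ = phi d * phi A1 * (d * B1)); last by ring.
  by rewrite E; ring.
have B1E : phi B1 = B1.
  apply: monic_twist_dvd => //.
  have : phi B1 %| phi A1 * B1 by rewrite E1 dvdp_mulr.
  by rewrite Gauss_dvdpr // coprimep_map coprimep_sym.
exists A1, B1; split.
- by apply/polyFqE; move: E1; rewrite B1E mulrC => /(mulfI (monic_neq0 mB)).
- exact/polyFqE.
- exact: monic_neq0.
by rewrite AE BE; ring.
Qed.

(** For [Y = N / R] the hypothesis reads [phi Y = T (Y - v)]. Hence the twist of the reduced
    denominator divides that denominator; both being monic of equal degree, the denominator lies in
    [F_q[t]], and it may multiply the equation. *)
Lemma twist_denominator (N R T v : {poly C}) : R != 0 ->
  T * N * phi R = R * phi N + R * phi R * T * v ->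
  exists N1 R1 : {poly C}, [/\ polyFq q R1, R1 != 0 & phi N1 = T * (N1 - R1 * v)].
Proof.
move=> R0 E; have [d [N1 [R1 [d0 NE RE cop mR]]]] := lowest_terms N R0.
have pd0 : phi d != 0 by rewrite map_poly_eq0.
have E1 : T * N1 * phi R1 = R1 * phi N1 + R1 * phi R1 * T * v.
  apply: (mulfI (mulf_neq0 d0 pd0)); move: E; rewrite NE RE !rmorphM /= => E.
  rewrite [LHS](_ : _ = T * (d * N1) * (phi d * phi R1)); last by ring.
  by rewrite E; ring.
have R1E : phi R1 = R1.
  apply: monic_twist_dvd => //.
  have : phi R1 %| R1 * phi N1.
    have -> : R1 * phi N1 = T * N1 * phi R1 - R1 * phi R1 * T * v by rewrite E1; ring.
    have -> : T * N1 * phi R1 - R1 * phi R1 * T * v = phi R1 * (T * N1 - R1 * T * v) by ring.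
    exact: dvdp_mulr.
  by rewrite Gauss_dvdpl // coprimep_map coprimep_sym.
exists N1, R1; split; [exact/polyFqE|exact: monic_neq0|].
apply: (mulfI (monic_neq0 mR)); rewrite R1E in E1.
have -> : R1 * phi N1 = T * N1 * R1 - R1 * R1 * T * v by rewrite E1; ring.
by ring.
Qed.

(** * Extraction of [p]-th roots from polynomial equations *)

Section Root.
Variable rp : C -> C.
Hypothesis rpK : forall x, (rp x) ^+ p = x.

Let p_gt0 : (0 < p)%N. Proof. exact/prime_gt0/(pcharf_prime hp). Qed.

Lemma pow_p_inj : injective (fun x : C => x ^+ p).
Proof.
(* With first argument [1] in place of [e], [frob] is the [p]-th power map, so its injectivity is
   already known. *)
have E x : x ^+ p = frob 1 hp 1 x by rewrite frob1 expn1.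
by move=> x y; rewrite /= !E => /frob_inj.
Qed.

Lemma rp0 : rp 0 = 0.
Proof. by apply: pow_p_inj; rewrite rpK expr0n -(prednK p_gt0). Qed.

Lemma rpD x y : rp (x + y) = rp x + rp y.
Proof.
apply: pow_p_inj; rewrite rpK /=.
have E z : z ^+ p = frob 1 hp 1 z by rewrite frob1 expn1.
by rewrite E rmorphD /= -!E !rpK.
Qed.

Lemma rpM x y : rp (x ^+ p * y) = x * rp y.
Proof. by apply: pow_p_inj; rewrite rpK /= exprMn rpK. Qed.

Lemma rp_frob x : rp (frob e hp 1 x) = frob e hp 1 (rp x).
Proof. by apply: pow_p_inj; rewrite rpK /= -rmorphXn rpK. Qed.

(** The Cartier-type sections: [P] is the sum over [s < p] of [t^s (psec s P)^p]. *)
Definition psec (s : nat) (P : {poly C}) : {poly C} :=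
  \poly_(i < size P) rp P`_(s + i * p).

Lemma coef_psec s P i : (psec s P)`_i = rp P`_(s + i * p).
Proof.
rewrite coef_poly; case: ltnP => // iP; rewrite nth_default ?rp0 //.
by apply: leq_trans iP _; apply: leq_trans (leq_addl _ _); rewrite leq_pmulr.
Qed.

Lemma psecD s P Q : psec s (P + Q) = psec s P + psec s Q.
Proof. by apply/polyP => i; rewrite coefD !coef_psec coefD rpD. Qed.

Lemma psec0 s : psec s 0 = 0.
Proof. by apply/polyP => i; rewrite coef_psec !coef0 rp0. Qed.

Lemma psecN s P : psec s (- P) = - psec s P.
Proof. by apply/eqP; rewrite -subr_eq0 opprK -psecD addNr psec0. Qed.

Lemma psec_sum s (I : Type) (r : seq I) (Q : pred I) (F : I -> {poly C}) :
  psec s (\sum_(i <- r | Q i) F i) = \sum_(i <- r | Q i) psec s (F i).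
Proof.
elim: r => [|i r IH]; first by rewrite !big_nil psec0.
by rewrite !big_cons; case: ifP => // _; rewrite psecD IH.
Qed.

Lemma psec_monom s c i P : (s < p)%N ->
  psec s ((c ^+ p *: 'X^(i * p)) * P) = (c *: 'X^i) * psec s P.
Proof.
move=> sp; apply/polyP => j; rewrite -!scalerAl coefZ coef_psec coefZ rpM coefXnM [in RHS]coefXnM.
case: (ltnP j i) => ji.
  by rewrite ifT ?rp0 //; nia.
rewrite ifF; last by apply/negbTE; rewrite -leqNgt; nia.
by rewrite coef_psec; congr (_ * rp _`__); rewrite mulnBl; have := leq_mul2r p i j; rewrite ji orbT; lia.
Qed.

Lemma poly_exp_p (A : {poly C}) : A ^+ p = \sum_(i < size A) A`_i ^+ p *: 'X^(i * p).
Proof.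
have hP : p \in [pchar {poly C}] by rewrite pchar_poly.
rewrite -[in LHS](coefK A) poly_def -(pFrobenius_autE hP) rmorph_sum.
by apply: eq_bigr => i _; rewrite /= pFrobenius_autE exprZn exprM.
Qed.

Lemma psecM s A P : (s < p)%N -> psec s (A ^+ p * P) = A * psec s P.
Proof.
move=> sp; rewrite poly_exp_p mulr_suml psec_sum.
under eq_bigr => i _ do rewrite psec_monom //.
by rewrite -mulr_suml -poly_def coefK.
Qed.

Lemma psec_twist s P : psec s (phi P) = phi (psec s P).
Proof. by apply/polyP => i; rewrite coef_psec !coef_map /= coef_psec rp_frob. Qed.

Lemma psec_Fq s P : polyFq q P -> polyFq q (psec s P).
Proof. by move=> /polyFqE h; apply/polyFqE; rewrite -psec_twist h. Qed.

Lemma psec_neq0 P : P != 0 -> exists2 s, (s < p)%N & psec s P != 0.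
Proof.
move=> P0; set k := (size P).-1.
exists (k %% p)%N; first by rewrite ltn_mod.
apply/eqP => /(congr1 (fun Q : {poly C} => Q`_(k %/ p))) /eqP.
rewrite coef_psec coef0 addnC -divn_eq -/(lead_coef P).
have -> : (rp (lead_coef P) == 0) = (lead_coef P == 0).
  apply/eqP/eqP => [h|->]; last exact: rp0.
  by rewrite -[lead_coef P]rpK h expr0n -(prednK p_gt0).
by rewrite lead_coef_eq0 (negPf P0).
Qed.

End Root.
End PolyTwist.

(** * Multi-index binomials *)

Section Multibinomial.
Variable n : nat.
Implicit Types e f g : 'X_{1..n}.

Definition mbin e g : nat := (\prod_k 'C(e k, g k))%N.

Lemma leq_mdeg e k : (e k <= mdeg e)%N.
Proof. by rewrite mdegE (bigD1 k) //= leq_addr. Qed.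

Lemma mdeg_le e f : (e <= f)%MM -> (mdeg e <= mdeg f)%N.
Proof. by move=> /mnm_lepP h; rewrite !mdegE; apply: leq_sum. Qed.

Lemma mbin_eq0 e g : ~~ (g <= e)%MM -> mbin e g = 0%N.
Proof.
move=> /mnm_lepP /existsNP[k /negP]; rewrite -ltnNge => h.
by rewrite /mbin (bigD1 k) //= bin_small.
Qed.

Lemma mbin_nn e : mbin e e = 1%N.
Proof. by rewrite /mbin big1 // => k _; rewrite binn. Qed.

(** For [z <= x] both sides are the multinomial coefficient [(x + y)! / (y! z! (x - z)!)]. In
    several variables this is the commutation of Hasse derivatives with translations. *)
Lemma bin_shift x y z : ('C(x + y, y) * 'C(x, z) = 'C(z + y, y) * 'C(x + y, z + y))%N.
Proof.
have [zx|xz] := leqP z x; last first.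
  by rewrite (bin_small xz) (@bin_small (x + y) (z + y)) ?ltn_add2r // !muln0.
have h1 := bin_fact (leq_addl x y); rewrite addnK in h1.
have h2 := bin_fact zx.
have h3 := bin_fact (leq_addl z y); rewrite addnK in h3.
have h4 : ('C(x + y, z + y) * ((z + y)`! * (x - z)`!) = (x + y)`!)%N.
  by rewrite -(bin_fact (_ : z + y <= x + y)%N) ?leq_add2r // subnDr.
have p0 : (0 < y`! * z`! * (x - z)`!)%N by rewrite !muln_gt0 !fact_gt0.
apply/eqP; rewrite -(eqn_pmul2r p0); apply/eqP.
have -> : ('C(x + y, y) * 'C(x, z) * (y`! * z`! * (x - z)`!) =
  'C(x + y, y) * (y`! * ('C(x, z) * (z`! * (x - z)`!))))%N by ring.
have -> : ('C(z + y, y) * 'C(x + y, z + y) * (y`! * z`! * (x - z)`!) =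
  'C(x + y, z + y) * ('C(z + y, y) * (y`! * z`!) * (x - z)`!))%N by ring.
by rewrite h2 h1 h3 h4.
Qed.

Lemma mbin_shift e f g :
  (mbin (e + f) f * mbin e g = mbin (g + f) f * mbin (e + f) (g + f))%N.
Proof.
rewrite /mbin -!big_split; apply: eq_bigr => k _; rewrite !mnmDE; exact: bin_shift.
Qed.

Section Ring.
Variable A : comNzRingType.

Lemma prod_sum_mnm b (G : 'I_n -> nat -> A) e : (mdeg e < b)%N ->
  (forall k j, (e k < j)%N -> G k j = 0) ->
  \prod_k \sum_(j < b) G k j = \sum_(g : 'X_{1..n < b}) \prod_k G k (g k).
Proof.
case: b => // b eb hG; rewrite bigA_distr_bigA /=.
have h0 : (mdeg (0%MM : 'X_{1..n}) < b.+1)%N by rewrite mdeg0.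
(* The default value [0] is taken only in degree at least [b.+1], where the terms vanish or are
   excluded by the reindexing condition. *)
pose bm (m : 'X_{1..n}) : 'X_{1..n < b.+1} := insubd (BMultinom h0) m.
have bmE m : (mdeg m < b.+1)%N -> bm m = m :> 'X_{1..n} by move=> h; rewrite /bm insubdK.
rewrite [RHS](bigID (fun g : 'X_{1..n < b.+1} => (g <= e)%MM)) /= [X in _ + X]big1 ?addr0; last first.
  move=> g /mnm_lepP /existsNP[k /negP]; rewrite -ltnNge => h.
  by rewrite (bigD1 k) //= hG // mul0r.
pose mm (h : {ffun 'I_n -> 'I_b.+1}) : 'X_{1..n} := [multinom (h k : nat) | k < n].
rewrite (reindex_onto (fun h : {ffun 'I_n -> 'I_b.+1} => bm (mm h))
  (fun g : 'X_{1..n < b.+1} => [ffun k => inord (g k)])) /=; last first.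
  move=> g ge; apply: val_inj => /=.
  have mg : mm [ffun k => inord (g k)] = g.
    apply/mnmP => k; rewrite mnmE ffunE inordK // ltnS; apply: leq_trans (leq_mdeg g k) _.
    by rewrite -ltnS; apply: leq_ltn_trans (mdeg_le ge) eb.
  by rewrite bmE mg //; apply: bmdeg.
rewrite [RHS]big_mkcond; apply: eq_bigr => h _.
case: (pselect (mm h <= e)%MM) => [he|/negP he].
  have hb : bm (mm h) = mm h :> 'X_{1..n} by rewrite bmE // (leq_ltn_trans (mdeg_le he) eb).
  rewrite hb he /= ifT; first by apply: eq_bigr => k _; rewrite mnmE.
  by apply/eqP/ffunP => k; rewrite ffunE mnmE inord_val.
have -> : \prod_k G k (h k) = 0.
  move/mnm_lepP/existsNP: he => [k /negP]; rewrite -ltnNge mnmE => hk.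
  by rewrite (bigD1 k) //= hG // mul0r.
case: ifP => // /andP[+ /eqP hh].
suff -> : bm (mm h) = mm h :> 'X_{1..n} by rewrite (negPf he).
by apply/mnmP => k; rewrite mnmE -{2}hh ffunE inordK // ltnS (leq_trans (leq_mdeg _ k)) // -ltnS; apply: bmdeg.
Qed.

Definition mpow (x : 'I_n -> A) e : A := \prod_k x k ^+ e k.
(** Truncated subtraction is harmless: this power occurs next to [mbin e g], which vanishes unless
    [g <= e]. *)
Definition mpowB (x : 'I_n -> A) e g : A := \prod_k x k ^+ (e k - g k).

Lemma mpow_add x v e b : (mdeg e < b)%N ->
  mpow (fun k => x k + v k) e =
  \sum_(g : 'X_{1..n < b}) (mbin e g)%:R * mpowB v e g * mpow x g.
Proof.
move=> eb; pose G k j := ('C(e k, j))%:R * v k ^+ (e k - j) * x k ^+ j.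
transitivity (\prod_k \sum_(j < b) G k j).
  apply: eq_bigr => k _; rewrite addrC exprDn.
  have kb : ((e k).+1 <= b)%N by apply: leq_ltn_trans (leq_mdeg e k) eb.
  rewrite (big_ord_widen b (fun j => v k ^+ (e k - j) * x k ^+ j *+ 'C(e k, j)) kb) big_mkcond /=.
  apply: eq_bigr => j _; rewrite /G; case: ltnP => jk.
    by rewrite -mulrA mulr_natl.
  by rewrite bin_small // !mul0r.
rewrite (prod_sum_mnm eb) => [|k j kj]; last by rewrite /G bin_small // !mul0r.
by apply: eq_bigr => g _; rewrite !big_split /= natr_prod.
Qed.

Lemma mpowB_shift v e f g : mpowB v (e + f) (g + f) = mpowB v e g.
Proof. by apply: eq_bigr => k _; rewrite !mnmDE subnDr. Qed.

Lemma sum_bm_shift b f (F : 'X_{1..n} -> A) :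
  (forall e, (b <= mdeg e)%N -> F e = 0) -> (forall e, ~~ (f <= e)%MM -> F e = 0) ->
  \sum_(e : 'X_{1..n < b}) F e = \sum_(e : 'X_{1..n < b}) F (e + f)%MM.
Proof.
case: b => [|b] hb hf.
  by rewrite !big1 // => -[e he].
have h0 : (mdeg (0%MM : 'X_{1..n}) < b.+1)%N by rewrite mdeg0.
pose bm (m : 'X_{1..n}) : 'X_{1..n < b.+1} := insubd (BMultinom h0) m.
have bmE m : (mdeg m < b.+1)%N -> bm m = m :> 'X_{1..n} by move=> h; rewrite /bm insubdK.
rewrite [LHS](bigID (fun e : 'X_{1..n < b.+1} => (f <= e)%MM)) /= [X in _ + X]big1 ?addr0; last by move=> e /hf.
rewrite (reindex_onto (fun e : 'X_{1..n < b.+1} => bm (e + f)%MM)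
  (fun e : 'X_{1..n < b.+1} => bm (e - f)%MM)) /=; last first.
  move=> e fe; apply: val_inj => /=.
  have h1 : bm (e - f)%MM = (e - f)%MM :> 'X_{1..n}.
    by rewrite bmE // (leq_ltn_trans (mdegB _ _)) //; apply: bmdeg.
  by rewrite bmE h1 submK //; apply: bmdeg.
rewrite big_mkcond; apply: eq_bigr => e _.
have [ef|ef] := ltnP (mdeg (e + f)) b.+1; last first.
  rewrite [F (e + f)%MM]hb //; case: ifP => // /andP[h1 /eqP h2]; rewrite hb //.
  have : mdeg e = mdeg (bm (e + f) - f)%MM.
    by rewrite -[in LHS]h2 bmE // (leq_ltn_trans (mdegB _ _)) //; apply: bmdeg.
  have := congr1 (@mdeg n) (submK h1); rewrite mdegD => h3 h4.
  by rewrite -h3 -h4 -mdegD.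
rewrite !bmE // ifT // lem_addl /=; apply/eqP/val_inj => /=.
by rewrite addmK bmE //; apply: bmdeg.
Qed.

Lemma sum_bm_single b e0 (F : 'X_{1..n} -> A) : (forall e, (b <= mdeg e)%N -> F e = 0) ->
  \sum_(e : 'X_{1..n < b}) (if (e : 'X_{1..n}) == e0 then F e else 0) = F e0.
Proof.
move=> hb; have [eb|eb] := ltnP (mdeg e0) b; last first.
  by rewrite hb // big1 // => e _; case: eqP => // ->; rewrite hb.
rewrite -big_mkcond (big_pred1 (BMultinom eb)) //=.
Qed.

End Ring.
End Multibinomial.

(** * Algebraic independence of the functions *)

(** Compare the coefficients of [X^(p^a)] in [(1 + X)^(p^a m) = (1 + X^(p^a))^m]: the binomial
    coefficient equals [m] in [C]. *)
Lemma bin_pfactor_neq0 (C : fieldType) (p a m : nat) : p \in [pchar C] -> ~~ (p %| m)%N ->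
  ('C(p ^ a * m, p ^ a))%:R != 0 :> C.
Proof.
move=> hp pm.
have hP : p \in [pchar {poly C}] by rewrite pchar_poly.
have pp := pcharf_prime hp.
have h : [pchar {poly C}].-nat (p ^ a)%N by rewrite pnatX (pnatE _ pp) hP.
have E1 : ((1 + 'X : {poly C}) ^+ (p ^ a * m))`_(p ^ a) = ('C(p ^ a * m, p ^ a))%:R.
  rewrite exprDn coef_sum.
  have [m0|m0] := posnP m; first by rewrite m0 dvdn0 in pm.
  have lt : (p ^ a < (p ^ a * m).+1)%N by rewrite ltnS leq_pmulr.
  rewrite (bigD1 (Ordinal lt)) //= expr1n mul1r coefMn coefXn eqxx big1 ?addr0 // => i.
  by rewrite -val_eqE /= expr1n mul1r coefMn coefXn eq_sym => /negPf ->; rewrite mul0rn.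
have pa0 : (0 < p ^ a)%N by rewrite expn_gt0 prime_gt0.
have E2 : ((1 + 'X : {poly C}) ^+ (p ^ a * m))`_(p ^ a) = m%:R.
  rewrite exprM exprDn_pchar // expr1n exprDn coef_sum.
  have [m0|m0] := posnP m; first by rewrite m0 dvdn0 in pm.
  have lt : (1 < m.+1)%N by [].
  rewrite (bigD1 (Ordinal lt)) //= expr1n mul1r expr1 bin1 coefMn coefXn eqxx.
  rewrite big1 ?addr0 // => i; rewrite -val_eqE /= expr1n mul1r coefMn -exprM coefXn => i1.
  by rewrite -[X in X == _]muln1 eqn_mul2l eqn0Ngt pa0 eq_sym (negPf i1) mul0rn.
by rewrite -E1 E2 -(dvdn_pcharf hp).
Qed.

(** If [x] is not a power of [p], its [p]-part is a forbidden proper index with nonzero binomial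
    coefficient. *)
Lemma primitive_exponent (C : fieldType) (p x : nat) : p \in [pchar C] -> (0 < x)%N ->
  (forall f, (0 < f < x)%N -> ('C(x, f))%:R = 0 :> C) -> exists a, x = (p ^ a)%N.
Proof.
move=> hp x0 h; have pp := pcharf_prime hp.
have [m pm xE] := pfactor_coprime pp x0.
have pm' : ~~ (p %| m)%N by rewrite -prime_coprime.
exists (logn p x).
have [m1|m1] := eqVneq m 1%N; first by rewrite {1}xE m1 mul1n.
have m0 : (0 < m)%N by case: (m) pm' => //; rewrite dvdn0.
have pa0 : (0 < p ^ logn p x)%N by rewrite expn_gt0 prime_gt0.
have lt : (0 < p ^ logn p x < x)%N.
  by rewrite pa0 /= {2}xE ltn_Pmull //; lia.
have /eqP := h _ lt; rewrite {1}xE mulnC.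
by rewrite (negPf (bin_pfactor_neq0 _ hp pm')).
Qed.

Section SemiInvariant.
Variables (C : closedFieldType) (p e : nat).
Local Notation q := (p ^ e)%N.
Hypothesis hp : p \in [pchar C].
Hypothesis e0 : (0 < e)%N.
Local Notation phi := (map_poly (frob e hp 1)).

Variables (n : nat) (w : 'I_n -> nat) (v : 'I_n -> {poly C}) (T : {poly C}) (z0 : 'I_n).
Hypothesis sizeT : size T = 2%N.
Hypothesis w0 : forall k, (0 < w k)%N.
Hypothesis vz0 : v z0 = 0.
(** The period variable [z0] is left out, because its weight [1] may agree with some [n_i] up to a
    power of [p]. *)
Hypothesis Hw : forall k l a b, k != z0 -> l != z0 ->
  (w k * p ^ a = w l * p ^ b)%N -> w k = w l.
(** The point where linear independence of the values enters; keeping it as a hypothesis makes the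
    study of semi-invariants purely algebraic. *)
Hypothesis Hfin : forall k0 (c : 'I_n -> {poly C}) Q, k0 != z0 -> (forall k, polyFq q (c k)) ->
  phi Q = T ^+ w k0 * (Q - \sum_(k | (k != z0) && (w k == w k0)) c k * v k) -> c k0 = 0.

Implicit Types (P : 'X_{1..n} -> {poly C}) (g f : 'X_{1..n}).

Definition wdot (m : 'X_{1..n}) : nat := (\sum_k w k * m k)%N.

Lemma wdotD m1 m2 : wdot (m1 + m2)%MM = (wdot m1 + wdot m2)%N.
Proof.
by rewrite /wdot -big_split; apply: eq_bigr => k _; rewrite mnmDE mulnDr.
Qed.

(* The coefficient of [x^g] in the image of [sum_m P m x^m] under the twist
   [x_k -> T^(w k) (x_k + v_k)]. *)
Definition twist_coef (b : nat) P g : {poly C} :=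
  \sum_(m : 'X_{1..n < b}) phi (P m) * ((mbin m g)%:R * mpowB v m g * T ^+ wdot m).

(** An eigenvector of the twist with eigenvalue [be / al] in [C(t)], cleared of denominators. *)
Definition semi_inv (b : nat) (al be : {poly C}) P : Prop :=
  [/\ al != 0, be != 0 & forall g, al * twist_coef b P g = be * P g].

Definition fsupp (b : nat) P := forall m, (b <= mdeg m)%N -> P m = 0.

Let T0 : T != 0. Proof. by rewrite -size_poly_eq0 sizeT. Qed.

Lemma twist_coef_shift b P f g : fsupp b P ->
  T ^+ wdot f * twist_coef b (fun m => (mbin (m + f)%MM f)%:R * P (m + f)%MM) g =
  (mbin (g + f)%MM f)%:R * twist_coef b P (g + f)%MM.
Proof.
move=> hP; rewrite /twist_coef (sum_bm_shift (f := f)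
    (F := fun m => phi (P m) * ((mbin m (g + f)%MM)%:R * mpowB v m (g + f)%MM * T ^+ wdot m))).
- rewrite !mulr_sumr; apply: eq_bigr => m _.
  rewrite mpowB_shift wdotD exprD rmorphM rmorph_nat.
  transitivity ((mbin (m + f)%MM f * mbin m g)%:R * (phi (P (m + f)%MM) * mpowB v m g * T ^+ wdot m * T ^+ wdot f)).
    by rewrite natrM; ring.
  by rewrite mbin_shift natrM; ring.
- by move=> m hm; rewrite hP // rmorph0 mul0r.
move=> m hm; rewrite mbin_eq0 ?mul0r ?mulr0 //.
by apply: contra hm; apply: lepm_trans; apply: lem_addl.
Qed.

(** The new family is the Hasse derivative of order [f]. It commutes with the translation by [v],
    and the scaling by powers of [T] contributes the factor [T ^+ wdot f]. *)
Lemma semi_inv_shift b al be P f : fsupp b P -> semi_inv b al be P ->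
  semi_inv b (al * T ^+ wdot f) be (fun m => (mbin (m + f)%MM f)%:R * P (m + f)%MM).
Proof.
move=> hP [al0 be0 h]; split=> // [|g]; first by rewrite mulf_neq0 ?expf_neq0.
by rewrite -mulrA twist_coef_shift // mulrCA h mulrCA.
Qed.

Lemma natr_poly_eq0 k : ((k%:R : {poly C}) == 0) = (k%:R == 0 :> C).
Proof. by rewrite -polyC_natr polyC_eq0. Qed.

(** Induction on [a]: a section [psec s] pulls [p]-th powers out of the powers of [T] and of the
    [v k], and keeps the coefficients in [F_q[t]]. The residue [s] is chosen so that [c k0]
    survives; for [a = 0] the claim is [Hfin]. *)
Lemma descent_contra k0 a : k0 != z0 -> forall (c : 'I_n -> {poly C}) Q,
  (forall k, polyFq q (c k)) ->
  phi Q = T ^+ (w k0 * p ^ a) *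
    (Q - \sum_(k | (k != z0) && (w k == w k0)) c k * v k ^+ (p ^ a)) -> c k0 = 0.
Proof.
move=> hk0; have [rp rpK] : exists rp : C -> C, forall x, rp x ^+ p = x.
  have [rp h] := choice (frob_surj hp (ltn0Sn 0) 1).
  by exists rp => x; have := h x; rewrite frob1 expn1.
elim: a => [|a IH] c Q hc E.
  by apply: (Hfin hk0 hc (Q := Q)); rewrite E expn0 muln1.
apply/eqP/negPn/negP => ck0.
have [s sp /eqP] := psec_neq0 hp rpK ck0; apply.
apply: (IH (fun k => psec p rp s (c k)) (psec p rp s Q)).
  by move=> k; apply: (psec_Fq hp rpK).
have := congr1 (psec p rp s) E; rewrite (psec_twist e hp rpK) => ->.
rewrite expnSr mulnA exprM (psecM hp e0 rpK) // (psecD hp rpK) (psecN hp rpK) (psec_sum hp rpK).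
congr (_ * (_ - _)); apply: eq_bigr => k _.
by rewrite exprM mulrC (psecM hp e0 rpK) // mulrC.
Qed.

Definition zpow m : 'X_{1..n} := (U_(z0) *+ m)%MM.
Definition zyp m k x : 'X_{1..n} := (zpow m + U_(k) *+ x)%MM.

Lemma zpowE m k : zpow m k = if k == z0 then m else 0%N.
Proof. by rewrite /zpow mulmnE mnm1E eq_sym; case: eqP; rewrite ?mul1n ?mul0n. Qed.

Lemma zypE m k x l : k != z0 ->
  zyp m k x l = if l == z0 then m else if l == k then x else 0%N.
Proof.
move=> kz; rewrite /zyp mnmDE zpowE mulmnE mnm1E [k == l]eq_sym.
by case: (eqVneq l z0) => [->|_]; [rewrite eq_sym (negPf kz) addn0|case: eqP; rewrite ?mul1n ?mul0n].
Qed.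

Lemma wdot_zpow m : wdot (zpow m) = (w z0 * m)%N.
Proof.
rewrite /wdot (bigD1 z0) //= zpowE eqxx big1 ?addn0 // => k /negPf kz.
by rewrite zpowE kz muln0.
Qed.

Lemma wdot_zyp m k x : k != z0 -> wdot (zyp m k x) = (w z0 * m + w k * x)%N.
Proof.
move=> kz; rewrite /zyp wdotD wdot_zpow; congr addn.
rewrite /wdot (bigD1 k) //= mulmnE mnm1E eqxx mul1n big1 ?addn0 // => l /negPf lk.
by rewrite mulmnE mnm1E eq_sym lk mul0n muln0.
Qed.

Lemma mbin_zpow (m : 'X_{1..n}) : mbin m (zpow (m z0)) = 1%N.
Proof.
rewrite /mbin big1 // => k _; rewrite zpowE; case: eqP => [->|_]; last exact: bin0.
exact: binn.
Qed.

Lemma mpowB_z0 (m g : 'X_{1..n}) : (g z0 < m z0)%N -> mpowB v m g = 0.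
Proof.
move=> h; rewrite /mpowB (bigD1 z0) //= vz0 expr0n subn_eq0 leqNgt h /=.
by rewrite mul0r.
Qed.

(** As [v z0 = 0], the twist scales the period variable without translating it, so exponents of [z0]
    never mix. *)
Lemma coef_z0 (m g : 'X_{1..n}) : (mbin m g)%:R * mpowB v m g != 0 -> m z0 = g z0 /\ (g <= m)%MM.
Proof.
have [gm|gm] := boolP (g <= m)%MM; last by rewrite mbin_eq0 // mul0r eqxx.
move=> h; split=> //; have := mnm_lepP gm z0; rewrite leq_eqVlt => /orP[/eqP //|lt].
by move: h; rewrite mpowB_z0 // mulr0 eqxx.
Qed.

(** * The induction step: semi-invariants whose Hasse derivatives are known *)

Section Step.
Variables (b : nat) (al be : {poly C}) (P : 'X_{1..n} -> {poly C}).
Hypothesis hP : fsupp b P.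
Hypothesis hS : semi_inv b al be P.
(** The inductive input: Hasse derivatives of positive order involve the period variable alone. *)
Hypothesis hshift : forall f, f != 0%MM -> forall g k, k != z0 -> g k != 0%N ->
  (mbin (g + f)%MM f)%:R * P (g + f)%MM = 0.

(** By [hshift] the binomials [mbin m f] vanish in [C] for nonzero [f <= m] falling short of [m] at
    a variable other than [z0]. Taking [f] as the full power of [x_k], with binomial [1], excludes a
    third variable; proper powers of [x_k] force [m k] to be a power of [p]. *)
Lemma supp_shape (m : 'X_{1..n}) k : P m != 0 -> k != z0 -> m k != 0%N ->
  exists a, m = zyp (m z0) k (p ^ a).
Proof.
move=> Pm kz mk.
have single f l : f != 0%MM -> (f <= m)%MM -> l != z0 -> (f l < m l)%N -> (mbin m f)%:R = 0 :> C.
  move=> f0 fm lz fl; have := hshift f0 (g := (m - f)%MM) lz.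
  rewrite submK // mnmBE -lt0n subn_gt0 => /(_ fl) /eqP.
  by rewrite mulf_eq0 (negPf Pm) orbF natr_poly_eq0 => /eqP.
pose f x : 'X_{1..n} := (U_(k) *+ x)%MM.
have fE x l : f x l = if l == k then x else 0%N.
  by rewrite /f mulmnE mnm1E eq_sym; case: eqP; rewrite ?mul1n ?mul0n.
have f0 x : (0 < x)%N -> f x != 0%MM.
  move=> x0; apply/eqP => /mnmP /(_ k); rewrite fE eqxx mnm0E => h; by rewrite h in x0.
have fm x : (x <= m k)%N -> (f x <= m)%MM.
  by move=> xm; apply/mnm_lepP => l; rewrite fE; case: eqP => [->|].
have mb x : mbin m (f x) = 'C(m k, x).
  rewrite /mbin (bigD1 k) //= fE eqxx big1 ?muln1 // => l /negPf lk.
  by rewrite fE lk bin0.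
have oth l : l != z0 -> l != k -> m l = 0%N.
  move=> lz lk; apply/eqP/negPn/negP => ml.
  have := single (f (m k)) l (f0 _ _) (fm _ (leqnn _)) lz; rewrite lt0n mk fE (negPf lk) lt0n => /(_ isT ml).
  by rewrite mb binn => /eqP; rewrite oner_eq0.
have [a ma] : exists a, m k = (p ^ a)%N.
  apply: (primitive_exponent hp); first by rewrite lt0n.
  move=> x /andP[x0 xm]; rewrite -mb; apply: (single _ k) => //; first exact: f0.
    by apply: fm; apply: ltnW.
  by rewrite fE eqxx.
exists a; apply/mnmP => l; rewrite zypE // -ma.
by case: (eqVneq l z0) => [->|lz] //; case: (eqVneq l k) => [->|lk] //; apply: oth.
Qed.

(** Any other contribution comes from a multiple of this monomial with the same exponent of [z0],
    hence by [supp_shape] from a higher power [x_k^(p^a')]; its binomial coefficient vanishes by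
    [hshift]. *)
Lemma top_eq k m a : k != z0 ->
  al * (phi (P (zyp m k (p ^ a))) * T ^+ wdot (zyp m k (p ^ a))) = be * P (zyp m k (p ^ a)).
Proof.
move=> kz; case: hS => _ _ h; rewrite -h; congr (_ * _); set z := zyp _ _ _.
pose F m' := phi (P m') * ((mbin m' z)%:R * mpowB v m' z * T ^+ wdot m').
have -> : phi (P z) * T ^+ wdot z = F z.
  rewrite /F mbin_nn mul1r (_ : mpowB v z z = 1) ?mul1r //.
  by rewrite /mpowB big1 // => l _; rewrite subnn expr0.
rewrite -(sum_bm_single (b := b) z (F := F)); last first.
  by move=> m' /hP; rewrite /F => ->; rewrite rmorph0 mul0r.
rewrite /twist_coef; apply: eq_bigr => m' _; case: eqP => [->//|mz].
apply/esym/eqP; rewrite mulf_eq0; have [Pm|Pm] := eqVneq (P m') 0.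
  by rewrite Pm rmorph0 eqxx.
apply/orP; right; rewrite mulf_eq0; apply/orP; left; apply/negPn/negP => hc.
have [mz0 zm] := coef_z0 hc.
have pa0 : (0 < p ^ a)%N by rewrite expn_gt0 prime_gt0 // (pcharf_prime hp).
have zk : z k = (p ^ a)%N by rewrite /z zypE // (negPf kz) eqxx.
have mk : (p ^ a <= m' k)%N by rewrite -zk; apply/mnm_lepP.
have mk0 : m' k != 0%N by rewrite -lt0n (leq_trans pa0).
have [a' ma] := supp_shape Pm kz mk0.
have mk' : m' k = (p ^ a')%N by rewrite ma zypE // (negPf kz) eqxx.
have m'z : m' z0 = m by rewrite mz0 /z zypE // eqxx.
have [paa|paa] := eqVneq (p ^ a)%N (p ^ a')%N.
  by case: mz; rewrite ma m'z -paa.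
have lt : (p ^ a < p ^ a')%N by rewrite ltn_neqAle paa -mk'.
have : (mbin m' z)%:R = 0 :> {poly C}.
  have f0 : (U_(k) *+ p ^ a)%MM != 0%MM :> 'X_{1..n}.
    by apply/eqP => /mnmP /(_ k); rewrite mulmnE mnm1E eqxx mul1n mnm0E => h'; rewrite h' in pa0.
  have := hshift f0 (g := (m' - U_(k) *+ p ^ a)%MM) kz.
  have fm : (U_(k) *+ p ^ a <= m')%MM.
    apply/mnm_lepP => l; rewrite mulmnE mnm1E; case: eqP => [<-|_]; rewrite ?mul1n ?mul0n //.
  rewrite submK // mnmBE mulmnE mnm1E eqxx mul1n -lt0n subn_gt0 mk' => /(_ lt) /eqP.
  rewrite mulf_eq0 (negPf Pm) orbF => /eqP <-; congr (_%:R).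
  rewrite /mbin; apply: eq_bigr => l _; rewrite mulmnE mnm1E /z zypE // [k == l]eq_sym.
  case: (eqVneq l z0) => [->|lz].
    by rewrite eq_sym (negPf kz) mul0n bin0 m'z binn.
  by case: eqP; rewrite ?mul1n ?mul0n.
by move=> h'; rewrite h' mul0r eqxx in hc.
Qed.

(** The twist preserves degrees in [t], so comparing sizes in the two instances of [top_eq] equates
    the exponents of [T]; the common part [w z0 * m] cancels. *)
Lemma weights_agree k l m a a' : k != z0 -> l != z0 ->
  P (zyp m k (p ^ a)) != 0 -> P (zyp m l (p ^ a')) != 0 -> w k = w l /\ a = a'.
Proof.
move=> kz lz hk hl; have [al0 be0 _] := hS.
have E1 := top_eq m a kz; have E2 := top_eq m a' lz.
set Pk := P _ in hk E1; set Pl := P _ in hl E2.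
have E : phi Pk * T ^+ wdot (zyp m k (p ^ a)) * Pl = phi Pl * T ^+ wdot (zyp m l (p ^ a')) * Pk.
  apply: (mulfI (mulf_neq0 al0 be0)).
  transitivity (al * (phi Pk * T ^+ wdot (zyp m k (p ^ a))) * (be * Pl)); first by ring.
  by rewrite E1 -E2; ring.
have sT d : size (T ^+ d) = d.+1.
  rewrite -[LHS]prednK ?size_poly_gt0 ?expf_neq0 //.
  by rewrite size_exp sizeT mul1n.
have sz A B d : A != 0 -> B != 0 -> size (phi A * T ^+ d * B) = (size A + d + size B).-1.
  move=> A0 B0; rewrite size_mul ?mulf_neq0 ?expf_neq0 ?map_poly_eq0 //.
  by rewrite size_mul ?expf_neq0 ?map_poly_eq0 // size_map_poly sT addnS.
have := congr1 (fun A : {poly C} => size A) E; rewrite !sz // !wdot_zyp //.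
have sk : (0 < size Pk)%N by rewrite size_poly_gt0.
have sl : (0 < size Pl)%N by rewrite size_poly_gt0.
move=> E'; have Ew : (w k * p ^ a = w l * p ^ a')%N.
  move: E' sk sl; move: (size Pk) (size Pl) (w z0 * m)%N (w k * p ^ a)%N (w l * p ^ a')%N.
  by clear; lia.
have Ewkl := Hw kz lz Ew; split=> //.
move: Ew; rewrite Ewkl => /eqP; rewrite eqn_pmul2l // eqn_exp2l; first by move/eqP.
exact/prime_gt1/(pcharf_prime hp).
Qed.

(** The coefficients of the [z0^m x_k^(p^a)] are proportional over [F_q(t)], and the coefficient of
    [z0^m] then yields an inhomogeneous twisted equation. Once denominators are cleared,
    [descent_contra] applies. *)
Lemma shape_contra (m1 : 'X_{1..n}) k0 : P m1 != 0 -> k0 != z0 -> m1 k0 != 0%N -> False.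
Proof.
move=> Pm1 kz0 m1k0; have [al0 be0 hS'] := hS.
have [a m1E] := supp_shape Pm1 kz0 m1k0.
set m := m1 z0 in m1E.
pose z k := zyp m k (p ^ a).
pose G := [pred k | (k != z0) && (w k == w k0)].
have Gk0 : G k0 by rewrite /= kz0 eqxx.
have pa0 : (0 < p ^ a)%N by rewrite expn_gt0 prime_gt0 // (pcharf_prime hp).
have zinj k l : G k -> z k = z l -> G l -> k = l.
  move=> /andP[kz _] E /andP[lz _]; apply/eqP/negPn/negP => kl.
  have := congr1 (fun u : 'X_{1..n} => u k) E; rewrite /z /= !zypE // (negPf kz) eqxx (negPf kl).
  by move=> h; rewrite h in pa0.
set o := zpow m; set R := P (z k0).
have R0 : R != 0 by rewrite /R /z -m1E.
set d := (w k0 * p ^ a)%N; set X := T ^+ (w z0 * m).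
have X0 : X != 0 by rewrite expf_neq0.
have wz k : G k -> T ^+ wdot (z k) = X * T ^+ d.
  by move=> /andP[kz /eqP wk]; rewrite /z wdot_zyp // exprD /X /d wk.
have top k : G k -> al * (phi (P (z k)) * (X * T ^+ d)) = be * P (z k).
  by move=> Gk; rewrite -(wz _ Gk); apply: top_eq; case/andP: Gk.
(* Besides [o] itself, only monomials with the same power of [z0] contribute; by [supp_shape] and
   [weights_agree] these are the [z k] with [k] in [G], all with the same [a]. *)
have bot : al * (X * (phi (P o) + T ^+ d * \sum_(k | G k) phi (P (z k)) * v k ^+ (p ^ a))) = be * P o.
  rewrite -hS'; congr (_ * _).
  pose F m' := phi (P m') * ((mbin m' o)%:R * mpowB v m' o * T ^+ wdot m').
  have Fb m' : (b <= mdeg m')%N -> F m' = 0.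
    by move=> /hP; rewrite /F => ->; rewrite rmorph0 mul0r.
  have Fo : F o = X * phi (P o).
    rewrite /F mbin_nn mul1r (_ : mpowB v o o = 1); last first.
      by rewrite /mpowB big1 // => l _; rewrite subnn expr0.
    by rewrite mul1r /o wdot_zpow mulrC.
  have Fz k : G k -> F (z k) = X * T ^+ d * (phi (P (z k)) * v k ^+ (p ^ a)).
    move=> Gk; have kz : k != z0 by case/andP: Gk.
    have zz : z k z0 = m by rewrite /z zypE // eqxx.
    rewrite /F wz // {1}/o -zz mbin_zpow.
    have -> : mpowB v (z k) o = v k ^+ (p ^ a).
      rewrite /mpowB (bigD1 k) //= /z zypE // (negPf kz) eqxx /o zpowE (negPf kz) subn0.
      rewrite big1 ?mulr1 // => l lk; rewrite zypE // zpowE (negPf lk).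
      by case: eqP => _; rewrite subnn expr0.
    by ring.
  rewrite mulrDr -Fo mulrA mulr_sumr -(eq_bigr _ Fz).
  rewrite -(sum_bm_single o Fb) -(eq_bigr _ (fun k _ => sum_bm_single (z k) Fb)).
  rewrite exchange_big -big_split /twist_coef; apply: eq_bigr => m' _ /=.
  have [/eqP m'o|m'o] := boolP ((m' : 'X_{1..n}) == o).
    rewrite m'o big1 ?addr0 // => k /andP[kz _]; rewrite ifF //.
    apply/negbTE/eqP => /mnmP /(_ k); rewrite /o zpowE (negPf kz) /z zypE // (negPf kz) eqxx.
    by move=> h; rewrite -h in pa0.
  rewrite add0r.
  have [[k Gk m'z]|nz] := pselect (exists2 k, G k & (m' : 'X_{1..n}) = z k).
    rewrite (bigD1 k) //= m'z eqxx big1 ?addr0 // => l /andP[Gl lk].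
    by rewrite ifF //; apply: contraNF lk => /eqP /(zinj k l Gk) /(_ Gl) ->.
  rewrite [LHS]big1 => [|k Gk]; last first.
    by rewrite ifF //; apply/negbTE/eqP => m'z; apply: nz; exists k.
  apply/esym/eqP; rewrite mulf_eq0; have [Pm|Pm] := eqVneq (P m') 0; first by rewrite Pm rmorph0 eqxx.
  apply/orP; right; rewrite mulf_eq0; apply/orP; left; apply/negPn/negP => hc.
  have [mz0 zm] := coef_z0 hc; have {}mz0 : m' z0 = m by rewrite mz0 /o zpowE eqxx.
  have [/existsP[l /andP[lz ml]]|/existsPn nl] := boolP [exists l, (l != z0) && (m' l != 0%N)].
    have [a' mE] := supp_shape Pm lz ml; rewrite mz0 in mE.
    have Pl : P (zyp m l (p ^ a')) != 0 by rewrite -mE.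
    have [wl aa] := weights_agree lz kz0 Pl R0.
    by apply: nz; exists l; rewrite ?mE ?aa //= lz wl eqxx.
  case/eqP: m'o; apply/mnmP => l; rewrite /o zpowE; case: eqP => [->//|/eqP lz].
  by have := nl l; rewrite lz /= negbK => /eqP.
(* Dividing the top equations of [k] and [k0] shows that [P (z k) / R] is fixed by the twist. The
   pair [(0, 0)] is a dummy outside [G]. *)
have ratio k : exists ab : {poly C} * {poly C}, G k -> [/\ polyFq q ab.1, polyFq q ab.2, ab.2 != 0 & P (z k) * ab.2 = R * ab.1].
  have [Gk|] := boolP (G k); last by exists (0, 0).
  have [|a' [b' [h1 h2 h3 h4]]] := @twist_ratio C p e hp (P (z k)) R R0; last by exists (a', b').
  apply: (mulfI (mulf_neq0 (mulf_neq0 al0 be0) (mulf_neq0 X0 (expf_neq0 d T0)))).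
  transitivity (al * (phi (P (z k)) * (X * T ^+ d)) * (be * R)); first by ring.
  by rewrite (top k Gk) -(top k0 Gk0); ring.
have [ab hab] := choice ratio.
pose bb := \prod_(k | G k) (ab k).2.
have bbF : polyFq q bb by apply: (polyFq_prod hp) => k /hab[].
have bb0 : bb != 0 by apply/prodf_neq0 => k /hab[].
pose cc k : {poly C} := if G k then (ab k).1 * \prod_(l | G l && (l != k)) (ab l).2 else 0.
have ccF k : polyFq q (cc k).
  rewrite /cc; case: ifP => [Gk|_]; last exact: polyFq0 e hp.
  apply: (polyFqM hp); first by case: (hab k Gk).
  by apply: (polyFq_prod hp) => l /andP[/hab[]].
have ccE k : G k -> P (z k) * bb = R * cc k.
  move=> Gk; rewrite /bb (bigD1 k) //= mulrA; have [_ _ _ ->] := hab k Gk.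
  by rewrite /cc ifT // mulrA.
have cc0 : cc k0 = bb by apply: (mulfI R0); rewrite -ccE // mulrC.
have phicc k : G k -> phi (P (z k)) * bb = phi R * cc k.
  move=> Gk; have := congr1 (fun A : {poly C} => phi A) (ccE k Gk); rewrite !rmorphM /=.
  by move/polyFqE: bbF => /(_ hp) ->; move/polyFqE: (ccF k) => /(_ hp) ->.
set S := \sum_(k | G k) _ in bot.
have bS : bb * S = phi R * \sum_(k | G k) cc k * v k ^+ (p ^ a).
  rewrite !mulr_sumr; apply: eq_bigr => k Gk.
  by rewrite mulrA [bb * _]mulrC (phicc k Gk) mulrA.
(* With [Y = bb P(o) / R] this says that [phi Y] is [T^d] times the difference of [Y] and the sum of
   the [cc k v_k^(p^a)], in the form required by [twist_denominator]. *)
have bot' : T ^+ d * (bb * P o) * phi R = R * phi (bb * P o)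
    + R * phi R * T ^+ d * \sum_(k | G k) cc k * v k ^+ (p ^ a).
  have -> : R * phi R * T ^+ d * (\sum_(k | G k) cc k * v k ^+ (p ^ a)) = R * T ^+ d * (bb * S).
    by rewrite bS; ring.
  rewrite rmorphM /=; move/polyFqE: bbF => /(_ hp) ->.
  apply: (mulfI (mulf_neq0 al0 X0)).
  transitivity (al * (phi R * (X * T ^+ d)) * (bb * P o)); first by ring.
  rewrite (top k0 Gk0) -/R.
  transitivity (bb * R * (be * P o)); first by ring.
  by rewrite -bot; ring.
have [N1 [R1 [R1F R10 E]]] := twist_denominator R0 bot'.
have : R1 * cc k0 = 0.
  apply: (descent_contra (a := a) kz0 (c := fun k => R1 * cc k) (Q := N1)).
    by move=> k; apply: (polyFqM hp).
  rewrite E; congr (_ * (_ - _)); rewrite mulr_sumr; apply: eq_bigr => k _.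
  by rewrite mulrA.
by move/eqP; rewrite cc0 mulf_eq0 (negPf R10) (negPf bb0).
Qed.

End Step.

(** The bound [b] in the definition of the twist stays fixed while the induction runs on a separate
    degree bound [D], which drops under Hasse derivatives of positive order. *)
Lemma semi_inv_supp b al be P : fsupp b P -> semi_inv b al be P ->
  forall m k, P m != 0 -> k != z0 -> m k = 0%N.
Proof.
suff H D : forall al be P, fsupp b P -> fsupp D P -> semi_inv b al be P ->
    forall m k, P m != 0 -> k != z0 -> m k = 0%N.
  by move=> hP; apply: (H b).
elim: D => [|D IH] {}al {}be {}P hb hD hS m k Pm kz.
  by move: Pm; rewrite hD ?eqxx.
apply/eqP/negPn/negP => mk; apply: (shape_contra hb hS _ Pm kz mk).
move=> f f0 g l lz gl; apply/eqP/negPn/negP => hne; case/eqP: gl.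
apply: (IH _ _ _ _ _ (semi_inv_shift f hb hS) g l hne lz).
  by move=> m' hm'; rewrite hb ?mulr0 // mdegD (leq_trans hm') // leq_addr.
move=> m' hm'; rewrite hD ?mulr0 // mdegD -addn1 leq_add //.
by rewrite lt0n mdeg_eq0.
Qed.

(** * From semi-invariants to relations between the functions *)

Variables (f : 'I_n -> series C) (om : series C).
Hypothesis f_phi : forall k,
  ser_map (frob e hp 1) (f k) = ser_poly (T ^+ w k) * (f k + ser_poly (v k)).
Hypothesis f_z0 : f z0 * om = 1.

Definition is_rel b P := \sum_(m : 'X_{1..n < b}) ser_poly (P m) * mpow f m = 0.

Lemma mpow_phi (m : 'X_{1..n}) b : (mdeg m < b)%N ->
  ser_map (frob e hp 1) (mpow f m) = \sum_(g : 'X_{1..n < b})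
     ser_poly ((mbin m g)%:R * mpowB v m g * T ^+ wdot m) * mpow f g.
Proof.
move=> mb; rewrite rmorph_prod /=.
transitivity (ser_poly (T ^+ wdot m) * mpow (fun k => f k + ser_poly (v k)) m).
  rewrite /mpow /wdot expr_sum rmorph_prod -big_split; apply: eq_bigr => k _.
  by rewrite rmorphXn /= f_phi exprMn exprM !rmorphXn.
rewrite (mpow_add _ _ mb) mulr_sumr; apply: eq_bigr => g _.
rewrite !rmorphM rmorph_nat /=.
have -> : ser_poly (mpowB v m g) = mpowB (fun k => ser_poly (v k)) m g.
  by rewrite /mpowB rmorph_prod; apply: eq_bigr => k _; rewrite rmorphXn.
by ring.
Qed.

Lemma rel_twist b P : is_rel b P -> is_rel b (twist_coef b P).
Proof.
move=> h; have := congr1 (ser_map (frob e hp 1)) h; rewrite rmorph0 rmorph_sum /= /is_rel => E.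
rewrite -[RHS]E /twist_coef.
under [LHS]eq_bigr => g _ do rewrite rmorph_sum mulr_suml.
rewrite exchange_big; apply: eq_bigr => m _.
rewrite rmorphM /= (mpow_phi (bmdeg m)) ser_map_poly mulr_sumr; apply: eq_bigr => g _.
by rewrite rmorphM mulrA.
Qed.

Lemma twist_coef_top b P (m : 'X_{1..n}) : fsupp b P -> (forall m', P m' != 0 -> (m' <= m)%O) ->
  twist_coef b P m = phi (P m) * T ^+ wdot m.
Proof.
move=> hb hm.
pose F m' := phi (P m') * ((mbin m' m)%:R * mpowB v m' m * T ^+ wdot m').
have -> : phi (P m) * T ^+ wdot m = F m.
  rewrite /F mbin_nn mul1r (_ : mpowB v m m = 1) ?mul1r //.
  by rewrite /mpowB big1 // => l _; rewrite subnn expr0.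
rewrite -(sum_bm_single (b := b) m (F := F)); last first.
  by move=> m' /hb; rewrite /F => ->; rewrite rmorph0 mul0r.
apply: eq_bigr => m' _; case: eqP => [->//|mm].
have [Pm|/hm m'm] := eqVneq (P m') 0; first by rewrite Pm rmorph0 mul0r.
rewrite mbin_eq0 ?mul0r ?mulr0 //; apply/negP => /lem_leo mm'.
by apply: mm; apply/le_anti; rewrite m'm mm'.
Qed.

Lemma rel_zero b P : fsupp b P -> is_rel b P -> forall m, P m = 0.
Proof.
suff H m0 : forall P, fsupp b P -> is_rel b P -> (forall m, P m != 0 -> (m < m0)%O) ->
    forall m, P m = 0.
  (* The monomial order refines the degree, so a single monomial of degree [b] lies above the whole
     support. *)
  move=> hb hr; apply: (H (U_(z0) *+ b)%MM _ hb hr) => m Pm.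
  rewrite ltNge; apply: contra Pm => /lemc_mdeg; rewrite mdegMn mdeg1 mul1n => bm.
  by rewrite hb.
elim/(ltmwf (n := n)): m0 => m0 IH {}P hb hr hlt.
apply: contrapT => /existsNP[m2 /eqP Pm2].
have m2b : (mdeg m2 < b)%N by rewrite ltnNge; apply: contra Pm2 => /hb ->.
have [m1 Pm1 hmax] : exists2 m1, P m1 != 0 & forall m, P m != 0 -> (m <= m1)%O.
  pose A := [pred m : 'X_{1..n < b} | P m != 0].
  have A2 : A (BMultinom m2b) by [].
  case: (@arg_maxP _ _ _ (BMultinom m2b) A (fun m : 'X_{1..n < b} => (m : 'X_{1..n})) A2) => m1 Pm1 h.
  exists (m1 : 'X_{1..n}) => // m Pm.
  have mb : (mdeg m < b)%N by rewrite ltnNge; apply: contra Pm => /hb ->.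
  exact: (h (BMultinom mb)).
set P' := twist_coef b P.
have P'1 : P' m1 = phi (P m1) * T ^+ wdot m1 by apply: twist_coef_top.
have P'10 : P' m1 != 0 by rewrite P'1 mulf_neq0 ?expf_neq0 ?map_poly_eq0.
have le_supp m : P' m != 0 -> (m <= m1)%O.
  move=> h; have [m' Pm'] : exists2 m', P m' != 0 & (m <= m')%MM.
    apply: contrapT => hn; case/eqP: h; apply: big1 => m' _.
    have [Pm'|Pm'] := eqVneq (P m') 0; first by rewrite Pm' rmorph0 mul0r.
    rewrite mbin_eq0 ?mul0r ?mulr0 //; apply/negP => mm'; apply: hn; by exists m'.
  by move=> /lem_leo mm'; apply: le_trans mm' (hmax _ Pm').
(* Cross-multiplication with the twisted relation cancels the leading monomial; by minimality [D]
   vanishes, which says that [P] is a semi-invariant. *)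
pose D m := P' m1 * P m - P m1 * P' m.
have DE m : D m = 0.
  apply: (IH m1 (hlt _ Pm1) D).
  - move=> m' hm'; rewrite /D (hb _ hm') mulr0 sub0r; apply/eqP; rewrite oppr_eq0 mulf_eq0 (negPf Pm1) /=.
    apply/eqP/big1 => m'' _; rewrite mbin_eq0 ?mul0r ?mulr0 //; apply/negP => /mdeg_le.
    by rewrite leqNgt (leq_trans (bmdeg m'') hm').
  - have := rel_twist hr; rewrite /is_rel -/P' => hr'.
    under eq_bigr => m' _ do rewrite /D rmorphB !rmorphM mulrBl -!mulrA.
    by rewrite sumrB -!mulr_sumr hr hr' !mulr0 subrr.
  move=> m' Dm'; rewrite lt_neqAle; apply/andP; split.
    by apply: contraNneq Dm' => ->; rewrite /D mulrC subrr.
  have [Pm'|/hmax //] := eqVneq (P m') 0.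
  apply: le_supp; apply: contraNneq Dm' => h; by rewrite /D Pm' h !mulr0 subrr.
have hS : semi_inv b (P m1) (P' m1) P.
  split=> // g; apply/esym/eqP; rewrite -subr_eq0; apply/eqP; exact: DE.
have hsupp := semi_inv_supp hb hS.
have mz m : P m != 0 -> m = zpow (m z0).
  move=> Pm; apply/mnmP => k; rewrite zpowE; case: eqP => [->//|/eqP kz].
  exact: hsupp Pm kz.
(* On powers of the period the twist is diagonal, and comparing degrees in [t] of the eigenvalue
   equation leaves a single exponent. The invertible period then cannot satisfy a one-term
   relation. *)
have uniq m : P m != 0 -> m = m1.
  move=> Pm; rewrite (mz _ Pm) (mz _ Pm1); congr zpow.
  have tc : twist_coef b P m = phi (P m) * T ^+ wdot m.
    pose F m' := phi (P m') * ((mbin m' m)%:R * mpowB v m' m * T ^+ wdot m').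
    have -> : phi (P m) * T ^+ wdot m = F m.
      rewrite /F mbin_nn mul1r (_ : mpowB v m m = 1) ?mul1r //.
      by rewrite /mpowB big1 // => l _; rewrite subnn expr0.
    rewrite -(sum_bm_single (b := b) m (F := F)); last first.
      by move=> m' /hb; rewrite /F => ->; rewrite rmorph0 mul0r.
    apply: eq_bigr => m' _; case: eqP => [->//|mm].
    have [Pm'|Pm'] := eqVneq (P m') 0; first by rewrite Pm' rmorph0 mul0r.
    apply/eqP; rewrite mulf_eq0; apply/orP; right; rewrite mulf_eq0; apply/orP; left.
    apply/negPn/negP => /coef_z0[mz0 _]; apply: mm.
    by rewrite (mz _ Pm') (mz _ Pm) mz0.
  have [_ _ /(_ m)] := hS; rewrite tc P'1 => E; rewrite [RHS]mulrC in E.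
  have sT d : size (T ^+ d) = d.+1.
    rewrite -[LHS]prednK ?size_poly_gt0 ?expf_neq0 //.
    by rewrite size_exp sizeT mul1n.
  have sz A B d : A != 0 -> B != 0 -> size (A * (phi B * T ^+ d)) = (size A + (size B + d)).-1.
    move=> A0 B0; rewrite size_mul ?mulf_neq0 ?expf_neq0 ?map_poly_eq0 //.
    by rewrite size_mul ?expf_neq0 ?map_poly_eq0 // size_map_poly sT addnS.
  have := congr1 (fun A : {poly C} => size A) E; rewrite !sz //.
  rewrite (mz _ Pm) (mz _ Pm1) !wdot_zpow.
  rewrite -(mz _ Pm) -(mz _ Pm1) => E'.
  have : (w z0 * m z0 = w z0 * m1 z0)%N.
    have sk : (0 < size (P m))%N by rewrite size_poly_gt0.
    have sl : (0 < size (P m1))%N by rewrite size_poly_gt0.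
    move: E' sk sl; move: (size (P m)) (size (P m1)) (w z0 * m z0)%N (w z0 * m1 z0)%N.
    by clear; lia.
  by move/eqP; rewrite eqn_pmul2l // => /eqP.
have : ser_poly (P m1) * f z0 ^+ (m1 z0) = 0.
  rewrite -[RHS]hr.
  pose F m := ser_poly (P m) * mpow f m.
  have -> : ser_poly (P m1) * f z0 ^+ m1 z0 = F m1.
    rewrite /F /mpow (bigD1 z0) //= big1 ?mulr1 // => k kz.
    by rewrite (hsupp _ _ Pm1 kz) expr0.
  rewrite -(sum_bm_single (b := b) m1 (F := F)); last first.
    by move=> m' /hb; rewrite /F => ->; rewrite rmorph0 mul0r.
  apply: eq_bigr => m _; case: eqP => // mm.
  have [Pm|/uniq //] := eqVneq (P m) 0.
  by rewrite Pm rmorph0 mul0r.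
move=> /(congr1 (fun x => x * om ^+ m1 z0)); rewrite mul0r -mulrA -exprMn f_z0 expr1n mulr1.
by move=> h; case/eqP: Pm1; apply: (@ser_poly_inj C); rewrite h rmorph0.
Qed.

End SemiInvariant.

(** * The Carlitz period and the deformation series *)

Section Construct.
Variables (R : realType) (C : closedFieldType) (abs : C -> R) (p e : nat) (theta : C).
Local Notation q := (p ^ e)%N.
Hypothesis hp : p \in [pchar C].
Hypothesis e0 : (0 < e)%N.
Hypothesis Hna : nonarch_abs abs.
Hypothesis theta1 : 1 < abs theta.
Hypothesis Hcomplete : forall s, cauchy_abs abs s -> exists l, cvg_abs abs s l.
Local Notation fr n := (frob e hp n).
Local Notation phi := (ser_map (fr 1)).
Local Notation evl := (evl abs).
Local Notation bnd := (bnd abs).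
Local Notation ncvg := (ncvg abs).
Local Notation ccvg := (ccvg abs).
Local Notation T := ('X - (theta ^+ q)%:P : {poly C}).

Let q1 : (1 < q)%N. Proof. exact: q_gt1 hp e0. Qed.
Let theta0 : theta != 0.
Proof. by rewrite -(abs_gt0 Hna); apply: lt_trans theta1. Qed.

Lemma expq0 i : 0 ^+ (q ^ i) = 0 :> C.
Proof. by rewrite expr0n gtn_eqF // (qX_gt0 hp e0). Qed.

Lemma coef_twist i (u : {poly C}) k : (twist q i u)`_k = u`_k ^+ (q ^ i).
Proof. by rewrite /twist coef_map_id0 // expq0. Qed.

Lemma ccvg_phi F f : ccvg F f -> ccvg (fun N => phi (F N)) (phi f).
Proof.
move=> h k /=; rewrite frob1; apply: cvg_abs_ext (cvg_absX Hna q (h k)) => N /=.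
by rewrite frob1.
Qed.

Section Radius.
Variable rho : R.
Hypothesis rho_theta : abs theta < rho.
Let rho1 : 1 < rho. Proof. exact: lt_trans rho_theta. Qed.
Let rho0 : 0 < rho. Proof. exact: lt_trans rho1. Qed.

Lemma ncvg_bnd_ex F f : (forall N, exists B, bnd B rho (F N)) -> ncvg rho F f ->
  exists B, bnd B rho f.
Proof.
move=> hF h; have [N hN] := h 1 ltr01; have [B hB] := hF N.
exists (Num.max B 1); rewrite -(subrK (F N) f) addrC; apply: (bndD Hna rho0).
  by apply: bnd_le hB; rewrite le_max lexx.
rewrite -opprB; apply: (bndN Hna); apply: bnd_le (hN N (leqnn _)).
by rewrite le_max lexx orbT.
Qed.

(* A solution of [phi Z = T^N Z] is a multiple of [Pi^N] by an element of
   [Fq[[t]]]; convergence beyond the unit disc makes this element a polynomial. *)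
Lemma twist_eigen_relation (K : finType) (G : pred K) (f : K -> series C) (v c : K -> {poly C})
    (vl : K -> C) (Q : {poly C}) (N : nat) (Pi Om : series C) (pit : C) :
  (forall k, exists B, bnd B rho (f k)) -> (exists B, bnd B rho Pi) -> (exists B, bnd B rho Om) ->
  Pi * Om = 1 -> phi Pi = ser_poly T * Pi ->
  (forall k, G k -> phi (f k) = ser_poly (T ^+ N) * (f k + ser_poly (v k))) ->
  (forall k, evl (f k) theta (vl k)) -> evl Pi theta pit ->
  (forall k, polyFq q (c k)) -> (0 < N)%N ->
  map_poly (fr 1) Q = T ^+ N * (Q - \sum_(k | G k) c k * v k) ->
  exists2 g : {poly C}, polyFq q g &
    \sum_(k | G k) (c k).[theta] * vl k = g.[theta] * pit ^+ N.
Proof.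
move=> hf [BP hPi] [BO hOm] PO phiPi phif hvl hpit cF N0 hQ.
pose Z := \sum_(k | G k) ser_poly (c k) * f k + ser_poly Q.
have phic k : phi (ser_poly (c k)) = ser_poly (c k).
  by rewrite ser_map_poly; have /(polyFqE e hp) -> := cF k.
have phiZ : phi Z = ser_poly (T ^+ N) * Z.
  rewrite /Z rmorphD rmorph_sum /= ser_map_poly hQ.
  rewrite (eq_bigr (fun k => ser_poly (T ^+ N) * (ser_poly (c k) * f k) + ser_poly (T ^+ N) * ser_poly (c k * v k))); last first.
    by move=> k Gk; rewrite rmorphM /= phic phif // [ser_poly (c k * v k)]rmorphM /=; ring.
  rewrite big_split /= -!mulr_sumr rmorphM rmorphB rmorph_sum /=; ring.
have T0 : T != 0 by rewrite polyXsubC_eq0.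
have sT0 : ser_poly (T ^+ N) != 0 :> series C.
  by apply/eqP; rewrite -[0](rmorph0 (@ser_poly C)) => /ser_poly_inj/eqP; rewrite expf_eq0 (negPf T0) andbF.
have phiO : ser_poly T * phi Om = Om.
  have := congr1 phi PO; rewrite rmorphM rmorph1 /= phiPi => E.
  transitivity (Pi * Om * (ser_poly T * phi Om)); first by rewrite PO mul1r.
  transitivity (Om * (ser_poly T * Pi * phi Om)); first by ring.
  by rewrite E mulr1.
pose g := Z * Om ^+ N.
have phig : phi g = g.
  apply/eqP; rewrite -subr_eq0; apply/eqP; apply: (ser_mulf_eq0 _ sT0).
  have -> : phi g = phi Z * phi Om ^+ N by rewrite /g rmorphM rmorphXn.
  rewrite mulrBr /g phiZ; apply/eqP; rewrite subr_eq0; apply/eqP.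
  transitivity (ser_poly (T ^+ N) * Z * (ser_poly T * phi Om) ^+ N).
    by rewrite exprMn rmorphXn /=; move: (ser_poly T) (phi Om) => x y; ring.
  by rewrite phiO mulrA.
have gF k : inFq q (coefs g k).
  by have := congr1 (fun h => coefs h k) phig; rewrite /= frob1.
have [BZ hZ] : exists B, bnd B rho Z.
  have [B hB] := choice hf; have [D hD] := choice (fun k => bnd_poly_ex Hna rho0 (c k)).
  have [BQ hBQ] := bnd_poly_ex Hna rho0 Q.
  have nn k : 0 <= D k * B k by rewrite mulr_ge0 ?(bnd_ge0 Hna rho0 (hB k)) ?(bnd_ge0 Hna rho0 (hD k)).
  exists (Num.max (\sum_k D k * B k) BQ); apply: (bndD Hna rho0); last first.
    by apply: bnd_le hBQ; rewrite le_max lexx orbT.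
  apply: (bnd_sum Hna rho0) => [|k _]; first by rewrite le_max sumr_ge0.
  apply: bnd_le (bndM Hna rho0 (hD k) (hB k)).
  by rewrite le_max (bigD1 k) //= lerDl sumr_ge0.
have hg : bnd (BZ * BO ^+ N) rho g by apply: (bndM Hna rho0 hZ); apply: (bndX Hna rho0).
(* A nonzero element of [F_q] has absolute value [1], so a nonzero coefficient of degree [k] would
   give [rho^k] at most the bound of [g]. *)
have [M hM] : exists M, forall k, (M <= k)%N -> coefs g k = 0.
  have r1 : 0 <= rho^-1 < 1 by rewrite invr_ge0 ltW //= invf_lt1.
  have D0 := bnd_ge0 Hna rho0 hg.
  have D1 : 0 < (BZ * BO ^+ N + 1)^-1 by rewrite invr_gt0 ltr_wpDl.
  have [M hM] := expr_small r1 D1; exists M => k /hM hk.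
  apply/eqP/negPn/negP => gk.
  have ak : 0 < abs (coefs g k) by rewrite abs_gt0.
  have a1 : abs (coefs g k) = 1.
    have := congr1 abs (gF k); rewrite absX // => E.
    apply/eqP; rewrite -(@pexpr_eq1 _ _ q.-1) ?abs_ge0 //; last by rewrite -ltnS prednK // ltnW.
    apply/eqP/(mulfI (lt0r_neq0 ak)); rewrite mulr1 -exprS prednK // ltnW //.
  have := hg k; rewrite a1 mul1r => h.
  move: hk; rewrite exprVn ltf_pV2 ?posrE ?exprn_gt0 ?ltr_wpDl // => h'.
  have := lt_le_trans h' h; rewrite -subr_gt0 opprD addrA subrr sub0r oppr_gt0.
  by rewrite ltr10.
pose g0 : {poly C} := ser_trunc M g.
have gE : g = ser_poly g0.
  apply: seriesP => k; rewrite coefs_poly coef_ser_trunc; case: ltnP => // /hM; exact.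
exists g0.
  by move=> k; rewrite -coefs_poly -gE.
have ZE : Z = ser_poly g0 * Pi ^+ N.
  by rewrite -gE /g -mulrA -exprMn [Om * Pi]mulrC PO expr1n mulr1.
have evZ : evl Z theta (\sum_(k | G k) (c k).[theta] * vl k + Q.[theta]).
  apply: (evlD Hna); last exact: evl_poly.
  apply: (evl_sum Hna) => k _; have [B hB] := hf k; have [D hD] := bnd_poly_ex Hna rho0 (c k).
  exact: (evlM Hna rho0 hD hB rho_theta (evl_poly Hna _ _) (hvl k)).
have evZ' : evl Z theta (g0.[theta] * pit ^+ N).
  rewrite ZE; have [D hD] := bnd_poly_ex Hna rho0 g0.
  apply: (evlM Hna rho0 hD (bndX Hna rho0 N hPi) rho_theta (evl_poly Hna _ _)).
  exact: (evlX Hna rho0 N hPi rho_theta hpit).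
(* Evaluate the equation of [Q] at [theta^q], the zero of [T]: the left side becomes [Q(theta)^q].
   Thus [Q] does not appear in the relation between values. *)
have Q0 : Q.[theta] = 0.
  have := congr1 (fun P : {poly C} => P.[fr 1 theta]) hQ; rewrite horner_map hornerM horner_exp /= frob1.
  rewrite hornerXsubC frob1 subrr expr0n eqn0Ngt N0 mul0r => /eqP.
  by rewrite expf_eq0 => /andP[_ /eqP].
by have := evl_ext Hna evZ evZ'; rewrite Q0 addr0.
Qed.

Hypothesis rho_lt : rho < abs theta ^+ q.

(** * The deformation of the period *)

Definition pole (i : nat) : C := theta ^+ (q ^ i).
(** The expansion of [(1 - t/a)^-1], the inverse of [lin1 a]. *)
Definition geo (a : C) : series C := Series (fun k => (a^-1) ^+ k).
Definition lin1 (a : C) : {poly C} := 1 - a^-1 *: 'X.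

Lemma pole_neq0 i : pole i != 0. Proof. by rewrite expf_neq0. Qed.

Lemma abs_pole i : abs (pole i) = abs theta ^+ (q ^ i). Proof. exact: absX. Qed.

Lemma rho_pole i : (0 < i)%N -> rho < abs (pole i).
Proof.
move=> i0; rewrite abs_pole; apply: lt_le_trans rho_lt _; rewrite ler_weXn2l ?ltW //.
by rewrite -[X in (X <= _)%N]expn1 leq_exp2l.
Qed.

Lemma phi_geo i : phi (geo (pole i)) = geo (pole i.+1).
Proof.
apply: seriesP => k /=; rewrite rmorphXn fmorphV /= frob1 /pole -exprM expnSr //.
Qed.

Lemma geoM a : ser_poly (lin1 a) * geo a = 1.
Proof.
apply: seriesP => k; rewrite /lin1 rmorphB rmorph1 mulrBl mul1r coefsB coefs1.
rewrite coefsM /=; case: k => [|k].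
  by rewrite big_ord1 coefZ coefX mulr0 mul0r subr0 expr0.
rewrite 2!big_ord_recl /= big1 ?addr0 => [|i _]; last by rewrite coefZ coefX mulr0 mul0r.
by rewrite !coefZ !coefX mulr0 mul0r add0r mulr1 /bump /= subn1 -exprS subrr.
Qed.

Lemma geo_ratio i : (0 < i)%N -> 0 <= rho / abs (pole i) < 1.
Proof.
move=> /rho_pole h; have ap : 0 < abs (pole i) by apply: lt_trans h.
by rewrite divr_ge0 ?ltW // ltr_pdivrMr // mul1r.
Qed.

Lemma bnd_geo i : (0 < i)%N -> bnd 1 rho (geo (pole i)).
Proof.
move=> /geo_ratio/andP[h0 h1] k /=; rewrite absX // absV // -exprMn mulrC.
by rewrite exprn_ile1 // ltW.
Qed.

Lemma bnd_geo1 i : (0 < i)%N -> bnd (rho / abs (pole i)) rho (geo (pole i) - 1).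
Proof.
move=> /geo_ratio/andP[h0 h1] k; rewrite coefsB coefs1 /=; case: k => [|k].
  by rewrite expr0 subrr abs0 // mul0r.
by rewrite subr0 absX // absV // -exprMn mulrC exprS ler_piMr // exprn_ile1 // ltW.
Qed.

Lemma bnd_lin1 i : (0 < i)%N -> bnd (rho / abs (pole i)) rho (ser_poly (lin1 (pole i)) - 1).
Proof.
move=> /geo_ratio/andP[h0 h1] k; rewrite coefsB coefs1 coefs_poly /lin1 coefB coef1 coefZ coefX.
rewrite addrAC subrr sub0r absN //; case: k => [|[|k]] /=; rewrite ?mulr0 ?abs0 ?mul0r //.
by rewrite mulr1 expr1 absV // mulrC.
Qed.

Lemma bnd_lin i : (0 < i)%N -> bnd 1 rho (ser_poly (lin1 (pole i))).
Proof.
move=> i0; rewrite -(subrK 1 (ser_poly _)); apply: (bndD Hna rho0); last exact: bnd1.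
by apply: bnd_le (bnd_lin1 i0); case/andP: (geo_ratio i0) => _ /ltW.
Qed.

Lemma pole_ratio_small (D eps : R) : 0 <= D -> 0 < eps ->
  exists N, forall m, (N <= m)%N -> D * (rho / abs (pole m.+1)) < eps.
Proof.
move=> D0 eps0.
have r1 : 0 <= (abs theta)^-1 < 1 by rewrite invr_ge0 ltW ?(lt_trans ltr01) //= invf_lt1 // (lt_trans ltr01).
have E0 : 0 < eps / (D * rho + 1) by rewrite divr_gt0 // ltr_wpDl // mulr_ge0 // ltW.
have [N hN] := expr_small r1 E0; exists N => m /hN; rewrite ltr_pdivlMr ?ltr_wpDl ?mulr_ge0 ?(ltW rho0) //.
apply: le_lt_trans; rewrite mulrA mulrC.
have t0 : 0 < abs theta by apply: lt_trans theta1.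
apply: ler_pM; rewrite ?invr_ge0 ?abs_ge0 ?mulr_ge0 ?(ltW rho0) //; last by rewrite lerDl.
rewrite abs_pole exprVn lef_pV2 ?posrE ?exprn_gt0 // ler_weXn2l ?ltW //.
by apply: leq_trans (leqnSn m) _; apply/ltnW/ltn_expl.
Qed.

Lemma infinite_product (F : nat -> series C) (h : nat -> series C) D :
  0 <= D -> bnd D rho (F 0%N) -> (forall i, bnd 1 rho (h i)) ->
  (forall i, bnd (rho / abs (pole i.+1)) rho (h i - 1)) ->
  (forall N, F N.+1 = F N * h N) ->
  exists2 f, ncvg rho F f & exists B, bnd B rho f.
Proof.
move=> D0 F0 h1 h2 FS.
have FB N : bnd D rho (F N).
  elim: N => // N IH; rewrite FS -[D]mulr1; exact: (bndM Hna rho0).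
have [f hf] : exists f, ncvg rho F f.
  apply: (ncvg_ex Hna rho0 Hcomplete (d := fun N => D * (rho / abs (pole N.+1)))) => [eps|N].
    exact: pole_ratio_small.
  rewrite FS -{2}[F N]mulr1 -mulrBr; exact: (bndM Hna rho0).
by exists f => //; apply: (ncvg_bnd_ex _ hf) => N; exists D.
Qed.

(** [Pi] is [xi^q] times the product of the [(1 - t/theta^(q^i))^-1] for [i >= 1], and [Om] is its
    inverse, the classical function Omega. The twist moves each factor to the next one; the missing
    first factor and the change of constant combine to [T]. *)
Lemma carlitz_period (xi pit : C) : xi ^+ (q - 1) = - theta ->
  cvg_abs abs (pi_partial q theta xi) pit ->
  exists Pi Om : series C, [/\ exists B, bnd B rho Pi, exists B, bnd B rho Om, Pi * Om = 1,
    phi Pi = ser_poly T * Pi & evl Pi theta pit].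
Proof.
move=> hxi hpit.
have xi0 : xi != 0.
  apply: contraNneq theta0 => xi0; rewrite -oppr_eq0 -hxi xi0 expr0n subn_eq0.
  by rewrite leqNgt q1.
pose kp : {poly C} := (xi ^+ q)%:P; pose ko : {poly C} := ((xi ^+ q)^-1)%:P.
have kk : kp * ko = 1 by rewrite /kp /ko -polyCM divff // expf_neq0.
pose P N := ser_poly kp * \prod_(1 <= i < N.+1) geo (pole i).
pose O N := ser_poly ko * \prod_(1 <= i < N.+1) ser_poly (lin1 (pole i)).
have PS N : P N.+1 = P N * geo (pole N.+1) by rewrite /P big_nat_recr //= mulrA.
have OS N : O N.+1 = O N * ser_poly (lin1 (pole N.+1)) by rewrite /O big_nat_recr //= mulrA.
have [DP hDP] := bnd_poly_ex Hna rho0 kp; have [DO hDO] := bnd_poly_ex Hna rho0 ko.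
have P0 : P 0%N = ser_poly kp by rewrite /P big_geq // mulr1.
have O0 : O 0%N = ser_poly ko by rewrite /O big_geq // mulr1.
have [Pi cP [BP bP]] : exists2 f, ncvg rho P f & exists B, bnd B rho f.
  apply: (@infinite_product P (fun i => geo (pole i.+1)) DP) => //.
  - exact: (bnd_ge0 Hna rho0 hDP).
  - by rewrite P0.
  - by move=> i; apply: bnd_geo.
  by move=> i; apply: bnd_geo1.
have [Om cO [BO bO]] : exists2 f, ncvg rho O f & exists B, bnd B rho f.
  apply: (@infinite_product O (fun i => ser_poly (lin1 (pole i.+1))) DO) => //.
  - exact: (bnd_ge0 Hna rho0 hDO).
  - by rewrite O0.
  - by move=> i; apply: bnd_lin.
  by move=> i; apply: bnd_lin1.
have PO N : P N * O N = 1.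
  elim: N => [|N IH]; first by rewrite P0 O0 -rmorphM kk rmorph1.
  by rewrite PS OS mulrACA IH mul1r mulrC geoM.
have ccP := ncvg_ccvg rho0 cP; have ccO := ncvg_ccvg rho0 cO.
exists Pi, Om; split; [by exists BP|by exists BO| | |].
- apply: (ccvg_unique Hna (ccvgM Hna ccP ccO)).
  have -> : (fun N => P N * O N) = (fun=> 1) by apply/funext => N; rewrite PO.
  exact: ccvg_cst.
- apply: (ccvg_unique Hna (ccvg_phi ccP)).
  have E N : phi (P N) = ser_poly T * P N.+1.
    rewrite /P rmorphM rmorph_prod /= ser_map_poly map_polyC /= frob1.
    under eq_bigr => i _ do rewrite phi_geo.
    rewrite [in RHS]big_nat_recl //.
    rewrite mulrA mulrA; congr (_ * _).
    have TE : T = - (theta ^+ q)%:P * lin1 (pole 1).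
      rewrite /lin1 /pole expn1 mulNr mulrBr mulr1 -mul_polyC mulrA -polyCM divff ?expf_neq0 //.
      by rewrite mul1r opprB.
    rewrite TE -[LHS]mulr1 -(geoM (pole 1)) !rmorphM /=.
    (* From [xi^(q-1) = -theta] one gets [xi^(q q) = (-theta)^q xi^q]; the sign leaves the power
       because the Frobenius is additive, also for [p = 2]. *)
    have -> : ((xi ^+ q) ^+ q)%:P = - (theta ^+ q)%:P * kp.
      rewrite /kp -polyCN -polyCM; congr _%:P.
      have -> : - theta ^+ q = (- theta) ^+ q by rewrite -!(frob1 e hp) rmorphN.
      rewrite -hxi -!exprM -exprD; congr (_ ^+ _).
      by rewrite mulnBl mul1n subnK // leq_pmull // ltnW.
    rewrite rmorphM /=; move: (ser_poly _) (ser_poly kp) (ser_poly _) (geo _) => x1 x2 x3 x4; ring.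
  have -> : (fun N => phi (P N)) = (fun N => ser_poly T * P N.+1) by apply/funext.
  by apply: (ccvgM Hna); [apply: ccvg_cst|apply: ccvgS].
have ev N : evl (P N) theta (pi_partial q theta xi N).
  have evg i : (0 < i)%N -> evl (geo (pole i)) theta (1 - theta / theta ^+ (q ^ i))^-1.
    move=> i0; have [y hy] := evl_ex Hna rho0 Hcomplete (bnd_geo i0) rho_theta.
    have [D hD] := bnd_poly_ex Hna rho0 (lin1 (pole i)).
    have := evlM Hna rho0 hD (bnd_geo i0) rho_theta (evl_poly Hna _ _) hy.
    rewrite geoM => h1.
    have h2 : evl 1 theta 1.
      by rewrite -(rmorph1 (@ser_poly C)) -(hornerC 1 theta); apply: evl_poly.
    have E : (1 - theta / theta ^+ (q ^ i)) * y = 1.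
      rewrite -[RHS](evl_ext Hna h1 h2) /lin1 !hornerE; congr (_ * _); congr (_ - _).
      by rewrite mulrC.
    have d0 : 1 - theta / theta ^+ (q ^ i) != 0.
      by apply: contraTneq isT => h; move: E; rewrite h mul0r => /eqP; rewrite eq_sym oner_eq0.
    by have -> : (1 - theta / theta ^+ (q ^ i))^-1 = y by apply: (mulfI d0); rewrite E divff.
  elim: N => [|N IH].
    by rewrite P0 /pi_partial big_geq // mulr1 -{1}(hornerC (xi ^+ q) theta); apply: evl_poly.
  have -> : pi_partial q theta xi N.+1 = pi_partial q theta xi N * (1 - theta / theta ^+ (q ^ N.+1))^-1.
    by rewrite /pi_partial [in LHS]big_nat_recr //= mulrA.
  rewrite PS.
  have [B hB] : exists B, bnd B rho (P N).
    elim: N {IH} => [|N [B hB]]; first by rewrite P0; exists DP.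
    by rewrite PS; exists (B * 1); apply: (bndM Hna rho0 hB); apply: bnd_geo.
  exact: (evlM Hna rho0 hB (bnd_geo (ltn0Sn N)) rho_theta IH (evg _ (ltn0Sn N))).
have [y hy] := evl_ex Hna rho0 Hcomplete bP rho_theta.
have hc := ncvg_evl Hna rho0 cP rho_theta bP ev hy.
by rewrite (cvg_abs_unique Hna hpit hc).
Qed.

(** The expansion at [0] of [(t - theta^(q^k))^-1]. *)
Definition hinv (k : nat) : series C := ser_poly (- (pole k)^-1)%:P * geo (pole k).

Lemma hinvM k : ser_poly ('X - (pole k)%:P) * hinv k = 1.
Proof.
have -> : 'X - (pole k)%:P = (- pole k)%:P * lin1 (pole k).
  rewrite /lin1 mulrBr mulr1 -mul_polyC mulrA -polyCM mulNr divff ?pole_neq0 //.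
  by rewrite !polyCN mulN1r opprK addrC.
rewrite rmorphM /hinv mulrACA -rmorphM -polyCM mulrNN divff ?pole_neq0 // rmorph1 mul1r.
exact: geoM.
Qed.

Lemma phi_hinv k : phi (hinv k) = hinv k.+1.
Proof.
rewrite /hinv rmorphM /= phi_geo ser_map_poly map_polyC /= rmorphN fmorphV /= frob1.
by rewrite /pole -exprM -expnSr.
Qed.

Lemma bnd_hinv k : (0 < k)%N -> bnd (abs (pole k))^-1 rho (hinv k).
Proof.
move=> k0; rewrite -[_^-1]mulr1; apply: (bndM Hna rho0); last exact: bnd_geo.
move=> [|j]; rewrite coefs_poly coefC /=; last first.
  by rewrite abs0 // mul0r invr_ge0 abs_ge0.
by rewrite expr0 mulr1 absN // absV.
Qed.

Lemma evl_hinv k : (0 < k)%N -> evl (hinv k) theta (theta - pole k)^-1.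
Proof.
move=> k0; have [y hy] := evl_ex Hna rho0 Hcomplete (bnd_hinv k0) rho_theta.
have [D hD] := bnd_poly_ex Hna rho0 ('X - (pole k)%:P).
have := evlM Hna rho0 hD (bnd_hinv k0) rho_theta (evl_poly Hna _ _) hy.
rewrite hinvM => h1.
have h2 : evl 1 theta 1.
  by rewrite -(rmorph1 (@ser_poly C)) -(hornerC 1 theta); apply: evl_poly.
have E : (theta - pole k) * y = 1 by rewrite -[RHS](evl_ext Hna h1 h2) hornerXsubC.
have d0 : theta - pole k != 0.
  by apply: contraTneq isT => h; move: E; rewrite h mul0r => /eqP; rewrite eq_sym oner_eq0.
by have -> : (theta - pole k)^-1 = y by apply: (mulfI d0); rewrite E divff.
Qed.

(** * The deformation of the values of [L] *)

Section Deformation.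
Variables (u : {poly C}) (n : nat).
Hypothesis hnorm : normp abs u ^+ (q - 1) < abs theta ^+ (n * q).
Local Notation U := (normp abs u).

Lemma normp_ge0 : 0 <= U.
Proof. by rewrite /normp; elim/big_rec: _ => // i x _ hx; rewrite le_max hx orbT. Qed.

Lemma coef_le_normp j : abs u`_j <= U.
Proof.
have [ju|uj] := ltnP j (size u); last by rewrite nth_default // abs0 // normp_ge0.
by rewrite /normp (bigD1 (Ordinal ju)) //= le_max lexx.
Qed.

Definition hprod (i : nat) : series C := \prod_(1 <= k < i.+1) hinv k.
Definition lterm (i : nat) : series C := ser_poly (twist q i u) * hprod i ^+ n.
Definition lsum (N : nat) : series C := \sum_(i < N) lterm i.
Definition lbound (i : nat) : R :=
  U ^+ (q ^ i) * rho ^+ size u * (\prod_(1 <= k < i.+1) (abs (pole k))^-1) ^+ n.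

Lemma bnd_twist i : bnd (U ^+ (q ^ i) * rho ^+ size u) rho (ser_poly (twist q i u)).
Proof.
have U0 := normp_ge0.
move=> k; rewrite coefs_poly coef_twist.
have [uk|ku] := leqP (size u) k.
  rewrite nth_default // expq0.
  by rewrite abs0 // mul0r mulr_ge0 // exprn_ge0 // ltW.
rewrite absX //; apply: ler_pM; rewrite ?exprn_ge0 ?abs_ge0 ?(ltW rho0) //.
  by rewrite lerXn2r ?coef_le_normp // nnegrE ?abs_ge0.
by rewrite ler_weXn2l ?(ltW rho1) // ltnW.
Qed.

Lemma bnd_hprod i : bnd (\prod_(1 <= k < i.+1) (abs (pole k))^-1) rho (hprod i).
Proof.
rewrite /hprod; elim: i => [|i IH]; first by rewrite !big_geq //; apply: bnd1.
rewrite big_nat_recr //= [X in bnd _ _ X]big_nat_recr //=.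
exact: (bndM Hna rho0 IH (bnd_hinv (ltn0Sn i))).
Qed.

Lemma bnd_lterm i : bnd (lbound i) rho (lterm i).
Proof. by apply: (bndM Hna rho0 (bnd_twist i)); apply: (bndX Hna rho0); apply: bnd_hprod. Qed.

Lemma lbound_ge0 i : 0 <= lbound i.
Proof. exact: (bnd_ge0 Hna rho0 (bnd_lterm i)). Qed.

(* [q + q^2 + ... + q^i = (q^(i+1) - q) / (q - 1)]. *)
Lemma prod_pole i : (\prod_(1 <= k < i.+1) abs (pole k)) ^+ (q - 1) * abs theta ^+ q = (abs theta ^+ q) ^+ (q ^ i).
Proof.
elim: i => [|i IH]; first by rewrite big_geq // expr1n mul1r expr1.
rewrite big_nat_recr //= exprMn mulrAC IH abs_pole -!exprM -exprD; congr (_ ^+ _).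
rewrite expnS; have := q1; case: (q) => // a _; rewrite subn1 /= !mulSn mulnC; lia.
Qed.

(** The [(q - 1)]-st power of [lbound m] is [r ^+ (q ^ m) * K], where [r < 1] is the norm
    hypothesis. Taking this power avoids the fractional exponents of the geometric sum of the
    poles. *)
Lemma lbound_small (eps : R) : 0 < eps -> exists N, forall m, (N <= m)%N -> lbound m < eps.
Proof.
move=> eps0; have U0 := normp_ge0; have t0 : 0 < abs theta by apply: lt_trans theta1.
set r := U ^+ (q - 1) / abs theta ^+ (n * q).
have r1 : 0 <= r < 1.
  by rewrite /r divr_ge0 ?exprn_ge0 ?(ltW t0) //= ltr_pdivrMr ?exprn_gt0 // mul1r.
pose K := (rho ^+ size u) ^+ (q - 1) * abs theta ^+ (n * q).
have K0 : 0 < K by rewrite mulr_gt0 // ?exprn_gt0.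
have E0 : 0 < eps ^+ (q - 1) / K by rewrite divr_gt0 // exprn_gt0.
have [N hN] := expr_small r1 E0; exists N => m Nm.
have Nq : (N <= q ^ m)%N by apply: leq_trans Nm _; apply/ltnW/ltn_expl.
have := hN _ Nq; rewrite ltr_pdivlMr // => h.
have Eq : lbound m ^+ (q - 1) = r ^+ (q ^ m) * K.
  rewrite /lbound /r /K prodfV exprVn.
  set p0 := \prod_(1 <= k < m.+1) _.
  have p00 : 0 < p0 by rewrite prodr_gt0 // => k _; rewrite abs_pole exprn_gt0.
  have := prod_pole m; rewrite -/p0 => hp0.
  rewrite !exprMn !exprVn -!exprM (mulnC (q ^ m)%N) exprM -mulrA -mulrA; congr (_ * _).
  have hx : (p0 ^+ (n * (q - 1))) * abs theta ^+ (n * q) = abs theta ^+ (n * q * q ^ m).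
    rewrite mulnC exprM [(n * q)%N]mulnC [in LHS]exprM -exprMn hp0 -!exprM; congr (_ ^+ _); ring.
  rewrite -hx invfM; have h1 : p0 ^+ (n * (q - 1)) != 0 by rewrite expf_neq0 // gt_eqF.
  have h2 : abs theta ^+ (n * q) != 0 by rewrite expf_neq0 // gt_eqF.
  by field; rewrite h1 h2.
rewrite -Eq in h.
have q10 : (0 < q - 1)%N by rewrite subn_gt0.
by rewrite -(ltr_pXn2r q10) ?nnegrE ?lbound_ge0 // ltW.
Qed.

(** The twist shifts the poles by one step, so only the pole at [theta^q] has to be restored; summed
    over [i], the term [lterm 0 = u] is what is missing. *)
Lemma phi_lterm i : ser_poly (T ^+ n) * lterm i.+1 = phi (lterm i).
Proof.
rewrite /lterm rmorphM /= ser_map_poly.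
have -> : map_poly (fr 1) (twist q i u) = twist q i.+1 u.
  by apply/polyP => k; rewrite coef_map /= !coef_twist frob1 -exprM -expnSr.
have -> : phi (hprod i ^+ n) = (ser_poly T * hprod i.+1) ^+ n.
  rewrite rmorphXn /=; congr (_ ^+ _); rewrite /hprod rmorph_prod /= (eq_bigr _ (fun k _ => phi_hinv k)) [in RHS]big_nat_recl //.
  have -> : ser_poly T * (hinv 1 * \prod_(1 <= k < i.+1) hinv k.+1) =
    ser_poly ('X - (pole 1)%:P) * hinv 1 * \prod_(1 <= k < i.+1) hinv k.+1.
    by rewrite mulrA /pole expn1.
  by rewrite hinvM mul1r.
by rewrite exprMn rmorphXn /= mulrCA.
Qed.

Lemma lterm0 : lterm 0 = ser_poly u.
Proof.
rewrite /lterm /hprod big_geq // expr1n mulr1; congr ser_poly.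
by apply/polyP => k; rewrite coef_twist expn0 expr1.
Qed.

Lemma deformation_series (l : C) : cvg_abs abs (Lpartial q theta n u) l ->
  exists f : series C, [/\ exists B, bnd B rho f,
    phi f = ser_poly (T ^+ n) * (f + ser_poly (- u)) & evl f theta l].
Proof.
move=> hl.
have lS N : lsum N.+1 = lsum N + lterm N by rewrite /lsum big_ord_recr.
have lb N : exists B, bnd B rho (lsum N).
  elim: N => [|N [B hB]]; first by exists 0; rewrite /lsum big_ord0; apply: (bnd0 Hna).
  exists (Num.max B (lbound N)); rewrite lS; apply: (bndD Hna rho0).
    by apply: bnd_le hB; rewrite le_max lexx.
  by apply: bnd_le (bnd_lterm N); rewrite le_max lexx orbT.
have [f hf] : exists f, ncvg rho lsum f.
  apply: (ncvg_ex Hna rho0 Hcomplete (d := lbound)) => [eps|N]; first exact: lbound_small.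
  by rewrite lS addrAC subrr add0r; apply: bnd_lterm.
have [B hB] := ncvg_bnd_ex lb hf; have cf := ncvg_ccvg rho0 hf.
exists f; split; first by exists B.
  apply: (ccvg_unique Hna (ccvg_phi cf)).
  have E N : phi (lsum N) = ser_poly (T ^+ n) * (lsum N.+1 + ser_poly (- u)).
    rewrite /lsum big_ord_recl lterm0 rmorphN addrAC subrr add0r mulr_sumr rmorph_sum /=.
    by apply: eq_bigr => i _; rewrite -phi_lterm.
  have -> : (fun N => phi (lsum N)) = (fun N => ser_poly (T ^+ n) * (lsum N.+1 + ser_poly (- u))).
    by apply/funext.
  apply: (ccvgM Hna); first exact: ccvg_cst.
  by apply: (ccvgD Hna); [apply: ccvgS|apply: ccvg_cst].
have evp i : evl (hprod i) theta (\prod_(1 <= k < i.+1) (theta - theta ^+ (q ^ k)))^-1.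
  elim: i => [|i IH].
    rewrite /hprod !big_geq // invr1 -(rmorph1 (@ser_poly C)) -(hornerC 1 theta); exact: evl_poly.
  rewrite /hprod big_nat_recr //= [X in evl _ _ X^-1]big_nat_recr //= invfM.
  exact: (evlM Hna rho0 (bnd_hprod i) (bnd_hinv (ltn0Sn i)) rho_theta IH (evl_hinv (ltn0Sn i))).
have ev N : evl (lsum N) theta (Lpartial q theta n u N).
  apply: (evl_sum Hna) => i _; rewrite /Lterm -exprVn.
  apply: (evlM Hna rho0 (bnd_twist i) (bndX Hna rho0 n (bnd_hprod i)) rho_theta (evl_poly Hna _ _)).
  exact: (evlX Hna rho0 n (bnd_hprod i) rho_theta (evp i)).
have [y hy] := evl_ex Hna rho0 Hcomplete hB rho_theta.
by rewrite (cvg_abs_unique Hna hl (ncvg_evl Hna rho0 hf rho_theta hB ev hy)).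
Qed.

End Deformation.
End Radius.
End Construct.

(** * From functions to values *)

Section Values.
Variables (R : realType) (C : closedFieldType) (abs : C -> R) (p e : nat) (theta : C).
Local Notation q := (p ^ e)%N.
Hypothesis hp : p \in [pchar C].
Hypothesis e0 : (0 < e)%N.
Hypothesis Hna : nonarch_abs abs.
Hypothesis theta1 : 1 < abs theta.
Hypothesis Hinf : forall a : {poly C}, polyFq q a -> a != 0 ->
  abs a.[theta] = abs theta ^+ (size a).-1.
Hypothesis Hcomplete : forall s, cauchy_abs abs s -> exists l, cvg_abs abs s l.
Local Notation phi := (ser_map (frob e hp 1)).
Local Notation evl := (evl abs).
Local Notation bnd := (bnd abs).
Local Notation T := ('X - (theta ^+ q)%:P : {poly C}).

Section Good.
Variables (Sz : nat -> C -> Prop) (kappa : R) (c : nat) (a : C) (da : nat).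
Hypothesis hO : height_order abs Sz kappa c.
Hypothesis Sza : Sz da a.
Hypothesis hda : (c <= da)%N.
Hypothesis Sz1 : Sz da 1.

(** [a ^+ x] clears the denominators of [P]. The height is left unspecified, because the system is
    fixed before any estimate; [c <= d] guarantees that zero coefficients have height [d]. *)
Definition good (x : nat) (P : {poly C}) : Prop := exists2 d, (c <= d)%N & polySz Sz d (a ^+ x *: P).

Lemma good_mul x y P Q : good x P -> good y Q -> good (x + y) (P * Q).
Proof.
move=> [d cd hP] [d' cd' hQ]; exists (d + d')%N; first by apply: leq_trans cd (leq_addr _ _).
rewrite exprD -scalerA scalerAr scalerAl; apply: (polySzM hO) => //.
exact: leq_trans cd (leq_addr _ _).
Qed.

Lemma good_le x y P : (x <= y)%N -> good x P -> good y P.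
Proof.
move=> xy [d cd hP]; have [<-|xy'] := eqVneq x y; first by exists d.
exists (da * (y - x) + d)%N; first by apply: leq_trans cd (leq_addl _ _).
move=> k; rewrite coefZ -[X in _ ^+ X](subnK xy) exprD -mulrA -coefZ; apply: (hoM hO) => //.
by apply: (SzX hO) => //; rewrite subn_gt0 ltn_neqAle xy' xy.
Qed.

Lemma good1 : good 0 1.
Proof.
exists da => // k; rewrite expr0 scale1r coef1; case: eqP => _ //.
exact: (Sz0 hO).
Qed.

Lemma good_exp x P k : good x P -> good (x * k) (P ^+ k).
Proof.
move=> h; elim: k => [|k IH]; first by rewrite muln0 expr0; apply: good1.
by rewrite mulnS exprS; apply: good_mul.
Qed.

Lemma good_nat m : good 0 (m%:R).
Proof.
elim: m => [|m [d cd IH]].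
  by exists da => // k; rewrite scaler0 coef0; apply: (Sz0 hO).
exists (da + d)%N; first by apply: leq_trans cd (leq_addl _ _).
have [d1 cd1 h1] := good1.
move=> k; rewrite -addn1 natrD scalerDr coefD; apply: (hoD hO).
  by apply: (ho_le hO) (IH k); apply: leq_addl.
rewrite expr0 scale1r coef1; case: eqP => _; last by apply: (Sz0 hO); apply: leq_trans cd (leq_addl _ _).
by apply: (ho_le hO) Sz1; apply: leq_addr.
Qed.

Lemma good_prod n (F : 'I_n -> {poly C}) (x : 'I_n -> nat) :
  (forall i, good (x i) (F i)) -> good (\sum_i x i) (\prod_i F i).
Proof.
move=> h; elim/big_rec2: _ => [|i y P _ hP]; first exact: good1.
exact: good_mul.
Qed.

End Good.

Lemma inKbar0 : inKbar q theta 0.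
Proof.
exists 'X; split; rewrite ?polyX_eq0 //; last by rewrite /root hornerX.
move=> j; rewrite coefX; case: eqP => _.
  exact: sf1 (inK_subfield hp Hna theta1 Hinf).
exact: sf0 (inK_subfield hp Hna theta1 Hinf).
Qed.

Variables (n : nat) (w : 'I_n -> nat) (v : 'I_n -> {poly C}) (f : 'I_n -> series C) (vl : 'I_n -> C).
Variable rho : R.
Hypothesis rho_theta : abs theta < rho.
Hypothesis hv : forall k, exists2 u, polyKbar q theta u & v k = - u.
Hypothesis hf : forall k, exists B, bnd B rho (f k).
Hypothesis f_phi : forall k, phi (f k) = ser_poly (T ^+ w k) * (f k + ser_poly (v k)).
Hypothesis f_val : forall k, evl (f k) theta (vl k).
Hypothesis f_free : forall b (P : 'X_{1..n} -> {poly C}), fsupp b P -> is_rel f b P ->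
  forall m, P m = 0.

Lemma mpow_bnd_evl (m : 'X_{1..n}) : (exists B, bnd B rho (mpow f m)) /\ evl (mpow f m) theta (mpow vl m).
Proof.
have r0 : 0 < rho by apply: lt_trans rho_theta; apply: lt_trans theta1.
rewrite /mpow; elim: (index_enum _) => [|k s [[B hB] IH]].
  rewrite !big_nil; split; first by exists 1; apply: bnd1.
  rewrite -(rmorph1 (@ser_poly C)) -(hornerC 1 theta); exact: evl_poly.
rewrite !big_cons; have [D hD] := hf k; split.
  by exists (D ^+ m k * B); apply: (bndM Hna r0) => //; apply: (bndX Hna r0).
apply: (evlM Hna r0 (bndX Hna r0 (m k) hD) hB rho_theta _ IH).
exact: (evlX Hna r0 (m k) hD rho_theta (f_val k)).
Qed.

Lemma mpoly_value_neq0 (F : {mpoly C[n]}) : (forall m, inKbar q theta F@_m) -> F != 0 ->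
  F.@[vl] != 0.
Proof.
move=> hF F0; set b := msize F.
have b0 : (0 < b)%N by rewrite lt0n msize_poly_eq0.
have r0 : 0 < rho by apply: lt_trans rho_theta; apply: lt_trans theta1.
have r1 : 1 < rho by apply: lt_trans rho_theta.
have q1 := q_gt1 hp e0.
have [u hu] : exists u : 'I_n -> {poly C}, forall k, polyKbar q theta (u k) /\ v k = - u k.
  have h k : exists u, polyKbar q theta u /\ v k = - u by have [u hu ->] := hv k; exists u.
  by have [u hu] := choice h; exists u.
pose Z := [seq (F@_(m : 'X_{1..n < b}))  | m : 'X_{1..n < b}] ++
          flatten [seq (u k : seq C) | k : 'I_n].
have [Sz [kappa [c [d0 [a [hO hpoly aF a0 hZ]]]]]] : exists (Sz : nat -> C -> Prop) (kappa : R) (c d0 : nat) (a : {poly C}),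
    [/\ height_order abs Sz kappa c,
        forall P : {poly C}, polyFq q P -> Sz (size P + c)%N P.[theta],
        polyFq q a, a != 0 & forall z, z \in Z -> Sz d0 (a.[theta] * z)].
  apply: (height_order_ex hp e0 Hna theta1 Hinf) => z.
  rewrite mem_cat => /orP[/mapP[m _ ->]|/flattenP[s /mapP[k _ ->]]]; first exact: hF.
  by move=> /(nthP 0)[j _ <-]; case: (hu k) => + _; apply.
set at_ := a.[theta] in hZ.
have at0 : at_ != 0 by apply: (polyFq_theta0 Hna theta1 Hinf).
pose d1 := (size a + 2 + c + d0)%N.
have cd1 : (c <= d1)%N by rewrite /d1; lia.
have Sz1 : Sz d1 1.
  have := hpoly 1 (polyFq1 e hp); rewrite hornerC; apply: (ho_le hO).
  by rewrite size_poly1 /d1; lia.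
have SzT : Sz d1 theta.
  have := hpoly 'X (polyFqX e hp); rewrite hornerX; apply: (ho_le hO).
  by rewrite size_polyX /d1; lia.
have Sza : Sz d1 at_ by apply: (ho_le hO) (hpoly a aF); rewrite /d1; lia.
pose gd := good Sz c at_.
have gT : gd 0%N T.
  exists (d1 * q + d1)%N; first by apply: leq_trans cd1 (leq_addl _ _).
  move=> k; rewrite expr0 scale1r coefB coefX coefC; apply: (hoD hO).
    case: eqP => _; first by apply: (ho_le hO) Sz1; apply: leq_addl.
    by apply: (Sz0 hO); apply: leq_trans cd1 (leq_addl _ _).
  apply: (hoN hO); case: eqP => _; last by apply: (Sz0 hO); apply: leq_trans cd1 (leq_addl _ _).
  apply: (ho_le hO) (SzX hO (ltnW q1) SzT); exact: leq_addr.
have gv k : gd 1%N (v k).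
  exists (d0 + c)%N; first exact: leq_addl.
  move=> j; rewrite expr1 coefZ; have [_ ->] := hu k; rewrite coefN mulrN; apply: (hoN hO).
  have [jk|kj] := ltnP j (size (u k)); last first.
    by rewrite nth_default // mulr0; apply: (Sz0 hO); apply: leq_addl.
  apply: (ho_le hO (leq_addr _ _)); apply: hZ; rewrite mem_cat; apply/orP; right.
  by apply/flattenP; exists (u k : seq C); [apply/mapP; exists k; rewrite ?mem_enum|apply: mem_nth].
(* The matrix of the twist on monomials, from [mpow_phi]. Its row [m] has degree at most [mdeg m] in
   the [v k], the only source of denominators. *)
pose E m g : {poly C} := (mbin m g)%:R * mpowB v m g * T ^+ wdot w m.
have gE (m g : 'X_{1..n}) : gd (mdeg m) (E m g).
  apply: (good_le (x := 0 + \sum_i (1 * (m i - g i)) + 0 * wdot w m) hO Sza).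
    by rewrite add0n mul0n addn0 mdegE; apply: leq_sum => i _; rewrite mul1n leq_subr.
  apply: (good_mul hO); last exact: (good_exp hO cd1 Sz1 _ gT).
  apply: (good_mul hO); first exact: (good_nat _ hO cd1 Sz1).
  by apply: (good_prod hO cd1 Sz1) => i; apply: (good_exp hO cd1 Sz1 _ (gv i)).
(* The scaling factor [A] clears the denominators of the difference system,
   since [phi (A psi) = A^q phi psi]. *)
pose A := at_ ^+ b.
have A0 : A != 0 by rewrite expf_neq0.
pose J := 'X_{1..n < b}.
pose Phi (m g : J) : {poly C} := A ^+ q.-1 *: E m g.
pose psi (m : J) : series C := ser_poly A%:P * mpow f m.
have gPhi (mg : J * J) : exists d, polySz Sz d (Phi mg.1 mg.2).
  have [|d _ h] := good_le (y := (b * q.-1)%N) hO Sza _ (gE mg.1 mg.2).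
    apply: leq_trans (ltnW (bmdeg mg.1)) _; rewrite leq_pmulr // -ltnS prednK //; exact: ltnW.
  by exists d; rewrite /Phi /A -exprM.
have [dP hdP] := choice gPhi.
pose c0 := (\max_mg dP mg + d1 + (d1 + d0))%N.
have Phi_Sz i j : polySz Sz c0 (Phi i j).
  move=> k; apply: (ho_le hO) (hdP (i, j) k); rewrite /c0.
  by apply: leq_trans (leq_addr _ _); apply: leq_trans (leq_addr _ _); apply: (leq_bigmax (i, j)).
pose lam (m : J) := at_ * F@_m.
have lam_Sz m : Sz c0 (lam m).
  apply: (ho_le hO (d := d0)); first by rewrite /c0; lia.
  by apply: hZ; rewrite mem_cat; apply/orP; left; apply/mapP; exists m; rewrite ?mem_enum.
have bJ (m : J) : exists B, bnd B rho (psi m).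
  have [[B hB] _] := mpow_bnd_evl m; have [D hD] := bnd_poly_ex Hna r0 A%:P.
  by exists (D * B); apply: (bndM Hna r0).
have [BJ hBJ] := choice bJ.
have BJ0 m : 0 <= BJ m by apply: (bnd_ge0 Hna r0 (hBJ m)).
pose B := 1 + \sum_m BJ m.
have B1 : 1 <= B by rewrite lerDl sumr_ge0.
have psi_bnd m : bnd B rho (psi m).
  apply: bnd_le (hBJ m); rewrite /B (bigD1 m) //= addrCA lerDl addr_ge0 // sumr_ge0 //.
have psi_val m : evl (psi m) theta (A * mpow vl m).
  have [[B' hB'] hv'] := mpow_bnd_evl m; have [D hD] := bnd_poly_ex Hna r0 A%:P.
  by rewrite -{1}(hornerC A theta); apply: (evlM Hna r0 hD hB' rho_theta (evl_poly Hna _ _)).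
have psi_phi m : phi (psi m) = \sum_g ser_poly (Phi m g) * psi g.
  rewrite rmorphM /= ser_map_poly map_polyC /= frob1 (mpow_phi f_phi (bmdeg m)) mulr_sumr.
  apply: eq_bigr => g _; rewrite /psi /Phi -/(E m g); move: (E m g) => x.
  rewrite -mul_polyC !mulrA -!rmorphM; congr (ser_poly _ * _).
  by rewrite [RHS]mulrAC -polyCM -exprSr prednK // ltnW.
have psi_free (P : J -> {poly C}) : \sum_j ser_poly (P j) * psi j = 0 -> forall j, P j = 0.
  move=> hP j.
  pose P' (m : 'X_{1..n}) : {poly C} := if insub m is Some m' then A *: P m' else 0.
  have P'E (m : J) : P' m = A *: P m by rewrite /P' valK.
  have : P' j = 0.
    apply: (f_free (b := b)) => [m bm|].
      by rewrite /P' insubF // ltnNge bm.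
    rewrite /is_rel -[RHS]hP; apply: eq_bigr => m _.
    by rewrite P'E /psi -mul_polyC rmorphM /= mulrCA mulrA.
  by rewrite P'E => /eqP; rewrite scaler_eq0 (negPf A0) => /eqP.
have lam0 : exists m, lam m != 0.
  have [m hm] : exists m, m \in msupp F.
    apply: contrapT => /forallNP h; case/eqP: F0; apply/mpolyP => m.
    by rewrite mcoeff0; apply/eqP; rewrite mcoeff_eq0; apply/negP/h.
  have mb := msize_mdeg_lt hm.
  by exists (BMultinom mb); rewrite mulf_neq0 //= -mcoeff_msupp.
have cc0 : (c <= c0)%N by rewrite /c0; lia.
have Sz1' : Sz c0 1 by apply: (ho_le hO) Sz1; rewrite /c0; lia.
have SzT' : Sz c0 theta by apply: (ho_le hO) SzT; rewrite /c0; lia.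
have := weak_abp e0 Hna theta1 Hcomplete hO B1 rho_theta psi_bnd psi_free psi_phi psi_val
  cc0 Sz1' SzT' Phi_Sz lam_Sz lam0.
have -> : \sum_j lam j * (A * mpow vl j) = at_ * A * F.@[vl].
  rewrite [in RHS](mpolywE (leqnn (msize F))) raddf_sum /= mulr_sumr; apply: eq_bigr => m _.
  by rewrite mevalZ mevalX -/(mpow vl m) /lam mulrACA.
by rewrite !mulf_eq0 (negPf at0) (negPf A0).
Qed.

End Values.

(** The norm condition is stated after raising to the power [q - 1], which removes the fractional
    exponent. As [Hnp] ranges over ordered pairs, natural exponents cover all integral powers of
    [p]. *)
Theorem theorem4p2 (R : realType) (C : closedFieldType) (abs : C -> R)
  (p q : nat) (theta : C)
  (HC : Cinfty_model abs q theta p)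
  (xi : C) (Hxi : xi ^+ (q - 1) = - theta)
  (pit : C) (Hpit : cvg_abs abs (pi_partial q theta xi) pit)
  (d : nat) (n : 'I_d -> nat) (r : 'I_d -> nat)
  (u : forall i : 'I_d, 'I_(r i) -> {poly C})
  (L : forall i : 'I_d, 'I_(r i) -> C)
  (Hn : forall i, (0 < n i)%N)
  (Hnp : forall i j : 'I_d, i != j -> forall k : nat, n i <> (n j * p ^ k)%N)
  (Hu : forall i j, polyKbar q theta (u i j))
  (Hnorm : forall i j, normp abs (u i j) ^+ (q - 1) < abs theta ^+ (n i * q))
  (HL : forall i j, cvg_abs abs (Lpartial q theta (n i) (u i j)) (L i j))
  (Hlin : forall i : 'I_d,
     lin_indep_over (inK q theta)
       (fun k : option 'I_(r i) =>
          match k with None => pit ^+ n i | Some j => L i j end)) :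
  alg_indep_over (inKbar q theta)
    (fun k : option {i : 'I_d & 'I_(r i)} =>
       match k with None => pit | Some (existT i j) => L i j end).
Proof.
case: HC => -[pp hp] [e [e0 qE]] [Hna theta1] Hinf [Hcomplete _]; subst q.
have q1 := q_gt1 hp e0; have t0 : 0 < abs theta by apply: lt_trans theta1.
(* Any radius strictly between [abs theta], the point of evaluation, and the first pole at
   [abs theta ^+ q] would do. *)
pose rho : R := (abs theta + abs theta ^+ (p ^ e)) / 2.
have ltq : abs theta < abs theta ^+ (p ^ e) by rewrite -{1}[abs theta]expr1 ltr_eXn2l.
have rho_theta : abs theta < rho by rewrite /rho; lra.
have rho_lt : rho < abs theta ^+ (p ^ e) by rewrite /rho; lra.
have [Pi [Om [bPi bOm PO phiPi evPi]]] :=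
  carlitz_period hp e0 Hna theta1 Hcomplete rho_theta rho_lt Hxi Hpit.
pose T : {poly C} := 'X - (theta ^+ (p ^ e))%:P.
pose S := {i : 'I_d & 'I_(r i)}.
have [fs hfs] : exists fs : S -> series C, forall s : S, [/\ exists B, bnd abs B rho (fs s),
    ser_map (frob e hp 1) (fs s) = ser_poly (T ^+ n (tag s)) * (fs s + ser_poly (- u (tag s) (tagged s)))
    & evl abs (fs s) theta (L (tag s) (tagged s))].
  have h (s : S) : exists f : series C, [/\ exists B, bnd abs B rho f,
      ser_map (frob e hp 1) f = ser_poly (T ^+ n (tag s)) * (f + ser_poly (- u (tag s) (tagged s)))
      & evl abs f theta (L (tag s) (tagged s))].
    exact: (deformation_series hp e0 Hna theta1 Hcomplete rho_theta rho_lt (Hnorm _ _) (HL _ _)).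
  by have [fs hfs] := choice h; exists fs.
set x := fun k : option _ => _.
have xE (s : S) : x (Some s) = L (tag s) (tagged s) by case: s.
pose w (k : 'I_#|{: option S}|) : nat := if enum_val k is Some s then n (tag s) else 1%N.
pose v (k : 'I_#|{: option S}|) : {poly C} :=
  if enum_val k is Some s then - u (tag s) (tagged s) else 0.
pose f (k : 'I_#|{: option S}|) : series C := if enum_val k is Some s then fs s else Pi.
pose z0 : 'I_#|{: option S}| := enum_rank None.
have kS k : k != z0 -> exists s : S, enum_val k = Some s.
  move=> kz; case E : (enum_val k) => [s|]; first by exists s.
  by case/eqP: kz; rewrite /z0 -E enum_valK.
have hf k : exists B, bnd abs B rho (f k).
  by rewrite /f; case: (enum_val k) => // s; case: (hfs s).
have f_phi k : ser_map (frob e hp 1) (f k) = ser_poly (T ^+ w k) * (f k + ser_poly (v k)).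
  rewrite /f /w /v; case: (enum_val k) => [s|]; first by case: (hfs s).
  by rewrite rmorph0 addr0 expr1.
have f_val k : evl abs (f k) theta (x (enum_val k)).
  by rewrite /f; case: (enum_val k) => [s|] //; rewrite xE; case: (hfs s).
have w0 k : (0 < w k)%N by rewrite /w; case: (enum_val k).
(* By symmetry [a <= b], and cancelling [p^a] gives [n i = n j p^(b-a)]. Hence variables of equal
   weight, the period aside, belong to the same index [i]. *)
have same_group (i j : 'I_d) a b : (n i * p ^ a = n j * p ^ b)%N -> i = j.
  move=> E; apply/eqP/negPn/negP => ij.
  wlog ab : i j a b E ij / (a <= b)%N.
    move=> H; case: (leqP a b) => [|/ltnW] h; first exact: (H i j a b).
    by apply: (H j i b a); rewrite // eq_sym.
  apply: (Hnp _ _ ij (b - a)%N); apply/eqP.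
  have pa0 : (0 < p ^ a)%N by rewrite expn_gt0 prime_gt0.
  by rewrite -(eqn_pmul2r pa0) E -mulnA -expnD subnK.
have Hw k l a b : k != z0 -> l != z0 -> (w k * p ^ a = w l * p ^ b)%N -> w k = w l.
  by move=> /kS[s hs] /kS[s' hs']; rewrite /w hs hs' => /same_group ->.
have Hfin k0 (c : 'I_#|{: option S}| -> {poly C}) Q : k0 != z0 ->
    (forall k, polyFq (p ^ e) (c k)) ->
    map_poly (frob e hp 1) Q =
      T ^+ w k0 * (Q - \sum_(k | (k != z0) && (w k == w k0)) c k * v k) -> c k0 = 0.
  move=> k0z hc hQ.
  pose G := [pred k | (k != z0) && (w k == w k0)].
  have fG k : G k -> ser_map (frob e hp 1) (f k) = ser_poly (T ^+ w k0) * (f k + ser_poly (v k)).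
    by move=> /andP[_ /eqP <-].
  have [g gF] := twist_eigen_relation e0 Hna theta1 rho_theta hf bPi bOm PO phiPi fG
     f_val evPi hc (w0 k0) hQ.
  have [[i0 j0] hk0] := kS _ k0z.
  have wk0 : w k0 = n i0 by rewrite /w hk0.
  (* [h] enumerates the variables of weight [w k0] other than the period, and [h'] inverts it; this
     rewrites the relation in terms of the values [L i0 j]. *)
  pose h (j : 'I_(r i0)) : 'I_#|{: option S}| := enum_rank (Some (Tagged (fun i => 'I_(r i)) j)).
  pose h' (k : 'I_#|{: option S}|) : 'I_(r i0) :=
    if enum_val k is Some s then tagged_as (Tagged (fun i => 'I_(r i)) j0) s else j0.
  have hz j : h j != z0 by apply/eqP => /enum_rank_inj.
  have hG j : (h j != z0) && (w (h j) == w k0) by rewrite hz /w enum_rankK hk0 /=.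
  rewrite (reindex h) /=; last first.
    exists h' => [j _|k /andP[kz /eqP]]; first by rewrite /h' /h enum_rankK tagged_asE.
    have [[i j] hk] := kS _ kz; rewrite wk0 /w hk /= => nij.
    have ij : i = i0 by apply: (same_group _ _ 0%N 0%N); rewrite nij.
    by subst i; rewrite /h' hk /h tagged_asE -hk enum_valK.
  under eq_bigl => j do rewrite hG.
  move=> rel.
  have HKp := inK_poly theta hp.
  have hk0E : h j0 = k0 by rewrite /h -hk0 enum_valK.
  (* The relation between values as a linear form over [K]: [pit ^+ n i0] receives the coefficient
     [- g.[theta]], so independence gives [(c k0).[theta] = 0], and [c k0 = 0] since it lies in
     [F_q[t]]. *)
  pose cf (k : option 'I_(r i0)) : C := if k is Some j then (c (h j)).[theta] else - g.[theta].
  have cfK k : inK (p ^ e) theta (cf k).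
    case: k => [j|] /=; first exact: HKp.
    by rewrite -hornerN; apply: HKp; apply: (polyFqN hp).
  have cf0 : \sum_k cf k * match k with None => pit ^+ n i0 | Some j => L i0 j end = 0.
    rewrite (bigD1 None) //= mulNr -wk0 -rel addrC.
    rewrite (reindex_omap Some id) /=; last by case.
    apply/eqP; rewrite subr_eq0; apply/eqP; apply: eq_big => [j|j _]; first by rewrite eqxx.
    by rewrite /h enum_rankK.
  have := Hlin i0 cf cfK cf0 (Some j0); rewrite /= hk0E => ck0.
  apply/eqP/negPn/negP => /(polyFq_theta0 Hna theta1 Hinf (hc k0)).
  by rewrite ck0 eqxx.
have sizeT : size T = 2%N by rewrite size_XsubC.
have vz0 : v z0 = 0 by rewrite /v enum_rankK.
have fz0 : f z0 * Om = 1 by rewrite /f enum_rankK.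
have f_free := fun b P => rel_zero e0 sizeT w0 vz0 Hw Hfin f_phi fz0 (b := b) (P := P).
have hv k : exists2 u', polyKbar (p ^ e) theta u' & v k = - u'.
  rewrite /v; case: (enum_val k) => [s|]; first by exists (u (tag s) (tagged s)).
  by exists 0; rewrite ?oppr0 // => j; rewrite coef0; apply: (inKbar0 hp Hna theta1 Hinf).
move=> F hF F0.
exact: (mpoly_value_neq0 e0 Hna theta1 Hinf Hcomplete rho_theta hv hf f_phi f_val f_free hF F0).
Qed.
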